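(* Let $0<\mu\le1$, and let either $1\le p\le\infty$ and $0<\ell<N$, or $p=1$ and $\ell=N$. Then there exist $u_0\in\dot M^{p,\ell}(\mathbb{R}^N)$ and a constant $c>0$ such that $$\|S_\mu(t)u_0\|_{M^{p,\ell}(\mathbb{R}^N)}=c,\quad t>0.$$
   Context: Morrey spaces: for $1\le p<\infty$, $0\le \ell\le N$, $M^{p,\ell}(\mathbb{R}^N)$ is the space of $\phi\in L^p_{loc}(\mathbb{R}^N)$ with $\|\phi\|_{M^{p,\ell}}:=\sup_{x_0\in\mathbb{R}^N,R>0}R^{\frac{\ell-N}{p}}\|\phi\|_{L^p(B(x_0,R))}<\infty$; $M^{\infty,\ell}(\mathbb{R}^N):=L^\infty(\mathbb{R}^N)$. The dotted space $\dot M^{p,\ell}(\mathbb{R}^N)$ is the subspace of those $\phi\in M^{p,\ell}(\mathbb{R}^N)$ with $\phi(\cdot-y)-\phi\to0$ in $M^{p,\ell}(\mathbb{R}^N)$ as $y\to0$. Fractional heat semigroup (for $u_t+(-\Delta)^\mu u=0$): $S_\mu(t)u_0(x)=\int_{\mathbb{R}^N}k_\mu(t,x-y)u_0(y)\,dy$, $k_\mu(t,x)=(2\pi)^{-N}\int_{\mathbb{R}^N}e^{ix\cdot\xi-t|\xi|^{2\mu}}\,d\xi$, $t>0$. *)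

(* Defs.v *)
From HB Require Import structures.
From mathcomp Require Import all_boot all_order all_algebra.
From mathcomp Require Import all_classical all_reals all_analysis.
From mathcomp Require Import measurable_realfun.
From mathcomp Require Import complex.

Set Implicit Arguments.
Unset Strict Implicit.
Unset Printing Implicit Defensive.
Import Order.TTheory GRing.Theory Num.Theory.
Import numFieldNormedType.Exports.

Local Open Scope classical_set_scope.
Local Open Scope ring_scope.

(* The Borel sigma-algebra of R^n, generated by the coordinate functions. *)
Section measurable_rV.
Context {d : measure_display} {T : measurableType d} {n : nat}.

Let coord : 'I_n -> 'rV[T]_n -> T := fun i x => x ord0 i.

Let rV_set0 : g_sigma_preimage coord set0.
Proof. exact: sigma_algebra0. Qed.

Let rV_setC A : g_sigma_preimage coord A -> g_sigma_preimage coord (~` A).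
Proof. exact: sigma_algebraC. Qed.

Let rV_bigcup (F : _^nat) : (forall i, g_sigma_preimage coord (F i)) ->
  g_sigma_preimage coord (\bigcup_i (F i)).
Proof. exact: sigma_algebra_bigcup. Qed.

HB.instance Definition _ := @isMeasurable.Build (measure_tuple_display d)
  'rV[T]_n (g_sigma_preimage coord) rV_set0 rV_setC rV_bigcup.

Lemma measurable_coord (i : 'I_n) :
  measurable_fun [set: 'rV[T]_n] (fun x => x ord0 i).
Proof.
move=> _ Y mY; rewrite setTI; apply: sub_sigma_algebra => /=.
rewrite -bigcup_seq/=; exists i => /=; first by rewrite mem_index_enum.
by exists Y => //; rewrite setTI.
Qed.

Lemma measurable_fun_rV {d' : measure_display} {S : measurableType d'}
    (f : S -> 'rV[T]_n) :
  (forall i, measurable_fun [set: S] (fun s => f s ord0 i)) ->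
  measurable_fun [set: S] f.
Proof.
move=> mf _ Y mY; rewrite setTI.
suff: g_sigma_preimage coord `<=` [set A | measurable (f @^-1` A)] by exact.
apply: smallest_sub.
  split=> /=; first by rewrite preimage_set0.
  - by move=> A mA; rewrite setTD preimage_setC; exact: measurableC.
  - by move=> F mF; rewrite preimage_bigcup; exact: bigcup_measurable.
rewrite -bigcup_seq/=; apply: bigcup_sub => i _ _ [B mB <-] /=.
rewrite setTI -comp_preimage -[X in measurable X]setTI.
exact: mf.
Qed.

End measurable_rV.

(* Lebesgue measure on R^n, by recursion on n: the point mass on R^0, and the
   product of the Lebesgue measures of R and R^n on R^(n+1) = R x R^n. *)
Section lebesgue_rV.
Context {R : realType}.

Section step.
Variable n : nat.

Definition rV_cons (z : measurableTypeR R * 'rV[R]_n) : 'rV[R]_n.+1 :=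
  row_mx (const_mx z.1 : 'rV[R]_1) z.2.

Definition rV_uncons (x : 'rV[R]_n.+1) : measurableTypeR R * 'rV[R]_n :=
  (x ord0 ord0, \row_i x ord0 (lift ord0 i)).

Lemma rV_cons0 z : rV_cons z ord0 ord0 = z.1.
Proof.
rewrite /rV_cons (_ : ord0 = lshift n (ord0 : 'I_1)) ?(@row_mxEl _ 1 1) ?mxE//.
exact: val_inj.
Qed.

Lemma rV_consS z i : rV_cons z ord0 (lift ord0 i) = z.2 ord0 i.
Proof.
rewrite /rV_cons (_ : lift ord0 i = rshift 1 i) ?(@row_mxEr _ 1 1)//.
exact: val_inj.
Qed.

Lemma rV_consK : cancel rV_cons rV_uncons.
Proof.
move=> [a y]; rewrite /rV_uncons rV_cons0; congr pair.
by apply/rowP => i; rewrite mxE rV_consS.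
Qed.

Lemma measurable_rV_cons : measurable_fun setT rV_cons.
Proof.
apply: measurable_fun_rV => i; case: (unliftP ord0 i) => [j|] ->.
  under eq_fun do rewrite rV_consS.
  exact: (measurableT_comp (measurable_coord j) measurable_snd).
by under eq_fun do rewrite rV_cons0; exact: measurable_fst.
Qed.

Lemma measurable_rV_uncons : measurable_fun setT rV_uncons.
Proof.
apply/measurable_fun_pairP; split; first exact: measurable_coord.
apply: measurable_fun_rV => i /=; under eq_fun do rewrite mxE.
exact: measurable_coord.
Qed.

Variable m : {sigma_finite_measure set 'rV[R]_n -> \bar R}.

Definition lebesgue_rV_step : set 'rV[R]_n.+1 -> \bar R :=
  pushforward (@lebesgue_measure R \x m)%E rV_cons.

Let step0 : lebesgue_rV_step set0 = 0%E.
Proof. by rewrite /lebesgue_rV_step /pushforward preimage_set0 measure0. Qed.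

Let step_ge0 A : (0 <= lebesgue_rV_step A)%E.
Proof. by rewrite /lebesgue_rV_step /pushforward; exact: measure_ge0. Qed.

Let step_sigma_additive : semi_sigma_additive lebesgue_rV_step.
Proof.
have mpre A : measurable A -> measurable (rV_cons @^-1` A).
  by move=> mA; rewrite -[X in measurable X]setTI; exact: measurable_rV_cons.
move=> F mF tF mUF; rewrite /lebesgue_rV_step /pushforward preimage_bigcup.
apply: measure_semi_sigma_additive.
- by move=> k; exact: mpre.
- apply/trivIsetP => /= i j _ _ ij; rewrite -preimage_setI.
  by move/trivIsetP : tF => /(_ _ _ _ _ ij) ->//; rewrite preimage_set0.
- by rewrite -preimage_bigcup; exact: mpre.
Qed.

HB.instance Definition _ := isMeasure.Build _ _ _ lebesgue_rV_step
  step0 step_ge0 step_sigma_additive.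

Let sigma_finite_step : sigma_finite setT lebesgue_rV_step.
Proof.
have /sigma_finiteP[F [FT ndF mF]] := sigma_finiteT (@lebesgue_measure R).
have /sigma_finiteP[G [GT ndG mG]] := sigma_finiteT m.
exists (fun k => rV_uncons @^-1` (F k `*` G k)).
  rewrite -preimage_bigcup; apply/esym/seteqP; split => // x _ /=.
  have [i _ Fi] : (\bigcup_k F k) (rV_uncons x).1 by rewrite -FT.
  have [j _ Gj] : (\bigcup_k G k) (rV_uncons x).2 by rewrite -GT.
  exists (maxn i j) => //; split.
    by move: Fi; exact/subsetPset/ndF/leq_maxl.
  by move: Gj; exact/subsetPset/ndG/leq_maxr.
move=> k; have [mFk Fkoo] := mF k; have [mGk Gkoo] := mG k; split.
  rewrite -[X in measurable X]setTI; apply: measurable_rV_uncons => //.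
  exact: measurableX.
rewrite /lebesgue_rV_step /pushforward -comp_preimage.
rewrite (_ : rV_uncons \o rV_cons = id); last first.
  by apply/funext => z; exact: rV_consK.
by rewrite preimage_id product_measure1E// lte_mul_pinfty// ge0_fin_numE.
Qed.

HB.instance Definition _ := @Measure_isSigmaFinite.Build _ _ _ lebesgue_rV_step
  sigma_finite_step.

End step.

Fixpoint lebesgue_rV (n : nat) : {sigma_finite_measure set 'rV[R]_n -> \bar R} :=
  match n with
  | 0 => \d_(0 : 'rV[R]_0)
  | n'.+1 => lebesgue_rV_step (lebesgue_rV n')
  end.

Lemma lebesgue_rV_box (n : nat) (A : 'I_n -> set R) :
  (forall i, measurable (A i)) ->
  lebesgue_rV n [set x | forall i, A i (x ord0 i)] =
  (\prod_(i < n) lebesgue_measure (A i))%E.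
Proof.
elim: n A => [|n IH] A mA.
  rewrite big_ord0 (_ : [set _ | _] = setT); first exact: diracT.
  by apply/seteqP; split => // x _ [].
transitivity ((@lebesgue_measure R \x lebesgue_rV n)%E (rV_cons (n:=n) @^-1`
    [set x | forall i, A i (x ord0 i)])); first by [].
rewrite big_ord_recl -IH// -product_measure1E//.
  congr (_ _); apply/seteqP; split => -[a y]/=.
  - move=> Ay; split => [|i]/=; first by have := Ay ord0; rewrite rV_cons0.
    by have := Ay (lift ord0 i); rewrite rV_consS.
  - move=> [/= Aa Ay] i; case: (unliftP ord0 i) => [j|] ->.
    + by rewrite rV_consS; exact: Ay.
    + by rewrite rV_cons0.
- exact: mA.
rewrite (_ : (fun _ => _) = \bigcap_(i in [set: 'I_n])
    ((fun x : 'rV[R]_n => x ord0 i) @^-1` A (lift ord0 i))).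
  apply: fin_bigcap_measurable => // i _.
  by rewrite -[X in measurable X]setTI; exact: measurable_coord.
by apply/seteqP; split => [x Ax i _|x Ax i]; exact: Ax.
Qed.

Lemma measurable_rV_opp (n : nat) : measurable_fun setT (-%R : 'rV[R]_n -> _).
Proof.
apply: measurable_fun_rV => i; under eq_fun do rewrite mxE.
exact: measurableT_comp (measurable_coord i).
Qed.

Lemma lebesgue_rV_opp (n : nat) (A : set 'rV[R]_n) :
  measurable A -> lebesgue_rV n (-%R @^-1` A) = lebesgue_rV n A.
Proof.
elim: n A => [|n IH] A mA /=.
  by rewrite /dirac !indicE; congr (_%:R%:E); congr (nat_of_bool _);
    apply/idP/idP; rewrite !inE /= oppr0.
pose mu1 := @lebesgue_measure R; pose m := lebesgue_rV n.
pose o (z : measurableTypeR R * 'rV[R]_n) : measurableTypeR R * 'rV[R]_n :=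
  (- z.1, - z.2).
have mN : measurable_fun [set: measurableTypeR R] (-%R : R -> R) by [].
have mo : measurable_fun setT o.
  apply/measurable_fun_pairP; split.
    exact: (measurableT_comp mN measurable_fst).
  exact: (measurableT_comp (@measurable_rV_opp n) measurable_snd).
have opE (B : set 'rV[R]_n.+1) : rV_cons (n:=n) @^-1` (-%R @^-1` B) =
    o @^-1` (rV_cons (n:=n) @^-1` B).
  suff oE z : rV_cons (o z) = - rV_cons z.
    by apply/seteqP; split => z /=; rewrite oE.
  apply/rowP => i; rewrite [RHS]mxE; case: (unliftP ord0 i) => [j|] ->.
    by rewrite !rV_consS mxE.
  by rewrite !rV_cons0.
rewrite /lebesgue_rV_step /pushforward opE.
pose m' := measure_function_pushforward__canonical__measure_function_Measure
  (mu1 \x m)%E mo.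
have mC : measurable (rV_cons (n:=n) @^-1` A).
  by rewrite -[X in measurable X]setTI; exact: measurable_rV_cons.
rewrite -[LHS]/(m' (rV_cons (n:=n) @^-1` A)); apply/esym.
apply: product_measure_unique => // B C mB mC' /=.
rewrite /pushforward (_ : o @^-1` _ = (-%R @^-1` B) `*` (-%R @^-1` C)); last first.
  by apply/seteqP; split => -[a y].
rewrite product_measure1E//.
- by congr (_ * _)%E; [exact: lebesgue_measureN|exact: IH].
- by rewrite -[X in measurable X]setTI; exact: mN.
- by rewrite -[X in measurable X]setTI; exact: measurable_rV_opp.
Qed.

End lebesgue_rV.

Section euclidean.
Context {R : realType} {N : nat}.
Implicit Types x y : 'rV[R]_N.

Definition dotp x y : R := \sum_(i < N) x ord0 i * y ord0 i.

(* The library's norm on 'rV[R]_N is the sup norm, hence this definition. *)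
Definition enorm x : R := Num.sqrt (dotp x x).

Definition eball x (r : R) : set 'rV[R]_N := [set y | enorm (y - x) < r].

End euclidean.

Section morrey.
Context {R : realType} {N : nat}.
Implicit Types (p : \bar R) (l : R) (phi : 'rV[R]_N -> R).
Local Notation leb := (lebesgue_rV N).

Definition Lp_loc p : set ('rV[R]_N -> R) :=
  [set phi | forall K : set 'rV[R]_N, compact K -> phi \_ K \in Lfun leb p].

(* Only meant for 1 <= p <= +oo; the last branch is the case p = +oo.
   [phi \_ B] is phi on B and 0 elsewhere. *)
Definition morrey_norm p l (phi : 'rV[R]_N -> \bar R) : \bar R :=
  match p with
  | q%:E => ereal_sup [set y | exists x0 : 'rV[R]_N, exists2 r : R, 0 < r &
      y = ((r `^ ((l - N%:R) / q))%:E * 'N[leb]_p[phi \_ (eball x0 r)])%E]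
  | _ => 'N[leb]_p[phi]
  end.

Definition morrey p l : set ('rV[R]_N -> R) :=
  match p with
  | q%:E => [set phi | Lp_loc p phi /\ (morrey_norm p l (EFin \o phi) < +oo)%E]
  | _ => [set phi | phi \in Lfun leb p]
  end.

Definition dotted_morrey p l : set ('rV[R]_N -> R) :=
  [set phi | morrey p l phi /\
    morrey_norm p l (fun x => (phi (x - y) - phi x)%:E) @[y --> (0 : 'rV[R]_N)]
      --> 0%E].

End morrey.

Section fractional_heat.
Context {R : realType}.
Local Open Scope complex_scope.

Definition cexp (z : R[i]) : R[i] :=
  (expR (complex.Re z))%:C * (cos (complex.Im z) +i* sin (complex.Im z)).

Definition cintegral {N : nat} (f : 'rV[R]_N -> R[i]) : R[i] :=
  Rintegral (lebesgue_rV N) setT (fun x => complex.Re (f x)) +i*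
  Rintegral (lebesgue_rV N) setT (fun x => complex.Im (f x)).

Definition frac_heat_fourier {N : nat} (mu t : R) (x : 'rV[R]_N) : R[i] :=
  ((2 * pi) ^- N)%:C *
  cintegral (fun xi : 'rV[R]_N =>
    cexp ('i * (dotp x xi)%:C - (t * enorm xi `^ (2 * mu))%:C)).

(* The Fourier integral is real: see [frac_heat_fourier_real]. *)
Definition frac_heat_kernel {N : nat} (mu t : R) (x : 'rV[R]_N) : R :=
  complex.Re (frac_heat_fourier mu t x).

Lemma dotpN {N : nat} (x y : 'rV[R]_N) : dotp x (- y) = - dotp x y.
Proof. by rewrite /dotp -sumrN; apply: eq_bigr => i _; rewrite mxE mulrN. Qed.

Lemma enormN {N : nat} (x : 'rV[R]_N) : enorm (- x) = enorm x.
Proof.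
rewrite /enorm /dotp; congr Num.sqrt; apply: eq_bigr => i _.
by rewrite !mxE mulrNN.
Qed.

Lemma measurable_dotp {N : nat} (f g : 'rV[R]_N -> 'rV[R]_N) :
  measurable_fun setT f -> measurable_fun setT g ->
  measurable_fun setT (fun y => dotp (f y) (g y)).
Proof.
move=> mf mg; apply: measurable_sum => i; apply: measurable_funM.
- exact: (measurableT_comp (measurable_coord i) mf).
- exact: (measurableT_comp (measurable_coord i) mg).
Qed.

Lemma Rintegral_rV_odd {N : nat} (f : 'rV[R]_N -> R) :
  measurable_fun setT f -> (forall x, f (- x) = - f x) ->
  Rintegral (lebesgue_rV N) setT f = 0.
Proof.
move=> mf fN; rewrite /Rintegral.
have mef : measurable_fun setT (EFin \o f) by exact/measurable_EFinP.
have mN := @measurable_rV_opp R N.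
have posE : (\int[lebesgue_rV N]_x ((EFin \o f)^\+ x) =
             \int[lebesgue_rV N]_x ((EFin \o f)^\- x))%E.
  transitivity (\int[lebesgue_rV N]_x ((EFin \o f)^\+ (- x)%R))%E; last first.
    apply: eq_integral => x _; rewrite funeposE funenegE /= fN.
    by rewrite EFinN.
  pose m' := measure_function_pushforward__canonical__measure_function_Measure
    (lebesgue_rV N) mN.
  rewrite (eq_measure_integral m'); last first.
    by move=> A mA _; rewrite /= /pushforward lebesgue_rV_opp.
  rewrite /= ge0_integral_pushforward//; exact: measurable_funepos.
rewrite integralE posE.
by case: (\int[_]_(x in _) _)%E => [r| |]//=; rewrite subrr.
Qed.

Lemma measurable_enorm {N : nat} : measurable_fun setT (@enorm R N).
Proof.
apply: (measurableT_comp (f := @Num.sqrt R)); last exact: measurable_dotp.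
by apply: continuous_measurable_fun; exact: sqrt_continuous.
Qed.

Lemma frac_heat_symbolE {N : nat} (mu t : R) (x xi : 'rV[R]_N) :
  cexp ('i * (dotp x xi)%:C - (t * enorm xi `^ (2 * mu))%:C) =
  (expR (- (t * enorm xi `^ (2 * mu))) * cos (dotp x xi)) +i*
  (expR (- (t * enorm xi `^ (2 * mu))) * sin (dotp x xi)).
Proof.
by rewrite /cexp; simpc.
Qed.

Lemma frac_heat_fourier_real {N : nat} (mu t : R) (x : 'rV[R]_N) :
  frac_heat_fourier mu t x = (frac_heat_kernel mu t x)%:C.
Proof.
suff Im0 : complex.Im (cintegral (fun xi : 'rV[R]_N =>
    cexp ('i * (dotp x xi)%:C - (t * enorm xi `^ (2 * mu))%:C))) = 0.
  rewrite /frac_heat_kernel /frac_heat_fourier.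
  move: (cintegral _) Im0 => [a b] /= ->.
  by simpc.
transitivity (Rintegral (lebesgue_rV N) setT (fun xi =>
    expR (- (t * enorm xi `^ (2 * mu))) * sin (dotp x xi))).
  by apply: eq_Rintegral => xi _; rewrite frac_heat_symbolE.
apply: Rintegral_rV_odd => [|xi]; last by rewrite enormN dotpN sinN mulrN.
apply: measurable_funM; apply: measurableT_comp => //; last 2 first.
- by apply: continuous_measurable_fun; exact: continuous_sin.
- by apply: measurable_dotp => //; exact: measurable_cst.
apply: measurableT_comp => //; apply: measurable_funM => //.
exact: (measurableT_comp (measurable_powR _) measurable_enorm).
Qed.

Definition frac_heat_semigroup {N : nat} (mu t : R) (u0 : 'rV[R]_N -> R)
    (x : 'rV[R]_N) : \bar R :=
  (\int[lebesgue_rV N]_y (frac_heat_kernel mu t (x - y) * u0 y)%:E)%E.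

End fractional_heat.

(* Main.v *)
Require Import Defs.
From mathcomp Require Import finmap.
From mathcomp Require Import all_boot all_order all_algebra.
From mathcomp Require Import all_classical all_reals all_analysis.
From mathcomp Require Import measurable_realfun ess_sup_inf complex lra ring.

Set Implicit Arguments.
Unset Strict Implicit.
Unset Printing Implicit Defensive.
Import Order.TTheory GRing.Theory Num.Theory.
Import numFieldNormedType.Exports.

Local Open Scope classical_set_scope.
Local Open Scope ring_scope.

(** Why the theorem is true.

    The fractional heat kernel [k] of order [mu] in [(0, 1]] is a probability
    density for every time [t > 0], so the semigroup averages translates of the
    initial datum.  By Jensen and Tonelli, averaging cannot increase a Morrey
    norm ([morrey_mean_average]), so it suffices to choose a datum whose Morrey
    norm cannot decrease either.

    For [p] finite and [0 < l < N] take [u0 x = (1 + |x|) ^ (- l / p)], with the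
    l1 norm.  It is a regularisation of the homogeneous function
    [|x| ^ (- l / p)], whose norm the semigroup preserves by scaling but whose
    translates do not depend continuously on the translation in the Morrey
    norm.  The supremum defining the norm of [u0] is not lost by averaging
    because it can be recovered at large scales: if the ball of radius [n]
    carries the mass [1 - e] of [k], then, with [lam = 1 + n], the average [s]
    of [u0] satisfies [s (lam x) >= (1 - e) lam ^ (- l / p) u0 x], and the
    Morrey norm is invariant under that scaling
    ([morrey_mean_raverage_profile_ge]).  Both bounds together give
    [morrey_norm_average_profile].  The norm of [u0] is finite because [l < N]
    ([integral_cube0_le]), and [u0] is in the dotted space because
    [u0 (x - y) <= m(|y|) u0 x] with [m] tending to [1]
    ([dotted_morrey_slowly_varying]).  For [p = +oo] the constant [1] is
    preserved, and for [p = 1], [l = N] the Morrey norm is the L1 norm, which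
    averaging preserves on nonnegative functions ([integral_average]).

    Positivity of [k] ([frac_heat_kernel_ge0]) is the probabilistic core: the
    symbol [exp (- t |xi| ^ (2 mu))] is a limit of characteristic functions of
    random walks.  Let [z] be the average of the [cos (h xi_j)], the symbol of
    one step of the simple random walk on the lattice of mesh [h].  The power
    series of [1 - (1 - z) ^ mu] has nonnegative coefficients exactly because
    [mu <= 1], so [1 - (1 - z) ^ mu] is the symbol of a walk that makes a
    random number of steps, and its [n]-th power tends to
    [exp (- t |xi| ^ (2 mu))] when [n (h^2 / 2N) ^ mu = t]
    ([positive_multiplier_heat_symbol]).  Positivity passes through these
    operations by way of the class [positive_multiplier], which is visibly
    closed under products, sums and bounded limits.  That [k] has integral [1]
    ([integral_frac_heat_kernel]) follows by damping with [exp (- e |x|_1)],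
    whose Fourier transform is an explicit product of Cauchy densities
    concentrating at the origin, where the symbol equals [1]. *)

(** * Integration on R^N: Fubini, affine changes of variables, products *)

Section lebesgue_line.
Context {R : realType}.
Local Notation mu := (@lebesgue_measure R).

(** Both sides are measures, so it is enough to compare them on half-open intervals. *)
Lemma lebesgue_measure_affine (a b : R) (A : set (measurableTypeR R)) :
  0 < a -> measurable A ->
  mu A = (a%:E * mu ((fun x => a * x + b)%R @^-1` A))%E.
Proof.
move=> a0 mA.
have ma : measurable_fun [set: measurableTypeR R]
    ((fun x => a * x + b)%R : measurableTypeR R -> measurableTypeR R).
  apply: (@measurable_funD _ _ R) => //.
pose m' := mscale (NngNum (ltW a0))
  (measure_function_pushforward__canonical__measure_function_Measure mu ma).
apply: (lebesgue_measure_unique (mu := m')) => //= _ [[c d]] _ <- /=.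
rewrite /m' /mscale /= /pushforward.
rewrite (_ : _ @^-1` _ = `](c - b) / a, (d - b) / a]%classic).
  rewrite !lebesgue_measure_itv/= !lte_fin ltr_pM2r ?invr_gt0// ltrD2r.
  by case: ifPn => _; rewrite ?mule0// -EFinB -EFinM; congr EFin; field; lra.
apply/seteqP; split => x /=; rewrite !in_itv/= ltr_pdivrMr// ler_pdivlMr// => /andP[? ?]; lra.
Qed.

Lemma ge0_integral_affine (a b : R) (f : R -> \bar R) : 0 < a ->
  measurable_fun setT f -> (forall x, 0 <= f x)%E ->
  (\int[mu]_x f (a * x + b)%R = (a^-1)%:E * \int[mu]_x f x)%E.
Proof.
move=> a0 mf f0.
have ma : measurable_fun [set: measurableTypeR R]
    ((fun x => a * x + b)%R : measurableTypeR R -> measurableTypeR R).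
  apply: (@measurable_funD _ _ R) => //.
pose m' := measure_function_pushforward__canonical__measure_function_Measure mu ma.
rewrite [in RHS](eq_measure_integral (mscale (NngNum (ltW a0)) m')); last first.
  by move=> A mA _ /=; rewrite /mscale/= /pushforward; exact: lebesgue_measure_affine.
rewrite ge0_integral_mscale//= muleA -EFinM mulVf ?gt_eqF// mul1e.
by rewrite ge0_integral_pushforward.
Qed.

Lemma ge0_integral_opp (f : R -> \bar R) :
  measurable_fun setT f -> (forall x, 0 <= f x)%E ->
  (\int[mu]_x f (- x)%R = \int[mu]_x f x)%E.
Proof.
move=> mf f0.
have mN : measurable_fun [set: measurableTypeR R]
  (-%R : measurableTypeR R -> measurableTypeR R) by [].
pose m' := measure_function_pushforward__canonical__measure_function_Measure mu mN.
rewrite [in RHS](eq_measure_integral m'); last first.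
  by move=> A mA _; rewrite /= lebesgue_measureN.
by rewrite ge0_integral_pushforward.
Qed.

End lebesgue_line.

Section lebesgue_space.
Context {R : realType}.
Local Notation leb := (@lebesgue_rV R).

Lemma measurable_rV_cons_preim n (f : 'rV[R]_n.+1 -> \bar R) :
  measurable_fun setT f -> measurable_fun setT (f \o @rV_cons R n).
Proof. by move=> mf; apply: measurableT_comp => //; exact: measurable_rV_cons. Qed.

Lemma integral_rV0 (f : 'rV[R]_0 -> \bar R) :
  (\int[leb 0]_x f x)%E = f 0.
Proof.
have mf : measurable_fun setT f.
  move=> _ Y mY; rewrite setTI.
  have [f0|f0] := pselect (Y (f 0)).
    rewrite (_ : _ @^-1` _ = setT)//; apply/seteqP; split => // x _ /=.
    by rewrite (_ : x = 0)//; apply/rowP => -[].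
  rewrite (_ : _ @^-1` _ = set0)//; apply/seteqP; split => // x /=.
  by rewrite (_ : x = 0)//; apply/rowP => -[].
by rewrite /= integral_dirac// diracT mul1e.
Qed.

Lemma integral_rVS_prod n (f : 'rV[R]_n.+1 -> \bar R) :
  measurable_fun setT f -> (forall x, 0 <= f x)%E ->
  (\int[leb n.+1]_x f x =
   \int[@lebesgue_measure R \x leb n]_z f (rV_cons z))%E.
Proof.
move=> mf f0.
by rewrite (ge0_integral_pushforward (@measurable_rV_cons R n)).
Qed.

Lemma ge0_integral_rVS n (f : 'rV[R]_n.+1 -> \bar R) :
  measurable_fun setT f -> (forall x, 0 <= f x)%E ->
  (\int[leb n.+1]_x f x =
   \int[@lebesgue_measure R]_a \int[leb n]_y f (rV_cons (a, y)))%E.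
Proof.
move=> mf f0; rewrite integral_rVS_prod//.
rewrite (fubini_tonelli1 (f \o @rV_cons R n))//.
  exact: (measurable_rV_cons_preim mf).
by move=> x /=.
Qed.

Lemma measurable_rV_affine n (a : R) (b : 'rV[R]_n) :
  measurable_fun setT (fun x : 'rV[R]_n => a *: x + b).
Proof.
apply: measurable_fun_rV => i; under eq_fun do rewrite 2!mxE.
apply: (@measurable_funD _ _ R) => //; apply: (@measurable_funM _ _ R) => //.
exact: measurable_coord.
Qed.

(** The affine map acts coordinatewise, so Tonelli reduces the formula to one
    factor [a ^-1] for each coordinate. *)
Lemma ge0_integral_rV_affine n (a : R) (b : 'rV[R]_n) (f : 'rV[R]_n -> \bar R) :
  0 < a -> measurable_fun setT f -> (forall x, 0 <= f x)%E ->
  (\int[leb n]_x f (a *: x + b)%R = (a ^- n)%:E * \int[leb n]_x f x)%E.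
Proof.
move=> a0; elim: n b f => [|n IH] b f mf f0.
  rewrite 2!integral_rV0 expr0 invr1 mul1e; congr f.
  by apply/rowP => -[].
have mfa : measurable_fun setT (fun x : 'rV[R]_n.+1 => f (a *: x + b)).
  exact: (measurableT_comp mf (measurable_rV_affine a b)).
rewrite !ge0_integral_rVS//.
have mG : measurable_fun setT (fun s : R => \int[leb n]_y f (rV_cons (s, y)))%E.
  exact: (measurable_fun_fubini_tonelli_F (f \o @rV_cons R n)
    (measurable_rV_cons_preim mf) (fun x => f0 _)).
pose b' : 'rV[R]_n := \row_i b ord0 (lift ord0 i).
transitivity (\int[@lebesgue_measure R]_s ((a ^- n)%:E *
    \int[leb n]_y f (rV_cons ((a * s + b ord0 ord0)%R, y))))%E.
  apply: eq_integral => s _.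
  rewrite -(IH b' (fun y => f (rV_cons ((a * s + b ord0 ord0)%R, y))))//.
    apply: eq_integral => y _; congr f; apply/rowP => i; rewrite 2!mxE.
    case: (unliftP ord0 i) => [j|] ->.
      by rewrite !rV_consS !mxE.
    by rewrite !rV_cons0.
  apply: (@measurableT_comp _ _ _ _ _ _ (f \o @rV_cons R n)).
    exact: measurable_rV_cons_preim.
  exact: pair1_measurable.
have mGa : measurable_fun setT
    (fun s : R => \int[leb n]_y f (rV_cons ((a * s + b ord0 ord0)%R, y)))%E.
  apply: (measurableT_comp mG).
  by apply: (@measurable_funD _ _ R).
have an0 : (0 <= (a ^- n)%:E)%E by rewrite lee_fin invr_ge0 exprn_ge0 ?ltW.
rewrite (ge0_integralZl (@lebesgue_measure R) measurableT mGa _ an0); last first.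
  by move=> s _; exact: integral_ge0.
rewrite (ge0_integral_affine _ a0 mG); last by move=> s; exact: integral_ge0.
by rewrite muleA -EFinM -invfM exprSr.
Qed.

Lemma ge0_integral_rV_shift n (b : 'rV[R]_n) (f : 'rV[R]_n -> \bar R) :
  measurable_fun setT f -> (forall x, 0 <= f x)%E ->
  (\int[leb n]_x f (x + b)%R = \int[leb n]_x f x)%E.
Proof.
move=> mf f0; have := ge0_integral_rV_affine b (@ltr01 R) mf f0.
rewrite expr1n invr1 mul1e => <-.
by apply: eq_integral => x _; rewrite scale1r.
Qed.

Lemma ge0_integral_rV_opp n (f : 'rV[R]_n -> \bar R) :
  measurable_fun setT f -> (forall x, 0 <= f x)%E ->
  (\int[leb n]_x f (- x)%R = \int[leb n]_x f x)%E.
Proof.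
move=> mf f0; have mN := @measurable_rV_opp R n.
pose m' := measure_function_pushforward__canonical__measure_function_Measure
  (leb n) mN.
rewrite [RHS](eq_measure_integral m'); last first.
  by move=> A mA _; rewrite /= /pushforward lebesgue_rV_opp.
by rewrite /= ge0_integral_pushforward.
Qed.

Lemma ge0_integral_rV_subr n (b : 'rV[R]_n) (f : 'rV[R]_n -> \bar R) :
  measurable_fun setT f -> (forall x, 0 <= f x)%E ->
  (\int[leb n]_x f (b - x)%R = \int[leb n]_x f x)%E.
Proof.
move=> mf f0.
rewrite -[RHS](ge0_integral_rV_shift b)//.
rewrite -[RHS]ge0_integral_rV_opp//.
- by apply: eq_integral => x _; rewrite addrC.
- apply: (measurableT_comp mf); have := @measurable_rV_affine n 1 b.
  by under eq_fun do rewrite scale1r.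
Qed.

Lemma measurable_prod_coord n (g : 'I_n -> R -> R) :
  (forall i, measurable_fun setT (g i)) ->
  measurable_fun setT (fun x : 'rV[R]_n => \prod_(i < n) g i (x ord0 i)).
Proof.
move=> mg; apply: measurable_prod => i _.
exact: (measurableT_comp (mg i) (measurable_coord i)).
Qed.

Lemma ge0_integral_rV_prod n (g : 'I_n -> R -> R) :
  (forall i, measurable_fun setT (g i)) -> (forall i s, 0 <= g i s) ->
  (\int[leb n]_x (\prod_(i < n) g i (x ord0 i))%:E =
   \prod_(i < n) \int[@lebesgue_measure R]_s (g i s)%:E)%E.
Proof.
elim: n g => [|n IH] g mg g0.
  by rewrite integral_rV0 !big_ord0.
rewrite ge0_integral_rVS//; last 2 first.
- by apply/measurable_EFinP; exact: measurable_prod_coord.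
- by move=> x; rewrite lee_fin; apply: prodr_ge0 => i _.
rewrite big_ord_recl -(IH (fun i => g (lift ord0 i)))//.
have mg0 : measurable_fun setT (fun s : R => (g ord0 s)%:E) by exact/measurable_EFinP.
rewrite -(ge0_integralZr (@lebesgue_measure R) measurableT mg0); last 2 first.
- by move=> x _; rewrite lee_fin.
- by apply: integral_ge0 => x _; rewrite lee_fin; apply: prodr_ge0 => i _.
apply: eq_integral => s _.
have mgl : measurable_fun setT
    (fun y : 'rV[R]_n => (\prod_(i < n) g (lift ord0 i) (y ord0 i))%:E).
  apply/measurable_EFinP.
  exact: (measurable_prod_coord (fun i => mg (lift ord0 i))).
rewrite -(ge0_integralZl (leb n) measurableT mgl); last 2 first.
- by move=> x _; rewrite lee_fin; apply: prodr_ge0 => i _.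
- by rewrite lee_fin.
apply: eq_integral => y _; rewrite big_ord_recl -EFinM rV_cons0; congr (_ * _)%:E.
by apply: eq_bigr => i _; rewrite rV_consS.
Qed.

End lebesgue_space.

(** * Two integrals over the real line *)

Section even_integrals.
Context {R : realType}.
Local Notation mu := (@lebesgue_measure R).

(** The antiderivative is only required to match [f] on the half line through
    [g], because integrands involving [`|x|] have no convenient antiderivative on
    the whole line. *)
Lemma ge0_integral_even_FTC (f g F : R -> R) (l : R) :
  (forall x, 0 <= f x) -> continuous f -> (forall x, f (- x) = f x) ->
  continuous g -> (forall x, 0 <= x -> f x = g x) ->
  (forall x : R, is_derive x (1 : R) F (g x)) -> F x @[x --> +oo] --> l ->
  (\int[mu]_x (f x)%:E = (2 * (l - F 0))%:E)%E.
Proof.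
move=> f0 cf fN cg fg dF Fl.
rewrite ge0_symfun_integralT//; last by move=> x /=; rewrite fN.
rewrite -set_itvcy EFinM; congr (_ * _)%E.
transitivity (\int[mu]_(x in `[0%R, +oo[) (g x)%:E)%E.
  by apply: eq_integral => x; rewrite inE/= in_itv/= andbT => x0; rewrite fg.
rewrite (@ge0_continuous_FTC2y _ g F 0 l).
- by rewrite EFinB.
- by move=> x x0; rewrite -fg.
- exact: continuous_subspaceT.
- exact: Fl.
- by move=> x x0; exact: ex_derive.
- apply: cvg_at_right_filter; apply: differentiable_continuous.
  by apply/derivable1_diffP; exact: ex_derive.
- by move=> x _; rewrite derive1E; apply: derive_val.
Qed.

(** The total mass of twice the Cauchy density, by the arctangent. *)
Lemma integral_cauchy : (\int[mu]_s (2 / (1 + s ^+ 2))%:E = (2 * pi)%:E)%E.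
Proof.
have s0 (s : R) : 0 < 1 + s ^+ 2 by rewrite ltr_pwDl// sqr_ge0.
have cg : continuous (fun s : R => 2 / (1 + s ^+ 2)).
  move=> s; apply: cvgM; first exact: cvg_cst.
  apply: cvgV; first by rewrite gt_eqF.
  by apply: cvgD; [exact: cvg_cst|exact: exprn_continuous].
rewrite (@ge0_integral_even_FTC _ (fun s => 2 / (1 + s ^+ 2)) (fun s => 2 * atan s) pi)//.
- by rewrite atan0 mulr0 subr0.
- by move=> s; rewrite divr_ge0// ltW.
- by move=> s; rewrite sqrrN.
- rewrite [X in _ --> X](_ : pi = 2 * (pi / 2)); last by field.
  by apply: cvgM; [exact: cvg_cst|exact: cvgy_atan].
Qed.

(** The Fourier transform of the double exponential.  Adding [1] to the cosine
    makes the integrand nonnegative, so that Tonelli and the fundamental theorem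
    of calculus on a half line apply without integrability conditions; the phase
    [th] is what makes the formula usable coordinate by coordinate. *)
Lemma integral_expabs_cos (d th x : R) : 0 < d ->
  (\int[mu]_s (expR (- (d * `|s|)) * (1 + cos (th + x * s)))%:E =
   (2 / d + cos th * (2 * d / (d ^+ 2 + x ^+ 2)))%:E)%E.
Proof.
move=> d0; set c := cos th.
have dx0 : 0 < d ^+ 2 + x ^+ 2 by rewrite ltr_pwDl ?exprn_gt0// sqr_ge0.
have cabs : continuous (fun s : R => expR (- (d * `|s|))).
  move=> s; apply: (continuous_comp (f := fun s : R => - (d * `|s|))).
    apply: cvgN; apply: cvgM; [exact: cvg_cst|exact: norm_continuous].
  exact: continuous_expR.
have cexp : continuous (fun s : R => expR (- (d * s))).
  move=> s; apply: (continuous_comp (f := fun s : R => - (d * s))).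
    by apply: cvgN; apply: cvgM; [exact: cvg_cst|exact: cvg_id].
  exact: continuous_expR.
have ccos (a b : R) : continuous (fun s : R => cos (a + b * s)).
  move=> s; apply: (continuous_comp (f := fun s : R => a + b * s)).
    by apply: cvgD; [exact: cvg_cst|apply: cvgM; [exact: cvg_cst|exact: cvg_id]].
  exact: continuous_cos.
pose f (s : R) : R := expR (- (d * `|s|)) * (1 + cos (th + x * s)).
have cf : continuous f.
  by move=> s; apply: cvgM; [exact: cabs|apply: cvgD; [exact: cvg_cst|exact: ccos]].
have f0 s : 0 <= f s.
  by rewrite mulr_ge0 ?expR_ge0// -lerBlDl sub0r cos_geN1.
have mf : measurable_fun setT (fun s => (f s)%:E).
  by apply/measurable_EFinP; exact: continuous_measurable_fun.
have mfN : measurable_fun setT (fun s : R => (f (- s))%:E).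
  apply: (measurableT_comp mf); exact: oppr_measurable.
have fN : (\int[mu]_s (f (- s))%:E = \int[mu]_s (f s)%:E)%E.
  exact: (@ge0_integral_opp _ (fun s => (f s)%:E)).
pose h (s : R) : R := expR (- (d * `|s|)) * (2 * (1 + c * cos (x * s))).
pose g (s : R) : R := expR (- (d * s)) * (2 * (1 + c * cos (x * s))).
pose F (s : R) : R := - (2 / d) * expR (- (d * s)) +
  2 * c / (d ^+ 2 + x ^+ 2) *
  (expR (- (d * s)) * (x * sin (x * s) - d * cos (x * s))).
have fh s : f s + f (- s) = h s.
  rewrite /f /h normrN mulrN cosD cosB -/c; ring.
have ch0 (s : R) : 0 <= 1 + c * cos (x * s).
  rewrite -lerBlDl sub0r; have : `|c * cos (x * s)| <= 1.
    by rewrite normrM mulr_ile1// ?ler_norml ?cos_geN1 ?cos_le1.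
  by rewrite ler_norml => /andP[].
have chc : continuous (fun s : R => 2 * (1 + c * cos (x * s))).
  move=> s; apply: cvgM; first exact: cvg_cst.
  apply: cvgD; first exact: cvg_cst.
  apply: cvgM; first exact: cvg_cst.
  by have := @ccos 0 x s; rewrite /continuous_at; under eq_fun do rewrite add0r; rewrite add0r.
have dF (s : R) : is_derive s (1 : R) F (g s).
  have dl (b : R) : is_derive s (1 : R) (fun s : R => b * s) b.
    by have := is_deriveZ b (is_derive_id s (1 : R)); rewrite /GRing.scale/= mulr1.
  have dE : is_derive s (1 : R) (fun s : R => expR (- (d * s))) (expR (- (d * s)) * - d).
    exact: (is_derive1_comp (is_derive_expR _) (is_deriveN (dl d))).
  have dS : is_derive s (1 : R) (fun s : R => sin (x * s)) (cos (x * s) * x).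
    exact: (is_derive1_comp (is_derive_sin _) (dl x)).
  have dC : is_derive s (1 : R) (fun s : R => cos (x * s)) (- sin (x * s) * x).
    exact: (is_derive1_comp (is_derive_cos _) (dl x)).
  have dF1 := is_deriveZ (- (2 / d)) dE.
  have dF2 := is_deriveB (is_deriveZ x dS) (is_deriveZ d dC).
  have dF3 := is_deriveZ (2 * c / (d ^+ 2 + x ^+ 2)) (is_deriveM dE dF2).
  have dF4 := is_deriveD dF1 dF3.
  refine (is_derive_eq dF4 _).
  rewrite (_ : (x \*: _ - d \*: _) s = x * sin (x * s) - d * cos (x * s))//.
  rewrite /g /GRing.scale/=; field.
  by rewrite !gt_eqF.
have Ih : (\int[mu]_s (h s)%:E =
    (2 * (2 / d + c * (2 * d / (d ^+ 2 + x ^+ 2))))%:E)%E.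
  transitivity (2 * (0 - F 0))%:E; last first.
    congr EFin; rewrite /F !mulr0 oppr0 expR0 sin0 cos0; field.
    by rewrite !gt_eqF.
  apply: (fun a b c d e => @ge0_integral_even_FTC h g F 0 a b c d e dF).
  - by move=> s; rewrite /h mulr_ge0 ?expR_ge0// mulr_ge0.
  - by move=> s; apply: cvgM; [exact: cabs|exact: chc].
  - by move=> s; rewrite /h normrN mulrN cosN.
  - by move=> s; apply: cvgM; [exact: cexp|exact: chc].
  - by move=> s s0; rewrite /h /g ger0_norm.
  - have ed : expR (- (d * s)) @[s --> +oo] --> (0 : R).
      apply: (@cvg_comp _ _ _ (fun s => d * s) (fun s => expR (- s)) _ +oo).
        by apply: gt0_cvgMry => //; exact: cvg_id.
      exact: cvgr_expR.
    pose K := 2 / d + `|2 * c / (d ^+ 2 + x ^+ 2)| * (`|x| + `|d|).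
    apply: norm_cvg0; apply: (@squeeze_cvgr _ _ _ _ (cst 0) (fun s => K * expR (- (d * s)))).
    + apply: nearW => s; rewrite normr_ge0/= /F /K.
      apply: (le_trans (ler_normD _ _)); rewrite [leRHS]mulrDl; apply: lerD.
        have d2 : 0 <= 2 / d by rewrite divr_ge0 ?ltW.
        by rewrite normrM normrN (ger0_norm d2) (ger0_norm (expR_ge0 _)).
      rewrite normrM -[leRHS]mulrA; apply: ler_wpM2l => //.
      rewrite normrM mulrC (ger0_norm (expR_ge0 _)).
      apply: ler_wpM2r; first exact: expR_ge0.
      apply: (le_trans (ler_normB _ _)); rewrite !normrM.
      by apply: lerD; rewrite ler_piMr// ler_norml ?sin_geN1 ?sin_le1 ?cos_geN1 ?cos_le1.
    + exact: cvg_cst.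
    + by rewrite -[X in _ --> X](mulr0 K); apply: cvgM; [exact: cvg_cst|].
(* [h] is twice the even part of [f], so it has twice the integral of [f]. *)
have : (\int[mu]_s (f s)%:E + \int[mu]_s (f s)%:E = \int[mu]_s (h s)%:E)%E.
  rewrite -{2}fN -ge0_integralD//; first last.
  - by move=> s _; rewrite lee_fin.
  - by move=> s _; rewrite lee_fin.
  by apply: eq_integral => s _; rewrite -EFinD fh.
rewrite Ih -/(f _).
have : (0 <= \int[mu]_s (f s)%:E)%E by apply: integral_ge0 => s _; rewrite lee_fin.
rewrite /f; case: (\int[mu]_s _)%E => [r| |]//= _ [].
by move=> e; congr EFin; lra.
Qed.

End even_integrals.

(** * Damping weights and functions of positive type *)

Section exponential_weight.
Context {R : realType}.
Local Notation leb := (@lebesgue_rV R).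

(** The weight [exp (- d |x|_1)]: integrable, with a positive Fourier transform,
    and increasing to [1] as [d] tends to [0]. *)
Definition expw {N : nat} (d : R) (x : 'rV[R]_N) : R :=
  \prod_(i < N) expR (- (d * `|x ord0 i|)).

Lemma expw_ge0 N d (x : 'rV[R]_N) : 0 <= expw d x.
Proof. by apply: prodr_ge0 => i _; exact: expR_ge0. Qed.

Lemma expw_le1 N d (x : 'rV[R]_N) : 0 <= d -> expw d x <= 1.
Proof.
move=> d0; apply: Num.Theory.prodr_ile1 => i _; rewrite expR_ge0/= -expR0 ler_expR.
by rewrite oppr_le0 mulr_ge0.
Qed.

Lemma measurable_expabs (d : R) : measurable_fun setT (fun s : R => expR (- (d * `|s|))).
Proof.
apply: measurableT_comp => //; apply: measurableT_comp => //.
by apply: measurable_funM => //; exact: measurableT_comp.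
Qed.

Lemma measurable_expw N (d : R) : measurable_fun setT (@expw N d).
Proof. exact: measurable_prod_coord (fun _ => measurable_expabs d). Qed.

Lemma integral_expabs (d : R) : 0 < d ->
  (\int[@lebesgue_measure R]_s (expR (- (d * `|s|)))%:E = (2 / d)%:E)%E.
Proof.
move=> d0; have := integral_expabs_cos (pi / 2) 0 d0.
rewrite cos_pihalf mul0r addr0 => <-.
by apply: eq_integral => s _; rewrite mul0r addr0 cos_pihalf addr0 mulr1.
Qed.

Lemma integral_expw N (d : R) : 0 < d ->
  (\int[leb N]_x (expw d x)%:E = ((2 / d) ^+ N)%:E)%E.
Proof.
move=> d0; rewrite (ge0_integral_rV_prod (fun _ => measurable_expabs d)); last first.
  by move=> i s; exact: expR_ge0.
under eq_bigr do rewrite integral_expabs//.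
by rewrite prodEFin prodr_const card_ord.
Qed.

Lemma dotp_cons N (x : 'rV[R]_N.+1) (s : R) (y : 'rV[R]_N) :
  dotp x (rV_cons (s, y)) =
  x ord0 ord0 * s + dotp (\row_i x ord0 (lift ord0 i)) y.
Proof.
rewrite /dotp big_ord_recl rV_cons0; congr (_ + _).
by apply: eq_bigr => i _; rewrite rV_consS mxE.
Qed.

Lemma expw_cons N (d s : R) (y : 'rV[R]_N) :
  expw d (rV_cons (s, y)) = expR (- (d * `|s|)) * expw d y.
Proof.
rewrite /expw big_ord_recl rV_cons0; congr (_ * _).
by apply: eq_bigr => i _; rewrite rV_consS.
Qed.

Lemma measurable_cos_dotp N (th : R) (x : 'rV[R]_N) :
  measurable_fun setT (fun y => cos (th + dotp x y)).
Proof.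
apply: measurableT_comp.
  by apply: continuous_measurable_fun; exact: continuous_cos.
apply: measurable_funD => //.
by apply: measurable_dotp => //; exact: measurable_cst.
Qed.

Lemma cosD1_ge0 (a : R) : 0 <= 1 + cos a.
Proof. by rewrite -lerBlDl sub0r cos_geN1. Qed.

(** The one-dimensional formula is applied in the first coordinate after
    induction, the remaining coordinates having turned the phase [th] into
    [th + x_0 s]. *)
Lemma integral_expw_cos N (d th : R) (x : 'rV[R]_N) : 0 < d ->
  (\int[leb N]_y (expw d y * (1 + cos (th + dotp x y)))%:E =
   ((2 / d) ^+ N + cos th * \prod_(i < N) (2 * d / (d ^+ 2 + x ord0 i ^+ 2)))%:E)%E.
Proof.
move=> d0; elim: N x th => [|N IH] x th.
  by rewrite integral_rV0 /expw /dotp !big_ord0 expr0 addr0 mul1r mulr1.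
have mF N' (th' : R) (x' : 'rV[R]_N') :
    measurable_fun setT (fun y => (expw d y * (1 + cos (th' + dotp x' y)))%:E).
  apply/measurable_EFinP; apply: measurable_funM; first exact: measurable_expw.
  by apply: measurable_funD => //; exact: measurable_cos_dotp.
have F0 N' (th' : R) (x' : 'rV[R]_N') y :
    (0 <= (expw d y * (1 + cos (th' + dotp x' y)))%:E)%E.
  by rewrite lee_fin mulr_ge0 ?expw_ge0 ?cosD1_ge0.
rewrite ge0_integral_rVS//.
pose x' : 'rV[R]_N := \row_i x ord0 (lift ord0 i).
pose A := (2 / d) ^+ N; pose Q := \prod_(i < N) (2 * d / (d ^+ 2 + x' ord0 i ^+ 2)).
have dx0 (s : R) : 0 < d ^+ 2 + s ^+ 2 by rewrite ltr_pwDl ?exprn_gt0// sqr_ge0.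
have QA : 0 <= Q <= A.
  apply/andP; split.
    by apply: prodr_ge0 => i _; rewrite divr_ge0 ?mulr_ge0 ?ltW.
  rewrite /A -[X in _ ^+ X](card_ord N) -prodr_const; apply: ler_prod => i _.
  apply/andP; split; first by rewrite divr_ge0 ?mulr_ge0 ?ltW.
  rewrite ler_pdivrMr; last exact: dx0.
  by rewrite mulrAC ler_pdivlMr// -mulrA ler_pM2l// -expr2 lerDl sqr_ge0.
have mE : measurable_fun setT (fun s : R => expR (- (d * `|s|))).
  exact: measurable_expabs.
(* [Q <= A] keeps both summands nonnegative. *)
transitivity (\int[@lebesgue_measure R]_s (((A - Q) * expR (- (d * `|s|)))%:E +
   (Q * (expR (- (d * `|s|)) * (1 + cos (th + x ord0 ord0 * s))))%:E))%E.
  apply: eq_integral => s _.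
  transitivity (\int[leb N]_y ((expR (- (d * `|s|)))%:E *
      (expw d y * (1 + cos ((th + x ord0 ord0 * s) + dotp x' y)))%:E))%E.
    by apply: eq_integral => y _; rewrite expw_cons dotp_cons -EFinM addrA mulrA.
  rewrite (ge0_integralZl (leb N) measurableT (mF _ _ _)); last 2 first.
  - by move=> y _; exact: F0.
  - by rewrite lee_fin expR_ge0.
  rewrite IH -EFinM -EFinD; congr EFin; rewrite -/A -/Q; ring.
have mg : measurable_fun setT (fun s : R => expR (- (d * `|s|)) * (1 + cos (th + x ord0 ord0 * s))).
  apply: measurable_funM => //; apply: measurable_funD => //.
  apply: measurableT_comp.
    by apply: continuous_measurable_fun; exact: continuous_cos.
  by apply: measurable_funD => //; apply: measurable_funM.
have [Q0 QA'] := andP QA.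
have mgE : measurable_fun setT (fun s : R => (expR (- (d * `|s|)) * (1 + cos (th + x ord0 ord0 * s)))%:E).
  exact/measurable_EFinP.
have mEE : measurable_fun setT (fun s : R => (expR (- (d * `|s|)))%:E).
  exact/measurable_EFinP.
have mEA : measurable_fun setT (fun s : R => ((A - Q) * expR (- (d * `|s|)))%:E).
  by apply/measurable_EFinP; apply: measurable_funM.
have mgA : measurable_fun setT (fun s : R => (Q * (expR (- (d * `|s|)) * (1 + cos (th + x ord0 ord0 * s))))%:E).
  by apply/measurable_EFinP; apply: measurable_funM.
rewrite (ge0_integralD (@lebesgue_measure R) measurableT _ mEA _ mgA); last 2 first.
- by move=> s _; rewrite lee_fin mulr_ge0 ?expR_ge0 ?subr_ge0.
- by move=> s _; rewrite lee_fin mulr_ge0// mulr_ge0 ?expR_ge0 ?cosD1_ge0.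
have A1 : (\int[@lebesgue_measure R]_s ((A - Q) * expR (- (d * `|s|)))%:E =
    ((A - Q) * (2 / d))%:E)%E.
  rewrite EFinM -integral_expabs//.
  rewrite -(ge0_integralZl (@lebesgue_measure R) measurableT mEE)//.
    by rewrite lee_fin subr_ge0.
have A2 : (\int[@lebesgue_measure R]_s
    (Q * (expR (- (d * `|s|)) * (1 + cos (th + x ord0 ord0 * s))))%:E =
    (Q * (2 / d + cos th * (2 * d / (d ^+ 2 + x ord0 ord0 ^+ 2))))%:E)%E.
  rewrite [in RHS]EFinM -integral_expabs_cos//.
  rewrite -(ge0_integralZl (@lebesgue_measure R) measurableT mgE)//.
rewrite A1 A2 -EFinD; congr EFin; rewrite big_ord_recl [_ ^+ N.+1]exprS -/A.
rewrite (_ : \prod_(i < N) _ = Q); last by apply: eq_bigr => i _; rewrite mxE.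
by ring.
Qed.

End exponential_weight.

Section positive_type.
Context {R : realType} {N : nat}.
Local Notation leb := (@lebesgue_rV R N).
Implicit Types (f g : 'rV[R]_N -> R) (x y : 'rV[R]_N).

Definition bounded_measurable f :=
  measurable_fun setT f /\ exists C, forall y, `|f y| <= C.

(** The real part of the Fourier transform of [f], made convergent by the weight. *)
Definition damped_cosine f (d : R) x : R :=
  Rintegral leb setT (fun y => f y * (cos (dotp x y) * expw d y)).

(** The dual form of Bochner's condition: rather than asking for a positive
    measure of which [f] is the transform, ask that the damped transforms of [f],
    whose limit is a multiple of that measure for even [f], be nonnegative. *)
Definition positive_type f := bounded_measurable f /\
  forall d x, 0 < d -> 0 <= damped_cosine f d x.

(** Functions of positive type are closed under products, but this is not easily
    seen from the definition.  For multipliers it is immediate, and they are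
    themselves of positive type, since the constant [1] is. *)
Definition positive_multiplier f := bounded_measurable f /\
  forall g, positive_type g -> positive_type (fun y => f y * g y).

Lemma measurable_cosw d x :
  measurable_fun setT (fun y => cos (dotp x y) * expw d y).
Proof.
apply: measurable_funM; last exact: measurable_expw.
have := measurable_cos_dotp 0 x; apply: eq_measurable_fun => y _.
by rewrite add0r.
Qed.

Lemma cosw_le d x y : `|cos (dotp x y) * expw d y| <= expw d y.
Proof.
by rewrite normrM (ger0_norm (expw_ge0 _ _)) ler_piMl ?expw_ge0// ler_norml cos_geN1 cos_le1.
Qed.

Lemma integrable_expw d : 0 < d -> leb.-integrable setT (EFin \o (@expw R N d)).
Proof.
move=> d0; apply/integrableP; split; first by apply/measurable_EFinP; exact: measurable_expw.
under eq_integral do rewrite /= ger0_norm ?expw_ge0//.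
by rewrite integral_expw// ltry.
Qed.

Lemma integrable_damped f d x : 0 < d -> bounded_measurable f ->
  leb.-integrable setT (fun y => (f y * (cos (dotp x y) * expw d y))%:E).
Proof.
move=> d0 [mf [C fC]].
apply: (@le_integrable _ _ _ _ _ _ _ (fun y => (C * expw d y)%:E)) => //.
- by apply/measurable_EFinP; apply: measurable_funM => //; exact: measurable_cosw.
- move=> y _; rewrite /= lee_fin [leRHS]normrM normrM.
  apply: ler_pM => //; first exact: (le_trans (fC y) (ler_norm _)).
  by rewrite (le_trans (cosw_le _ _ _))// ler_norm.
- under eq_fun do rewrite EFinM.
  by apply: integrableZl => //; exact: integrable_expw.
Qed.

Lemma bounded_measurable_cst c : bounded_measurable (fun=> c).
Proof. by split; [exact: measurable_cst|exists `|c|]. Qed.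

Lemma bounded_measurableM f g : bounded_measurable f -> bounded_measurable g ->
  bounded_measurable (fun y => f y * g y).
Proof.
move=> [mf [C fC]] [mg [D gD]]; split; first exact: measurable_funM.
by exists (C * D) => y; rewrite normrM ler_pM.
Qed.

Lemma bounded_measurableD f g : bounded_measurable f -> bounded_measurable g ->
  bounded_measurable (fun y => f y + g y).
Proof.
move=> [mf [C fC]] [mg [D gD]]; split; first exact: measurable_funD.
by exists (C + D) => y; rewrite (le_trans (ler_normD _ _))// lerD.
Qed.

Lemma bounded_measurable_cos a : bounded_measurable (fun y => cos (dotp a y)).
Proof.
split; last by exists 1 => y; rewrite ler_norml cos_geN1 cos_le1.
have := measurable_cos_dotp 0 a; apply: eq_measurable_fun => y _.
by rewrite add0r.
Qed.

(** The damped transform of [1] is that of the weight, a product of Cauchy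
    densities. *)
Lemma positive_type1 : positive_type (fun=> 1).
Proof.
split; first exact: bounded_measurable_cst.
move=> d x d0; rewrite /damped_cosine /Rintegral; under eq_integral do rewrite mul1r.
have i1 : leb.-integrable setT (fun y => (expw d y * (1 + cos (0 + dotp x y)))%:E).
  apply/integrableP; split.
    apply/measurable_EFinP; apply: measurable_funM; first exact: measurable_expw.
    by apply: measurable_funD => //; exact: measurable_cos_dotp.
  under eq_integral do rewrite /= ger0_norm ?mulr_ge0 ?expw_ge0 ?cosD1_ge0//.
  by rewrite integral_expw_cos// ltry.
have -> : (\int[leb]_y (cos (dotp x y) * expw d y)%:E =
    \int[leb]_y ((expw d y * (1 + cos (0 + dotp x y)))%:E - (expw d y)%:E))%E.
  by apply: eq_integral => y _; rewrite -EFinB; congr EFin; rewrite add0r; ring.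
rewrite integralB//; last exact: integrable_expw.
rewrite integral_expw_cos// integral_expw// -EFinB /= addrAC subrr add0r cos0 mul1r.
apply: prodr_ge0 => i _; rewrite divr_ge0 ?mulr_ge0 ?ltW//.
by rewrite ltr_pwDl ?exprn_gt0// sqr_ge0.
Qed.

Lemma positive_typeD f g : positive_type f -> positive_type g ->
  positive_type (fun y => f y + g y).
Proof.
move=> [bf f0] [bg g0]; split; first exact: bounded_measurableD.
move=> d x d0; rewrite /damped_cosine; under eq_Rintegral do rewrite mulrDl.
rewrite RintegralD//; [|exact: integrable_damped..].
by rewrite addr_ge0//; [exact: f0|exact: g0].
Qed.

Lemma positive_typeZ c f : 0 <= c -> positive_type f ->
  positive_type (fun y => c * f y).
Proof.
move=> c0 [bf f0]; split.
  exact: (bounded_measurableM (bounded_measurable_cst c)).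
move=> d x d0; rewrite /damped_cosine; under eq_Rintegral do rewrite -mulrA.
rewrite RintegralZl//; last exact: integrable_damped.
by rewrite mulr_ge0//; exact: f0.
Qed.

(** The weight is integrable, so dominated convergence applies to each damped
    transform. *)
Lemma positive_type_lim (F : nat -> 'rV[R]_N -> R) f C :
  (forall n, positive_type (F n)) -> (forall n y, `|F n y| <= C) ->
  (forall y, F n y @[n --> \oo] --> f y) -> positive_type f.
Proof.
move=> FP FC Ff.
have mf : measurable_fun setT f.
  apply: (measurable_fun_cvg (h := F)) => // n.
  by have [[]] := FP n.
have fC y : `|f y| <= C.
  have : `|F n y| @[n --> \oo] --> `|f y| by apply: cvg_norm; exact: Ff.
  by move=> /(ler_cvg_to); apply; [exact: cvg_cst|apply: nearW => n; exact: FC].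
have bf : bounded_measurable f by split => //; exists C.
split => // d x d0.
have cvgI := @dominated_cvg _ _ _ leb setT measurableT
  (fun n y => (F n y * (cos (dotp x y) * expw d y))%:E)
  (fun y => (f y * (cos (dotp x y) * expw d y))%:E)
  (fun y => (C * expw d y)%:E).
have {}cvgI : (\int[leb]_y (F n y * (cos (dotp x y) * expw d y))%:E)%E @[n --> \oo]
    --> (\int[leb]_y (f y * (cos (dotp x y) * expw d y))%:E)%E.
  apply: cvgI => //.
  - move=> n; apply/measurable_EFinP; apply: measurable_funM; last exact: measurable_cosw.
    by have [[]] := FP n.
  - move=> y _; apply/cvg_EFin; first by apply: nearW.
    by apply: cvgM; [exact: Ff|exact: cvg_cst].
  - under eq_fun do rewrite EFinM.
    by apply: integrableZl => //; exact: integrable_expw.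
  - move=> n y _ /=; rewrite lee_fin normrM.
    by apply: ler_pM => //; exact: cosw_le.
rewrite /damped_cosine /Rintegral; apply: fine_ge0.
apply: (cvge_to_ge cvgI); apply: nearW => n.
have [_ /(_ d x d0)] := FP n.
have /(integrable_fin_num measurableT) := integrable_damped x d0 (FP n).1.
by move=> /fineK <- ; rewrite lee_fin.
Qed.

Lemma positive_multiplierM f g : positive_multiplier f -> positive_multiplier g ->
  positive_multiplier (fun y => f y * g y).
Proof.
move=> [bf fP] [bg gP]; split; first exact: bounded_measurableM.
by move=> h hP; under eq_fun do rewrite -mulrA; apply: fP; exact: gP.
Qed.

Lemma positive_multiplierD f g : positive_multiplier f -> positive_multiplier g ->
  positive_multiplier (fun y => f y + g y).
Proof.
move=> [bf fP] [bg gP]; split; first exact: bounded_measurableD.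
move=> h hP; under eq_fun do rewrite mulrDl.
by apply: positive_typeD; [exact: fP|exact: gP].
Qed.

Lemma positive_multiplier_cst c : 0 <= c -> positive_multiplier (fun=> c).
Proof.
move=> c0; split; first exact: bounded_measurable_cst.
by move=> h hP; exact: positive_typeZ.
Qed.

Lemma positive_multiplierX f n : positive_multiplier f ->
  positive_multiplier (fun y => f y ^+ n).
Proof.
move=> fP; elim: n => [|n IH]; first exact: positive_multiplier_cst.
by under eq_fun do rewrite exprS; exact: positive_multiplierM.
Qed.

Lemma positive_multiplier_sum n (F : 'I_n -> 'rV[R]_N -> R) :
  (forall i, positive_multiplier (F i)) ->
  positive_multiplier (fun y => \sum_(i < n) F i y).
Proof.
elim: n F => [|n IH] F FP.
  by under eq_fun do rewrite big_ord0; exact: positive_multiplier_cst.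
under eq_fun do rewrite big_ord_recl.
by apply: positive_multiplierD => //; exact: (IH (fun i => F (lift ord0 i))).
Qed.

Lemma positive_multiplier_lim (F : nat -> 'rV[R]_N -> R) f C :
  (forall n, positive_multiplier (F n)) -> (forall n y, `|F n y| <= C) ->
  (forall y, F n y @[n --> \oo] --> f y) -> positive_multiplier f.
Proof.
move=> FP FC Ff.
have fP g : positive_type g -> positive_type (fun y => f y * g y).
  move=> gP; have [[_ [D gD]] _] := gP.
  apply: (@positive_type_lim (fun n y => F n y * g y) _ (C * D)).
  - by move=> n; exact: (FP n).2.
  - by move=> n y; rewrite normrM ler_pM.
  - by move=> y; apply: cvgM; [exact: Ff|exact: cvg_cst].
split=> //; have [+ _] := fP _ positive_type1.
by under eq_fun do rewrite mulr1.
Qed.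

(** Multiplication by [cos (a . y)] averages the translates of the damped
    transform by [a] and [- a]. *)
Lemma positive_multiplier_cos a : positive_multiplier (fun y => cos (dotp a y)).
Proof.
split; first exact: bounded_measurable_cos.
move=> g [bg g0]; split.
  by apply: bounded_measurableM => //; exact: bounded_measurable_cos.
move=> d x d0.
have dotpD (u v y : 'rV[R]_N) : dotp (u + v) y = dotp u y + dotp v y.
  by rewrite /dotp -big_split; apply: eq_bigr => i _; rewrite mxE mulrDl.
have dotpNl (u y : 'rV[R]_N) : dotp (- u) y = - dotp u y.
  by rewrite /dotp -sumrN; apply: eq_bigr => i _; rewrite mxE mulNr.
have -> : damped_cosine (fun y => cos (dotp a y) * g y) d x =
    2^-1 * (damped_cosine g d (x + a) + damped_cosine g d (x - a)).
  rewrite /damped_cosine -RintegralD//; [|exact: integrable_damped..].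
  rewrite -RintegralZl//; last first.
    exact: (integrableD measurableT (integrable_damped (x + a) d0 bg)
      (integrable_damped (x - a) d0 bg)).
  apply: eq_Rintegral => y _; by rewrite !dotpD dotpNl cosD cosB; field.
by rewrite mulr_ge0// addr_ge0//; exact: g0.
Qed.

Lemma positive_multiplier_type f : positive_multiplier f -> positive_type f.
Proof.
move=> [_ /(_ _ positive_type1)].
by under eq_fun do rewrite mulr1.
Qed.

End positive_type.

(** * Elementary limits and the binomial series *)

Section real_limits.
Context {R : realType}.
Implicit Types (r a : R) (u : nat -> R).

(** At a positive limit this is continuity; the limit [0] is treated apart, as the
    power is not differentiable there. *)
Lemma cvg_powR r u a : 0 < r -> (forall n, 0 <= u n) -> u n @[n --> \oo] --> a ->
  u n `^ r @[n --> \oo] --> a `^ r.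
Proof.
move=> r0 u0 ua.
have : 0 <= a by apply: (cvgr_to_ge ua); apply: nearW.
rewrite le_eqVlt => /predU1P[a0|a0]; last first.
  apply: (@continuous_cvg _ _ _ _ _ u (fun x => x `^ r) a) => //.
  apply: differentiable_continuous; apply/derivable1_diffP.
  by apply: derivable_powR; rewrite in_itv/= andbT.
rewrite -a0 powR0 ?gt_eqF//; apply/cvgrPdist_lt => e e0.
have er0 : 0 < e `^ r^-1 by rewrite powR_gt0.
move/cvgrPdist_lt : ua => /(_ _ er0); apply: filterS => n.
rewrite -a0 !sub0r !normrN ger0_norm// ger0_norm ?powR_ge0// => une.
have -> : e = (e `^ r^-1) `^ r by rewrite -powRrM mulVf ?gt_eqF// powRr1// ltW.
by apply: gt0_ltr_powR; rewrite ?nnegrE ?powR_ge0.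
Qed.

(** Squeeze: [exp (- y / (1 - y)) <= 1 - y <= exp (- y)] for [y < 1]. *)
Lemma cvg_1sub_expR (y : nat -> R) L : (forall n, 0 <= y n) ->
  n.+1%:R * y n @[n --> \oo] --> L ->
  (1 - y n) ^+ n.+1 @[n --> \oo] --> expR (- L).
Proof.
move=> y0 yL.
have yc0 : y n @[n --> \oo] --> (0 : R).
  have -> : y = (fun n => n.+1%:R^-1 * (n.+1%:R * y n)).
    by apply/funext => n; rewrite mulrA mulVf ?mul1r.
  rewrite -(mul0r L); apply: cvgM => //; exact: cvg_harmonic.
apply: (@squeeze_cvgr _ _ _ _ (fun n => expR (- (n.+1%:R * y n / (1 - y n))))
   (fun n => expR (- (n.+1%:R * y n)))).
- have : \forall n \near \oo, y n < 1 by apply: (cvgr_lt 0).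
  apply: filterS => n yn1.
  have d0 : 0 < 1 - y n by rewrite subr_gt0.
  apply/andP; split; last first.
    rewrite -mulrN expRM_natl.
    apply: lerXn2r; [by rewrite nnegrE ltW|by rewrite nnegrE expR_ge0|].
    exact: expR_ge1Dx.
  rewrite -[_ * y n / _]mulrA -mulrN expRM_natl.
  apply: lerXn2r; [by rewrite nnegrE expR_ge0|by rewrite nnegrE ltW|].
  rewrite expRN -[leRHS]invrK.
  rewrite lef_pV2 ?posrE ?expR_gt0 ?invr_gt0//.
  apply: le_trans (expR_ge1Dx _); rewrite le_eqVlt; apply/orP; left; apply/eqP.
  by field; rewrite gt_eqF.
- apply: (@continuous_cvg _ _ _ _ _ (fun n => - (n.+1%:R * y n / (1 - y n))) expR).
    exact: continuous_expR.
  apply: cvgN; rewrite -[X in _ --> X]divr1; apply: cvgM => //.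
  apply: cvgV => //; rewrite -[X in _ --> X]subr0.
  by apply: cvgB; [exact: cvg_cst|].
- apply: (@continuous_cvg _ _ _ _ _ (fun n => - (n.+1%:R * y n)) expR).
    exact: continuous_expR.
  exact: cvgN.
Qed.

(** By the half-angle formula the quotient is [x^2 (sin v / v)^2] with
    [v = h x / 2]. *)
Lemma cvg_cosB1 (h : nat -> R) (x : R) : (forall n, 0 < h n) ->
  h n @[n --> \oo] --> (0 : R) ->
  2 * (1 - cos (h n * x)) / h n ^+ 2 @[n --> \oo] --> x ^+ 2.
Proof.
move=> h0 hc.
have [->|x0] := eqVneq x 0.
  rewrite (_ : (fun _ => _) = cst 0); first by rewrite expr0n; exact: cvg_cst.
  by apply/funext => n /=; rewrite mulr0 cos0 subrr mulr0 mul0r.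
pose v n := h n * x / 2.
have v0 n : v n != 0.
  by rewrite !mulf_neq0 ?invr_neq0 ?pnatr_eq0// lt0r_neq0.
have vc : v n @[n --> \oo] --> (0 : R).
  rewrite -(mul0r (x / 2)); under eq_fun do rewrite /v -mulrA.
  by apply: cvgM => //; exact: cvg_cst.
(* The derivative of [sin] at [0] is a limit over punctured neighbourhoods. *)
have vc' : v n @[n --> \oo] --> (0 : R)^'.
  move=> A nA; have : \forall n \near \oo, v n != 0 -> A (v n) by exact: (vc _ nA).
  by apply: filterS => n; apply; exact: v0.
have sv : sin (v n) / v n @[n --> \oo] --> (1 : R).
  have dsin : derivable (@sin R) 0 1 by exact: ex_derive.
  have : h^-1 *: (sin (h *: 1 + 0) - sin (0 : R)) @[h --> 0^'] --> (1 : R).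
    have := @derive_val _ _ _ _ _ _ _ (is_derive_sin (0 : R)).
    by rewrite cos0 => {2}<-; exact: dsin.
  move=> /(cvg_comp _ _ vc'); apply: cvg_trans; apply: near_eq_cvg.
  by apply: nearW => n /=; rewrite addr0 sin0 subr0 /GRing.scale/= mulr1 mulrC.
have -> : (fun n => 2 * (1 - cos (h n * x)) / h n ^+ 2) =
    (fun n => x ^+ 2 * (sin (v n) / v n) ^+ 2).
  apply/funext => n.
  have -> : cos (h n * x) = 1 - 2 * sin (v n) ^+ 2.
    have -> : h n * x = v n *+ 2 by rewrite /v mulr2n; field.
    by rewrite cos_mulr2n cos2sin2 mulr2n; ring.
  rewrite /v; field.
  by rewrite x0 gt_eqF.
rewrite -[X in _ --> X]mulr1; apply: cvgM; first exact: cvg_cst.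
rewrite -[X in _ --> X](expr1n _ 2).
apply: (@continuous_cvg _ _ _ _ _ (fun n => sin (v n) / v n) (fun x : R => x ^+ 2)) => //.
exact: exprn_continuous.
Qed.

End real_limits.

Section binomial_series.
Context {R : realType}.
Variable mu : R.
Hypotheses (mu0 : 0 < mu) (mu1 : mu <= 1).

(** The Taylor coefficients of [(1 - z) ^ mu]. *)
Fixpoint binom_coef (k : nat) : R :=
  if k is k'.+1 then binom_coef k' * (k'%:R - mu) / k%:R else 1.

Definition binom_poly n (z : R) := \sum_(k < n.+1) binom_coef k * z ^+ k.

Lemma binom_coefS k : binom_coef k.+1 * k.+1%:R = binom_coef k * (k%:R - mu).
Proof. by rewrite /= divfK. Qed.

(** The factors [k - mu] are nonnegative from [k = 1] on because [mu <= 1]; all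
    the positivity of the heat kernel rests on this sign. *)
Lemma binom_coef_le0 k : binom_coef k.+1 <= 0.
Proof.
elim: k => [|k IH]; first by rewrite /= mul1r sub0r divr1 oppr_le0 ltW.
rewrite -(pmulr_lle0 _ (ltr0Sn R k.+1)) binom_coefS mulr_le0_ge0// subr_ge0.
by rewrite (le_trans mu1)// ler1n.
Qed.

Lemma binom_coef_bound k : - binom_coef k.+1 * k.+1%:R <= mu.
Proof.
elim: k => [|k IH]; first by rewrite /= mul1r sub0r divr1 opprK mulr1.
rewrite mulNr binom_coefS -mulNr (le_trans _ IH)//.
by apply: ler_wpM2l; [rewrite oppr_ge0 binom_coef_le0|rewrite gerBl ltW].
Qed.

Let dbinom n (z : R) := \sum_(k < n.+1) binom_coef k * (k%:R * z ^+ k.-1).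

Lemma is_derive_binom_poly n (z : R) : is_derive z (1 : R) (binom_poly n) (dbinom n z).
Proof.
have -> : binom_poly n = \sum_(k < n.+1) (binom_coef k \*: (fun z : R => z ^+ k)).
  by apply/funext => x; rewrite /binom_poly fct_sumE.
apply: is_derive_sum => k; apply: is_deriveZ.
have -> : (fun z : R => z ^+ k) = (id : R -> R) ^+ k.
  by apply/funext => x; rewrite exprfctE.
have := @is_deriveX R _ id k z 1 1 (is_derive_id _ _).
by rewrite /GRing.scale/= mulr1.
Qed.

(** The partial sums solve the differential equation [(1 - z) y' + mu y = 0] of
    [(1 - z) ^ mu] up to a term of order [z ^ n]. *)
Lemma binom_polyE n (z : R) : (1 - z) * dbinom n z + mu * binom_poly n z =
  - (n%:R - mu) * binom_coef n * z ^+ n.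
Proof.
elim: n => [|n IH].
  by rewrite /dbinom /binom_poly !big_ord1 /= expr0; ring.
have -> : dbinom n.+1 z = dbinom n z + binom_coef n.+1 * (n.+1%:R * z ^+ n).
  by rewrite /dbinom big_ord_recr.
have -> : binom_poly n.+1 z = binom_poly n z + binom_coef n.+1 * z ^+ n.+1.
  by rewrite /binom_poly big_ord_recr.
have e := binom_coefS n; move: (binom_coef n.+1) e => b e.
have e' : - (n%:R - mu) * binom_coef n * z ^+ n = - (b * n.+1%:R) * z ^+ n.
  by rewrite e; ring.
rewrite e' in IH; rewrite !mulrDr addrACA IH exprS; ring.
Qed.

(** The derivative of [binom_poly z * (1 - z) ^ (- mu)] is the error term of
    [binom_polyE] times [(1 - z) ^ (- mu - 1)], hence geometrically small on
    [[-r, r]]; the mean value theorem concludes. *)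
Lemma binom_poly_lipschitz n (r x y : R) : r < 1 -> - r <= x -> x < y -> y <= r ->
  `|binom_poly n.+1 y * (1 - y) `^ (- mu) - binom_poly n.+1 x * (1 - x) `^ (- mu)|
  <= mu * (1 - r) `^ (- mu - 1) * r ^+ n.+1 * (y - x).
Proof.
move=> r1 rx xy yr.
pose G z := binom_poly n.+1 z * (1 - z) `^ (- mu).
pose dG z := (1 - z) `^ (- mu - 1) * (- (n.+1%:R - mu) * binom_coef n.+1 * z ^+ n.+1).
have dGP (z : R) : z <= r -> is_derive z (1 : R) G (dG z).
  move=> zr; have z1 : 0 < 1 - z by rewrite subr_gt0 (le_lt_trans zr).
  have d1 : is_derive z (1 : R) (fun z : R => 1 - z) (- 1).
    have := is_deriveB (is_derive_cst (1 : R) z (1 : R)) (is_derive_id z (1 : R)).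
    by rewrite sub0r.
  have d2 := @is_derive1_comp _ (fun x => x `^ (- mu)) (fun z : R => 1 - z) _ _ _
    (is_derive1_powR (- mu) z1) d1.
  refine (is_derive_eq (is_deriveM (is_derive_binom_poly n.+1 z) d2) _).
  rewrite /GRing.scale/= /dG -binom_polyE.
  have -> : (1 - z) `^ (- mu) = (1 - z) * (1 - z) `^ (- mu - 1).
    have <- : (1 - z) `^ (1 + (- mu - 1)) = (1 - z) * (1 - z) `^ (- mu - 1).
      by rewrite powRD ?(gt_eqF z1) ?implybT// powRr1// ltW.
    by congr (_ `^ _); ring.
  by ring.
have cG : {within `[x, y], continuous G}.
  apply: derivable_within_continuous => z; rewrite in_itv/= => /andP[_ zy].
  by have := dGP z (le_trans zy yr) => ?; exact: ex_derive.
have [c + ->] := MVT xy (fun z zxy => dGP z (le_trans (ltW (andP zxy).2) yr)) cG.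
rewrite in_itv/= => /andP[xc cy].
rewrite normrM (ger0_norm (_ : 0 <= y - x)); last by rewrite subr_ge0 ltW.
apply: ler_wpM2r; first by rewrite subr_ge0 ltW.
rewrite [leRHS](_ : _ = (1 - r) `^ (- mu - 1) * (mu * r ^+ n.+1)); last by ring.
rewrite /dG normrM; apply: ler_pM; [exact: normr_ge0|exact: normr_ge0| |].
- have c1 : 0 < 1 - c by lra.
  have r1' : 0 < 1 - r by lra.
  rewrite ger0_norm ?powR_ge0// (_ : - mu - 1 = - (mu + 1)); last by ring.
  rewrite !powRN lef_pV2 ?posrE ?powR_gt0//.
  apply: ge0_ler_powR; rewrite ?nnegrE; first by rewrite addr_ge0// ltW.
  - exact: ltW.
  - exact: ltW.
  - by rewrite lerD2l lerN2 ltW// (lt_le_trans cy).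
- rewrite normrM; apply: ler_pM; [exact: normr_ge0|exact: normr_ge0| |].
    have nm : 0 <= n.+1%:R - mu by rewrite subr_ge0 (le_trans mu1)// ler1n.
    rewrite normrM normrN (ger0_norm nm) (ler0_norm (binom_coef_le0 n)) mulrC.
    apply: le_trans (binom_coef_bound n).
    by apply: ler_wpM2l; [rewrite oppr_ge0 binom_coef_le0|rewrite gerBl ltW].
  rewrite normrX; apply: lerXn2r; rewrite ?nnegrE//.
    by have := normr_ge0 c; lra.
  by rewrite ler_norml; apply/andP; split; lra.
Qed.

(** By [binom_poly_lipschitz] between [0] and [z], the partial sums times
    [(1 - z) ^ (- mu)] tend to their value [1] at the origin. *)
Lemma cvg_binom_poly (z : R) : `|z| < 1 ->
  binom_poly n z @[n --> \oo] --> (1 - z) `^ mu.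
Proof.
move=> z1; set r := `|z|.
have z1' : 0 < 1 - z by move: z1; rewrite ltr_norml => /andP[]; lra.
have B0 n : binom_poly n 0 = 1.
  rewrite /binom_poly big_ord_recl big1 ?addr0 ?expr0 ?mulr1// => i _.
  by rewrite expr0n mulr0.
pose K := mu * (1 - r) `^ (- mu - 1).
have le n : `|binom_poly n.+1 z * (1 - z) `^ (- mu) - 1| <= K * r * r ^+ n.+1.
  rewrite [leRHS]mulrAC.
  have [zn|zp|->] := ltgtP z 0.
  - have rE : r = - z by rewrite /r ltr0_norm.
    have := @binom_poly_lipschitz n r z 0 z1 _ zn _.
    rewrite B0 subr0 powR1 mul1r sub0r -rE distrC; apply.
      by rewrite rE opprK.
    exact: normr_ge0.
  - have rE : r = z by rewrite /r gtr0_norm.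
    have := @binom_poly_lipschitz n r 0 z z1 _ zp _.
    rewrite B0 !subr0 powR1 mul1r => H.
    rewrite [X in _ <= _ * X]rE; apply: H; last by rewrite rE.
    by rewrite oppr_le0 normr_ge0.
  - have r0 : 0 <= r := normr_ge0 _.
    rewrite B0 subr0 powR1 mulr1 subrr normr0 mulr_ge0// mulr_ge0 ?exprn_ge0//.
    by rewrite mulr_ge0 ?powR_ge0// ltW.
have c1 : binom_poly n z * (1 - z) `^ (- mu) @[n --> \oo] --> (1 : R).
  rewrite -(cvg_shiftS (fun n => binom_poly n z * (1 - z) `^ (- mu))).
  apply/subr_cvg0; apply: norm_cvg0.
  apply: (@squeeze_cvgr _ _ _ _ (cst 0) (fun n => K * r * r ^+ n.+1)).
  + by apply: nearW => n; rewrite normr_ge0 le.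
  + exact: cvg_cst.
  + rewrite -(mulr0 (K * r)); apply: cvgM; first exact: cvg_cst.
    rewrite (cvg_shiftS (fun n => r ^+ n)).
    by apply: cvg_expr; rewrite normr_id.
have -> : (fun n => binom_poly n z) =
    (fun n => binom_poly n z * (1 - z) `^ (- mu) * (1 - z) `^ mu).
  by apply/funext => n; rewrite -mulrA powRN mulVf ?mulr1// gt_eqF// powR_gt0.
rewrite -[X in _ --> X]mul1r; apply: cvgM => //; exact: cvg_cst.
Qed.

Lemma binom_poly_sub1 n (z : R) :
  1 - binom_poly n z = \sum_(k < n) - binom_coef k.+1 * z ^+ k.+1.
Proof.
rewrite /binom_poly big_ord_recl/= expr0 mulr1 opprD addrA subrr add0r -sumrN.
by apply: eq_bigr => i _; rewrite mulNr.
Qed.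

(** By the signs of the coefficients the left-hand side is largest at [`|z|], where
    the partial sums decrease to the nonnegative number [(1 - `|z|) ^ mu]. *)
Lemma binom_poly_bound n (z : R) : `|z| < 1 -> `|1 - binom_poly n z| <= 1.
Proof.
move=> z1; rewrite binom_poly_sub1 (le_trans (ler_norm_sum _ _ _))//.
apply: (@le_trans _ _ (1 - binom_poly n `|z|)).
  rewrite binom_poly_sub1; apply: ler_sum => k _.
  by rewrite normrM normrX ger0_norm// oppr_ge0 binom_coef_le0.
rewrite gerBl.
have nz1 : `|(`|z|)| < 1 by rewrite normr_id.
apply: (le_trans (powR_ge0 (1 - `|z|) mu)).
have noninc : nonincreasing_seq (fun n => binom_poly n `|z|).
  apply/nonincreasing_seqP => m.
  have -> : binom_poly m.+1 `|z| = binom_poly m `|z| + binom_coef m.+1 * `|z| ^+ m.+1.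
    by rewrite /binom_poly big_ord_recr.
  by rewrite gerDl; apply: mulr_le0_ge0; [exact: binom_coef_le0|exact: exprn_ge0].
have := nonincreasing_cvgn_ge noninc (cvgP _ (cvg_binom_poly nz1)) n.
by rewrite (cvg_lim _ (cvg_binom_poly nz1)).
Qed.

End binomial_series.

(** * The symbol of the fractional heat semigroup *)

Section heat_symbol.
Context {R : realType} {N : nat}.
Local Notation leb := (@lebesgue_rV R N).
Variable mu : R.
Hypotheses (mu0 : 0 < mu) (mu1 : mu <= 1).

Lemma subr1_powR_bound (z : R) : `|z| <= 1 -> `|1 - (1 - z) `^ mu| <= 1.
Proof.
rewrite ler_norml => /andP[z1 z2].
have p0 := powR_ge0 (1 - z) mu.
suff p2 : (1 - z) `^ mu <= 2 by rewrite ler_norml; apply/andP; split; lra.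
have [z1'|z1'] := leP 1 (1 - z).
  by apply: (le_trans (ler1_powR z1' mu1)); lra.
apply: (@le_trans _ _ (1 `^ mu)); last by rewrite powR1; lra.
apply: ge0_ler_powR; [exact: ltW|by rewrite nnegrE subr_ge0|by rewrite nnegrE|exact: ltW].
Qed.

(** The factor [r < 1] keeps the argument of the binomial series inside the open
    disc of convergence, with a bound uniform in the degree. *)
Lemma positive_multiplier_subr1_powR_damped (f : 'rV[R]_N -> R) (r : R) :
  positive_multiplier f -> (forall y, `|f y| <= 1) -> 0 <= r < 1 ->
  positive_multiplier (fun y => 1 - (1 - r * f y) `^ mu).
Proof.
move=> fM f1 /andP[r0 r1].
have rf y : `|r * f y| < 1.
  by rewrite normrM (le_lt_trans _ r1)// ger0_norm// ler_piMr.
apply: (@positive_multiplier_lim _ _ (fun n y => 1 - binom_poly mu n (r * f y)) _ 1).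
- move=> n; under eq_fun do rewrite binom_poly_sub1.
  apply: positive_multiplier_sum => i.
  apply: positive_multiplierM.
    by apply: positive_multiplier_cst; rewrite oppr_ge0 binom_coef_le0.
  apply: positive_multiplierX; apply: positive_multiplierM => //.
  exact: positive_multiplier_cst.
- by move=> n y; exact: binom_poly_bound.
- by move=> y; apply: cvgB; [exact: cvg_cst|exact: cvg_binom_poly].
Qed.

(** This is subordination of a random walk: [1 - (1 - f) ^ mu] is the symbol of
    the walk of symbol [f] stopped after a random number of steps. *)
Lemma positive_multiplier_subr1_powR (f : 'rV[R]_N -> R) :
  positive_multiplier f -> (forall y, `|f y| <= 1) ->
  positive_multiplier (fun y => 1 - (1 - f y) `^ mu).
Proof.
move=> fM f1; pose r n : R := 1 - n.+1%:R^-1.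
have r01 n : 0 <= r n < 1.
  rewrite /r subr_ge0 invf_le1// ler1n/= gtrBl invr_gt0//.
apply: (@positive_multiplier_lim _ _ (fun n y => 1 - (1 - r n * f y) `^ mu) _ 1).
- by move=> n; exact: positive_multiplier_subr1_powR_damped.
- move=> n y; apply: subr1_powR_bound; have /andP[r0 r1] := r01 n.
  by rewrite normrM ger0_norm// mulr_ile1// ltW.
- move=> y; apply: cvgB; first exact: cvg_cst.
  apply: cvg_powR => //.
    move=> n; have /andP[r0 r1] := r01 n; rewrite subr_ge0.
    rewrite (le_trans (ler_norm _))// normrM ger0_norm// mulr_ile1//.
    exact: ltW.
  apply: cvgB; first exact: cvg_cst.
  rewrite -[X in _ --> X]mul1r; apply: cvgM; last exact: cvg_cst.
  rewrite -[X in _ --> X]subr0; apply: cvgB; [exact: cvg_cst|exact: cvg_harmonic].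
Qed.

(** The characteristic function of one step of the simple random walk of mesh
    [h]. *)
Definition walk_symbol (h : R) (y : 'rV[R]_N) : R :=
  N%:R^-1 * \sum_(j < N) cos (h * y ord0 j).

Lemma positive_multiplier_walk h : positive_multiplier (walk_symbol h).
Proof.
apply: positive_multiplierM; first by apply: positive_multiplier_cst; rewrite invr_ge0.
apply: positive_multiplier_sum => j.
have := positive_multiplier_cos (h *: delta_mx ord0 j : 'rV[R]_N).
congr positive_multiplier; apply/funext => y; congr cos.
rewrite /dotp (bigD1 j)//= big1 ?addr0; first by rewrite !mxE !eqxx mulr1.
by move=> i ij; rewrite !mxE eqxx (negbTE ij) mulr0 mul0r.
Qed.

Lemma walk_symbol_bound h y : (0 < N)%N -> `|walk_symbol h y| <= 1.
Proof.
move=> N0; rewrite /walk_symbol normrM ger0_norm ?invr_ge0//.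
rewrite ler_pdivrMl ?ltr0n// mulr1 (le_trans (ler_norm_sum _ _ _))//.
have -> : N%:R = \sum_(j < N) (1 : R) by rewrite sumr_const card_ord.
by apply: ler_sum => j _; rewrite ler_norml cos_geN1 cos_le1.
Qed.

Definition heat_symbol (t : R) (y : 'rV[R]_N) : R :=
  expR (- (t * enorm y `^ (2 * mu))).

Lemma enorm_powR (y : 'rV[R]_N) : enorm y `^ (2 * mu) = dotp y y `^ mu.
Proof.
have d0 : 0 <= dotp y y by apply: sumr_ge0 => i _; rewrite -expr2 sqr_ge0.
rewrite powRrM; congr (_ `^ _).
by rewrite (@powR_mulrn _ _ 2) ?sqrtr_ge0// sqr_sqrtr.
Qed.

(** The mesh [h n] is chosen so that [n + 1] steps of the subordinated walk give
    exactly [t]: with [g n = (t / (n + 1)) ^ (1 / mu)] and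
    [h n ^ 2 = 2 N g n], one has [(n + 1) g n ^ mu = t] while
    [1 - walk_symbol] is [g n] times a quantity that tends to [|xi| ^ 2]. *)
Lemma positive_multiplier_heat_symbol t : (0 < N)%N -> 0 < t ->
  positive_multiplier (heat_symbol t).
Proof.
move=> N0 t0.
have NR : 0 < N%:R :> R by rewrite ltr0n.
pose g n : R := (t / n.+1%:R) `^ mu^-1; pose h n := Num.sqrt (2 * N%:R * g n).
have g0 n : 0 < g n by rewrite powR_gt0// divr_gt0.
have gmu n : n.+1%:R * g n `^ mu = t.
  rewrite -powRrM mulVf ?gt_eqF// powRr1; last by rewrite divr_ge0// ltW.
  by rewrite mulrC divfK.
have h0 n : 0 < h n by rewrite sqrtr_gt0 !mulr_gt0.
have h2 n : h n ^+ 2 = 2 * N%:R * g n by rewrite sqr_sqrtr// !mulr_ge0// ltW.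
have gc : g n @[n --> \oo] --> (0 : R).
  rewrite -(@powR0 _ mu^-1) ?invr_neq0 ?gt_eqF//.
  apply: cvg_powR; first by rewrite invr_gt0.
    by move=> n; rewrite divr_ge0// ltW.
  by rewrite -(mulr0 t); apply: cvgM; [exact: cvg_cst|exact: cvg_harmonic].
have hc : h n @[n --> \oo] --> (0 : R).
  rewrite -sqrtr0; apply: (@continuous_cvg _ _ _ _ _ (fun n => 2 * N%:R * g n) Num.sqrt).
    exact: sqrt_continuous.
  by rewrite -(mulr0 (2 * N%:R)); apply: cvgM => //; exact: cvg_cst.
apply: (@positive_multiplier_lim _ _
  (fun n y => (1 - (1 - walk_symbol (h n) y) `^ mu) ^+ n.+1) _ 1).
- move=> n; apply: positive_multiplierX.
  apply: positive_multiplier_subr1_powR; first exact: positive_multiplier_walk.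
  by move=> y; exact: walk_symbol_bound.
- move=> n y; rewrite normrX exprn_ile1//.
  by apply: subr1_powR_bound; exact: walk_symbol_bound.
- move=> y; apply: cvg_1sub_expR; first by move=> n; exact: powR_ge0.
  pose u n := \sum_(j < N) 2 * (1 - cos (h n * y ord0 j)) / h n ^+ 2.
  have u0 n : 0 <= u n.
    apply: sumr_ge0 => j _; apply: divr_ge0; last exact: sqr_ge0.
    by apply: mulr_ge0 => //; rewrite subr_ge0 cos_le1.
  have -> : (fun n => n.+1%:R * (1 - walk_symbol (h n) y) `^ mu) =
      (fun n => t * u n `^ mu).
    apply/funext => n.
    have -> : 1 - walk_symbol (h n) y = g n * u n.
      rewrite /u -mulr_suml -mulr_sumr sumrB sumr_const card_ord h2 /walk_symbol.
      by field; rewrite !gt_eqF.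
    by rewrite powRM ?(ltW (g0 n))// mulrA gmu.
  apply: cvgM; first exact: cvg_cst.
  rewrite enorm_powR; apply: cvg_powR => //.
  rewrite /dotp; under eq_bigr do rewrite -expr2.
  apply: cvg_big => [|j _]; [exact: add_continuous|exact: cvg_cosB1].
Qed.

Lemma heat_symbol_gt0 t y : 0 < heat_symbol t y.
Proof. exact: expR_gt0. Qed.

Lemma heat_symbol_le1 t y : 0 <= t -> heat_symbol t y <= 1.
Proof.
by move=> t0; rewrite /heat_symbol expR_le1 oppr_le0 mulr_ge0// powR_ge0.
Qed.

Lemma measurable_heat_symbol t : measurable_fun setT (heat_symbol t).
Proof.
apply: measurableT_comp => //; apply: measurableT_comp => //.
apply: measurable_funM => //.
exact: (measurableT_comp (measurable_powR _) measurable_enorm).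
Qed.

(** This weight dominates the symbol and has an explicit integral; it is also the
    Fourier transform of [expw 1]. *)
Definition cauchyw (y : 'rV[R]_N) : R := \prod_(j < N) (2 / (1 + y ord0 j ^+ 2)).

Lemma sqrD1_gt0 (s : R) : 0 < 1 + s ^+ 2.
Proof. by rewrite ltr_pwDl// sqr_ge0. Qed.

Lemma cauchyw_gt0 y : 0 < cauchyw y.
Proof. by apply: prodr_gt0 => j _; rewrite divr_gt0// sqrD1_gt0. Qed.

Lemma measurable_cauchy : measurable_fun setT (fun s : R => 2 / (1 + s ^+ 2)).
Proof.
apply: continuous_measurable_fun => s; apply: cvgM; first exact: cvg_cst.
apply: cvgV; first by rewrite gt_eqF// sqrD1_gt0.
by apply: cvgD; [exact: cvg_cst|exact: exprn_continuous].
Qed.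

Lemma measurable_cauchyw : measurable_fun setT cauchyw.
Proof. exact: measurable_prod_coord (fun _ => measurable_cauchy). Qed.

Lemma integral_cauchyw : (\int[leb]_y (cauchyw y)%:E = ((2 * pi) ^+ N)%:E)%E.
Proof.
rewrite (ge0_integral_rV_prod (fun _ => measurable_cauchy)); last first.
  by move=> i s; rewrite divr_ge0// ltW// sqrD1_gt0.
under eq_bigr do rewrite integral_cauchy//.
by rewrite prodEFin prodr_const card_ord.
Qed.

Lemma integrable_cauchyw : leb.-integrable setT (EFin \o cauchyw).
Proof.
apply/integrableP; split; first by apply/measurable_EFinP; exact: measurable_cauchyw.
under eq_integral do rewrite /= ger0_norm ?(ltW (cauchyw_gt0 _))//.
by rewrite integral_cauchyw ltry.
Qed.

(** The exponential decay in [s ^ mu], [s = |y| ^ 2], beats the polynomial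
    [(1 + s) ^ N], which bounds the product of the [1 + y_j ^ 2]. *)
Lemma heat_symbol_le_cauchyw t : 0 < t ->
  exists2 C, 0 < C & forall y, heat_symbol t y <= C * cauchyw y.
Proof.
move=> t0; pose m := (Num.truncn (N%:R / mu)).+1.
have mmu : N%:R <= m%:R * mu.
  by rewrite -ler_pdivrMr// ltW// truncnS_gt.
pose K := 1 + (m%:R / t) ^+ m.
have K1 : 1 <= K by rewrite lerDl exprn_ge0// divr_ge0// ltW.
(* From [exp (u / m) >= u / m], raised to the power [m]. *)
have expB (u : R) : 0 < u -> expR (- u) <= (m%:R / u) ^+ m.
  move=> u0; rewrite expRN -[leRHS]invrK lef_pV2 ?posrE ?expR_gt0 ?invr_gt0 ?exprn_gt0 ?divr_gt0//.
  have m0 : 0 < m%:R :> R by rewrite ltr0n.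
  have -> : expR u = expR (u / m%:R) ^+ m.
    by rewrite -expRM_natl mulrC divfK// gt_eqF.
  rewrite -exprVn invf_div; apply: lerXn2r.
  - by rewrite nnegrE divr_ge0 ?ltW.
  - by rewrite nnegrE expR_ge0.
  - by apply: le_trans (expR_ge1Dx _); rewrite lerDr.
have B (s : R) : 0 <= s -> (1 + s) ^+ N * expR (- (t * s `^ mu)) <= 2 ^+ N * K.
  move=> s0; have [s1|s1] := leP s 1.
    apply: ler_pM; rewrite ?exprn_ge0 ?addr_ge0 ?expR_ge0//.
      by apply: lerXn2r; rewrite ?nnegrE ?addr_ge0//; lra.
    by rewrite (le_trans _ K1)// expR_le1 oppr_le0 mulr_ge0 ?powR_ge0 ?ltW.
  have sp : 0 < s by lra.
  have smu : 0 < s `^ mu by rewrite powR_gt0.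
  apply: (@le_trans _ _ (2 ^+ N * ((s `^ mu) ^+ m * (m%:R / (t * s `^ mu)) ^+ m))).
    rewrite mulrA; apply: ler_pM; rewrite ?exprn_ge0 ?addr_ge0 ?expR_ge0//.
      apply: (@le_trans _ _ ((2 * s) ^+ N)).
        by apply: lerXn2r; rewrite ?nnegrE ?addr_ge0 ?mulr_ge0//; lra.
      rewrite exprMn; apply: ler_wpM2l; first by rewrite exprn_ge0.
      rewrite -(powR_mulrn N s0) -(powR_mulrn m (powR_ge0 s mu)) -powRrM.
      by apply: ler_powR; [exact: ltW|rewrite mulrC].
    by apply: expB; rewrite mulr_gt0.
  rewrite -exprMn; apply: ler_wpM2l; first by rewrite exprn_ge0.
  rewrite (_ : s `^ mu * _ = m%:R / t); last first.
    by field; rewrite !gt_eqF.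
  by rewrite /K lerDr.
exists (2 ^+ N * K / 2 ^+ N).
  by rewrite divr_gt0 ?mulr_gt0 ?exprn_gt0// (lt_le_trans _ K1).
move=> y; have d0 : 0 <= dotp y y by apply: sumr_ge0 => i _; rewrite -expr2 sqr_ge0.
have -> : 2 ^+ N * K / 2 ^+ N * cauchyw y = 2 ^+ N * K * \prod_(j < N) (1 + y ord0 j ^+ 2)^-1.
  rewrite /cauchyw big_split/= prodr_const card_ord; field.
  by rewrite expf_neq0.
rewrite prodfV ler_pdivlMr; last by apply: prodr_gt0 => j _; exact: sqrD1_gt0.
rewrite mulrC; apply: le_trans (B _ d0).
rewrite /heat_symbol enorm_powR; apply: ler_wpM2r; first exact: expR_ge0.
rewrite -[X in _ ^+ X](card_ord N) -prodr_const; apply: ler_prod => j _.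
rewrite (ltW (sqrD1_gt0 _)) lerD2l /dotp (bigD1 j)//= -expr2 lerDl.
by apply: sumr_ge0 => i _; rewrite -expr2 sqr_ge0.
Qed.

Lemma integrable_heat_symbol t : 0 < t -> leb.-integrable setT (EFin \o heat_symbol t).
Proof.
move=> t0; have [C C0 CP] := heat_symbol_le_cauchyw t0.
apply: (@le_integrable _ _ _ _ _ _ _ (fun y => (C * cauchyw y)%:E)) => //.
- by apply/measurable_EFinP; exact: measurable_heat_symbol.
- move=> y _; rewrite /= lee_fin (ger0_norm (ltW (heat_symbol_gt0 _ _))).
  exact: (le_trans (CP y) (ler_norm _)).
- under eq_fun do rewrite EFinM.
  by apply: integrableZl => //; exact: integrable_cauchyw.
Qed.

End heat_symbol.

(** * The fractional heat kernel is a probability density *)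

Section heat_kernel.
Context {R : realType} {N : nat}.
Local Notation leb := (@lebesgue_rV R N).
Variables mu t : R.
Hypotheses (N0 : (0 < N)%N) (mu0 : 0 < mu) (mu1 : mu <= 1) (t0 : 0 < t).
Local Notation psi := (@heat_symbol R N mu t).
Local Notation k := (@frac_heat_kernel R N mu t).

Lemma frac_heat_kernelE x :
  k x = (2 * pi) ^- N * Rintegral leb setT (fun y => psi y * cos (dotp x y)).
Proof.
have ReM (a : R) (z : R[i]) : complex.Re (a%:C%C * z) = a * complex.Re z.
  by case: z => p q /=; rewrite mul0r subr0.
rewrite /frac_heat_kernel /frac_heat_fourier ReM; congr (_ * _).
by apply: eq_Rintegral => y _; rewrite frac_heat_symbolE.
Qed.

Lemma measurable_cos_dotp0 (x : 'rV[R]_N) : measurable_fun setT (fun y => cos (dotp x y)).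
Proof. by have [] := bounded_measurable_cos x. Qed.

Lemma integrable_heat_symbol_cos x :
  leb.-integrable setT (fun y => (psi y * cos (dotp x y))%:E).
Proof.
apply: (@le_integrable _ _ _ _ _ _ _ (EFin \o psi)) => //.
- apply/measurable_EFinP; apply: measurable_funM; first exact: measurable_heat_symbol.
  exact: measurable_cos_dotp0.
- move=> y _; rewrite /= lee_fin normrM ler_piMr//.
  by rewrite ler_norml cos_geN1 cos_le1.
- exact: integrable_heat_symbol.
Qed.

Lemma expwE d (y : 'rV[R]_N) : expw d y = expR (- (d * \sum_(j < N) `|y ord0 j|)).
Proof. by rewrite mulr_sumr -sumrN expR_sum. Qed.

Lemma cvg_harmonic_expw (y : 'rV[R]_N) :
  expw n.+1%:R^-1 y @[n --> \oo] --> (1 : R).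
Proof.
pose s := \sum_(j < N) `|y ord0 j|.
have -> : (fun n => expw n.+1%:R^-1 y) = expR \o (fun n => - (n.+1%:R^-1 * s)).
  by apply/funext => n; exact: expwE.
have ec : - (n.+1%:R^-1 * s) @[n --> \oo] --> - (0 * s).
  by apply: cvgN; apply: cvgM; [exact: cvg_harmonic|exact: cvg_cst].
have H := continuous_cvg _ (@continuous_expR R (- (0 * s))) ec.
have e1 : expR (- (0 * s)) = 1 by rewrite mul0r oppr0 expR0.
rewrite e1 in H; exact: H.
Qed.

(** The symbol is of positive type and integrable, so its Fourier transform is the
    limit of its damped Fourier transforms. *)
Lemma frac_heat_kernel_ge0 x : 0 <= k x.
Proof.
rewrite frac_heat_kernelE mulr_ge0// ?invr_ge0 ?exprn_ge0 ?mulr_ge0 ?pi_ge0//.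
apply: fine_ge0.
have cvgI := @dominated_cvg _ _ _ leb setT measurableT
  (fun n y => (psi y * (cos (dotp x y) * expw n.+1%:R^-1 y))%:E)
  (fun y => (psi y * cos (dotp x y))%:E) (EFin \o psi).
have {}cvgI : (\int[leb]_y (psi y * (cos (dotp x y) * expw n.+1%:R^-1 y))%:E)%E
    @[n --> \oo] --> (\int[leb]_y (psi y * cos (dotp x y))%:E)%E.
  apply: cvgI => //.
  - move=> n; apply/measurable_EFinP; apply: measurable_funM.
      exact: measurable_heat_symbol.
    exact: measurable_cosw.
  - move=> y _; apply/cvg_EFin; first by apply: nearW.
    apply: cvgM; first exact: cvg_cst.
    rewrite -[X in _ --> X]mulr1.
    by apply: cvgM; [exact: cvg_cst|exact: cvg_harmonic_expw].
  - exact: integrable_heat_symbol.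
  - move=> n y _ /=; rewrite lee_fin normrM gtr0_norm ?heat_symbol_gt0//.
    apply: ler_piMr; first by rewrite ltW ?heat_symbol_gt0.
    by apply: (le_trans (cosw_le _ _ _)); apply: expw_le1.
apply: (cvge_to_ge cvgI); apply: nearW => n.
have [bf] := positive_multiplier_type (positive_multiplier_heat_symbol mu0 mu1 N0 t0).
have d0 : 0 < n.+1%:R^-1 :> R by rewrite invr_gt0.
move=> /(_ _ x d0).
have /(integrable_fin_num measurableT) := integrable_damped x d0 bf.
by move=> /fineK <- ; rewrite lee_fin.
Qed.

Lemma measurable_dotp_prod :
  measurable_fun setT (fun z : 'rV[R]_N * 'rV[R]_N => dotp z.1 z.2).
Proof.
apply: measurable_sum => i; apply: measurable_funM.
- exact: (measurableT_comp (measurable_coord i) measurable_fst).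
- exact: (measurableT_comp (measurable_coord i) measurable_snd).
Qed.

Let I := Rintegral leb setT psi.

Let IE : (\int[leb]_y (psi y)%:E = I%:E)%E.
Proof.
by rewrite /I /Rintegral fineK// integrable_fin_num//; exact: integrable_heat_symbol.
Qed.

Let c0 : 0 < (2 * pi) ^+ N :> R.
Proof. by rewrite exprn_gt0// mulr_gt0// pi_gt0. Qed.

(** Adding the integral of the symbol gives a nonnegative integrand, to which
    Tonelli applies below. *)
Lemma integral_heat_symbol_cosD1 x :
  (\int[leb]_y (psi y * (1 + cos (dotp x y)))%:E = (I + (2 * pi) ^+ N * k x)%:E)%E.
Proof.
under eq_integral do rewrite mulrDr mulr1 EFinD.
rewrite integralD//; last 2 first.
- exact: integrable_heat_symbol.
- exact: integrable_heat_symbol_cos.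
rewrite IE EFinD; congr (_ + _)%E.
rewrite frac_heat_kernelE mulrA divff ?mul1r ?gt_eqF//.
by rewrite /Rintegral fineK// integrable_fin_num//; exact: integrable_heat_symbol_cos.
Qed.

Let F (z : 'rV[R]_N * 'rV[R]_N) := (psi z.2 * (1 + cos (dotp z.1 z.2)))%:E.

Let mF : measurable_fun setT F.
Proof.
apply/measurable_EFinP; apply: measurable_funM.
  exact: (measurableT_comp (measurable_heat_symbol _ _) measurable_snd).
apply: measurable_funD => //; apply: measurableT_comp; last exact: measurable_dotp_prod.
by apply: continuous_measurable_fun; exact: continuous_cos.
Qed.

Let F0 z : (0 <= F z)%E.
Proof. by rewrite lee_fin mulr_ge0 ?cosD1_ge0// ltW// heat_symbol_gt0. Qed.

Lemma measurable_frac_heat_kernel : measurable_fun setT k.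
Proof.
have m1 : measurable_fun setT (fun x => I + (2 * pi) ^+ N * k x).
  apply/measurable_EFinP.
  have := @measurable_fun_fubini_tonelli_F _ _ _ _ _ leb F mF F0.
  apply: eq_measurable_fun => x _; exact: integral_heat_symbol_cosD1.
have -> : k = (fun x => (2 * pi) ^- N * ((I + (2 * pi) ^+ N * k x) - I)).
  by apply/funext => x; rewrite addrAC subrr add0r mulrA mulVf ?mul1r// gt_eqF.
by apply: measurable_funM => //; apply: measurable_funB.
Qed.

(** A Parseval identity: the double integral of
    [expw x * psi y * (1 + cos (x . y))] is computed in both orders.  The term
    coming from [1] is finite and the same on both sides, so it cancels; the
    substitution [y -> d y] then turns the transform of the weight into
    [cauchyw]. *)
Lemma integral_kernel_expw d : 0 < d ->
  (\int[leb]_x (k x * expw d x)%:E =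
   ((2 * pi) ^- N)%:E * \int[leb]_y (psi (d *: y) * cauchyw y)%:E)%E.
Proof.
move=> d0.
pose G (z : 'rV[R]_N * 'rV[R]_N) := ((expw d z.1)%:E * F z)%E.
have mw : measurable_fun setT (fun z : 'rV[R]_N * 'rV[R]_N => (expw d z.1)%:E).
  by apply/measurable_EFinP; exact: (measurableT_comp (measurable_expw d) measurable_fst).
have mG : measurable_fun setT G by exact: emeasurable_funM.
have G0 z : (0 <= G z)%E by rewrite mule_ge0// lee_fin expw_ge0.
have mk := measurable_frac_heat_kernel.
pose A := (\int[leb]_x (k x * expw d x)%:E)%E.
pose Q (y : 'rV[R]_N) := psi y * \prod_(i < N) (2 * d / (d ^+ 2 + y ord0 i ^+ 2)).
have Q0 y : 0 <= Q y.
  rewrite mulr_ge0 ?(ltW (heat_symbol_gt0 _ _ _))//; apply: prodr_ge0 => i _.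
  by rewrite divr_ge0 ?addr_ge0 ?sqr_ge0// mulr_ge0// ltW.
have mQ : measurable_fun setT Q.
  apply: measurable_funM; first exact: measurable_heat_symbol.
  apply: (@measurable_prod_coord _ _ (fun _ s => 2 * d / (d ^+ 2 + s ^+ 2))) => _.
  apply: continuous_measurable_fun => s; apply: cvgM; first exact: cvg_cst.
  apply: cvgV; first by rewrite gt_eqF// ltr_pwDl ?exprn_gt0// sqr_ge0.
  by apply: cvgD; [exact: cvg_cst|exact: exprn_continuous].
have E1 : (\int[leb]_x \int[leb]_y G (x, y) =
    ((2 / d) ^+ N * I)%:E + ((2 * pi) ^+ N)%:E * A)%E.
  transitivity (\int[leb]_x ((I * expw d x)%:E + ((2 * pi) ^+ N)%:E * (k x * expw d x)%:E))%E.
    apply: eq_integral => x _; rewrite /G /=.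
    have mFx : measurable_fun setT (fun y => F (x, y)).
      exact: (measurableT_comp mF (pair1_measurable x)).
    have wx0 : (0 <= (expw d x)%:E)%E by rewrite lee_fin expw_ge0.
    rewrite (ge0_integralZl leb measurableT mFx (fun y _ => F0 (x, y)) wx0).
    rewrite integral_heat_symbol_cosD1 -!EFinM -EFinD; congr EFin; ring.
  have I0 : 0 <= I.
    by apply: Rintegral_ge0 => y _; rewrite ltW// heat_symbol_gt0.
  have kw0 x : 0 <= k x * expw d x by rewrite mulr_ge0 ?expw_ge0 ?frac_heat_kernel_ge0.
  have mkw : measurable_fun setT (fun x => (k x * expw d x)%:E).
    by apply/measurable_EFinP; apply: measurable_funM => //; exact: measurable_expw.
  rewrite ge0_integralD//; last 4 first.
  - by move=> x _; rewrite lee_fin mulr_ge0 ?expw_ge0.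
  - by apply/measurable_EFinP; apply: measurable_funM => //; exact: measurable_expw.
  - by move=> x _; rewrite -EFinM lee_fin mulr_ge0// ltW.
  - exact: measurable_funeM.
  congr (_ + _)%E.
    under eq_integral do rewrite EFinM.
    have mwx : measurable_fun setT (fun x : 'rV[R]_N => (expw d x)%:E).
      by apply/measurable_EFinP; exact: measurable_expw.
    rewrite (ge0_integralZl leb measurableT mwx).
    + by rewrite integral_expw// -EFinM mulrC.
    + by move=> x _; rewrite lee_fin expw_ge0.
    + by rewrite lee_fin.
  have c0E : (0 <= ((2 * pi) ^+ N)%:E :> \bar R)%E by rewrite lee_fin ltW.
  rewrite (ge0_integralZl leb measurableT mkw _ c0E)//.
  by move=> x _; rewrite lee_fin.
have E2 : (\int[leb]_y \int[leb]_x G (x, y) =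
    ((2 / d) ^+ N * I)%:E + \int[leb]_y (Q y)%:E)%E.
  transitivity (\int[leb]_y (((2 / d) ^+ N * psi y)%:E + (Q y)%:E))%E.
    apply: eq_integral => y _.
    transitivity (\int[leb]_x ((psi y)%:E * (expw d x * (1 + cos (0 + dotp y x)))%:E))%E.
      apply: eq_integral => x _; rewrite /G /F /= -!EFinM; congr EFin.
      have -> : dotp x y = dotp y x by apply: eq_bigr => i _; rewrite mulrC.
      by rewrite add0r; ring.
    have my : measurable_fun setT (fun x => (expw d x * (1 + cos (0 + dotp y x)))%:E).
      apply/measurable_EFinP; apply: measurable_funM; first exact: measurable_expw.
      by apply: measurable_funD => //; exact: measurable_cos_dotp.
    have wy0 : (0 <= (psi y)%:E)%E by rewrite lee_fin ltW// heat_symbol_gt0.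
    rewrite (ge0_integralZl leb measurableT my _ wy0); last first.
      by move=> x _; rewrite lee_fin mulr_ge0 ?expw_ge0 ?cosD1_ge0.
    rewrite integral_expw_cos// cos0 mul1r -EFinM -EFinD; congr EFin.
    by rewrite /Q; ring.
  have d2 : 0 <= (2 / d) ^+ N by rewrite exprn_ge0// divr_ge0// ltW.
  have mpsi : measurable_fun setT psi by exact: measurable_heat_symbol.
  have psi0 y : 0 <= psi y by rewrite ltW// heat_symbol_gt0.
  rewrite ge0_integralD//; last 4 first.
  - by move=> y _; rewrite lee_fin mulr_ge0.
  - by apply/measurable_EFinP; apply: measurable_funM.
  - by move=> y _; rewrite lee_fin.
  - by apply/measurable_EFinP.
  congr (_ + _)%E; under eq_integral do rewrite EFinM.
  have mpsiE : measurable_fun setT (fun y => (psi y)%:E) by exact/measurable_EFinP.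
  rewrite (ge0_integralZl leb measurableT mpsiE).
  - by rewrite IE EFinM.
  - by move=> y _; rewrite lee_fin.
  - by rewrite lee_fin.
have E3 : (((2 * pi) ^+ N)%:E * A = \int[leb]_y (Q y)%:E)%E.
  have := @fubini_tonelli _ _ _ _ _ leb leb G mG G0.
  rewrite E1 E2; set q := (\int[leb]_y (Q y)%:E)%E => e.
  have : (((2 / d) ^+ N * I)%:E + ((2 * pi) ^+ N)%:E * A - ((2 / d) ^+ N * I)%:E =
    ((2 / d) ^+ N * I)%:E + q - ((2 / d) ^+ N * I)%:E)%E by rewrite e.
  by rewrite ![(_%:E + _)%E]addeC !addeK.
have E4 : (\int[leb]_y (Q y)%:E = \int[leb]_y (psi (d *: y) * cauchyw y)%:E)%E.
  have dN : (0 < d ^+ N) by rewrite exprn_gt0.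
  have mQE : measurable_fun setT (fun y => (Q y)%:E) by exact/measurable_EFinP.
  have Q0E y : (0 <= (Q y)%:E)%E by rewrite lee_fin.
  have := congr1 (fun z => (d ^+ N)%:E * z)%E (ge0_integral_rV_affine 0 d0 mQE Q0E).
  rewrite muleA -EFinM divff ?gt_eqF// mul1e => <-.
  have mQd : measurable_fun setT (fun y : 'rV[R]_N => (Q (d *: y + 0))%:E).
    by apply/measurable_EFinP; exact: (measurableT_comp mQ (measurable_rV_affine d 0)).
  rewrite -(ge0_integralZl leb measurableT mQd); last 2 first.
  - by move=> y _; rewrite lee_fin.
  - by rewrite lee_fin ltW.
  apply: eq_integral => y _; rewrite addr0 -EFinM; congr EFin.
  rewrite /Q /cauchyw mulrCA; congr (_ * _).
  rewrite -[X in d ^+ X](card_ord N) -prodr_const -big_split/=.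
  apply: eq_bigr => i _; rewrite mxE exprMn -[X in X + _]mulr1 -mulrDr.
  have := lt0r_neq0 (sqrD1_gt0 (y ord0 i)); move: (1 + _) => w w0.
  by field; rewrite w0 gt_eqF.
rewrite -E4 -E3 muleA -EFinM mulVf ?gt_eqF// mul1e//.
Qed.

(** Let the damping tend to [0] in [integral_kernel_expw]: monotone convergence on
    the left, where [k >= 0]; dominated convergence by [cauchyw] on the right,
    where the symbol tends to its value [1] at the origin. *)
Lemma integral_frac_heat_kernel : (\int[leb]_x (k x)%:E = 1)%E.
Proof.
have k0 := frac_heat_kernel_ge0; have mk := measurable_frac_heat_kernel.
pose e n : R := n.+1%:R^-1.
have e0 n : 0 < e n by rewrite invr_gt0.
have psi0 y : 0 <= psi y by rewrite ltW// heat_symbol_gt0.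
have L : (\int[leb]_x (k x * expw (e n) x)%:E)%E @[n --> \oo] --> (\int[leb]_x (k x)%:E)%E.
  have := @cvg_monotone_convergence _ _ _ leb setT measurableT
    (fun n x => (k x * expw (e n) x)%:E).
  have -> : (fun x => limn (fun n => (k x * expw (e n) x)%:E)) = (fun x => (k x)%:E).
    apply/funext => x; apply/cvg_lim => //; apply/cvg_EFin; first by apply: nearW.
    rewrite -[X in _ --> X]mulr1.
    by apply: cvgM; [exact: cvg_cst|exact: cvg_harmonic_expw].
  apply.
  - move=> n; apply/measurable_EFinP; apply: measurable_funM => //.
    exact: measurable_expw.
  - by move=> n x _; rewrite lee_fin mulr_ge0 ?expw_ge0.
  - move=> x _ m n mn; rewrite lee_fin ler_wpM2l// !expwE ler_expR lerN2.
    apply: ler_wpM2r; first exact: sumr_ge0.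
    by rewrite /e lef_pV2 ?posrE ?ltr0n// ler_nat.
have M : (\int[leb]_y (psi (e n *: y) * cauchyw y)%:E)%E @[n --> \oo]
    --> (\int[leb]_y (cauchyw y)%:E)%E.
  have cvgI := @dominated_cvg _ _ _ leb setT measurableT
    (fun n y => (psi (e n *: y) * cauchyw y)%:E) (EFin \o cauchyw) (EFin \o cauchyw).
  apply: cvgI => //.
  - move=> n; apply/measurable_EFinP; apply: measurable_funM; last exact: measurable_cauchyw.
    have := measurableT_comp (measurable_heat_symbol mu t) (measurable_rV_affine (e n) (0 : 'rV[R]_N)).
    by apply: eq_measurable_fun => y _ /=; rewrite addr0.
  - move=> y _; apply/cvg_EFin; first by apply: nearW.
    rewrite /= -[X in _ --> X]mul1r; apply: cvgM; last exact: cvg_cst.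
    have ec : e n * (e n * dotp y y) @[n --> \oo] --> 0 * (0 * dotp y y).
      apply: cvgM; first exact: cvg_harmonic.
      by apply: cvgM; [exact: cvg_harmonic|exact: cvg_cst].
    have dE n : dotp (e n *: y) (e n *: y) = e n * (e n * dotp y y).
      by rewrite /dotp !mulr_sumr; apply: eq_bigr => i _; rewrite !mxE; ring.
    have dE0 n : 0 <= e n * (e n * dotp y y).
      by rewrite -dE; apply: sumr_ge0 => i _; rewrite -expr2 sqr_ge0.
    have tc : - (t * (e n * (e n * dotp y y)) `^ mu) @[n --> \oo] -->
        - (t * (0 * (0 * dotp y y)) `^ mu).
      by apply: cvgN; apply: cvgM; [exact: cvg_cst|exact: cvg_powR].
    have H := continuous_cvg _ (@continuous_expR R _) tc.
    have e1 : expR (- (t * (0 * (0 * dotp y y)) `^ mu)) = 1.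
      by rewrite mul0r powR0 ?gt_eqF// mulr0 oppr0 expR0.
    rewrite e1 in H.
    have -> : (fun n => psi (e n *: y)) =
        expR \o (fun n => - (t * (e n * (e n * dotp y y)) `^ mu)).
      by apply/funext => n /=; rewrite /heat_symbol enorm_powR dE.
    exact: H.
  - exact: integrable_cauchyw.
  - move=> n y _ /=; rewrite lee_fin normrM ger0_norm// ger0_norm ?(ltW (cauchyw_gt0 _))//.
    by apply: ler_piMl; rewrite ?(ltW (cauchyw_gt0 _))// heat_symbol_le1// ltW.
have M' : (((2 * pi) ^- N)%:E * \int[leb]_y (psi (e n *: y) * cauchyw y)%:E)%E
    @[n --> \oo] --> (((2 * pi) ^- N)%:E * \int[leb]_y (cauchyw y)%:E)%E.
  by apply: cvgeZl.
move: M'; rewrite integral_cauchyw -EFinM mulVf ?gt_eqF//.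
under eq_fun do rewrite -integral_kernel_expw//.
move=> M'; exact: (cvg_unique _ L M').
Qed.

End heat_kernel.

(** * Cubes and compact sets *)

Section euclidean_geometry.
Context {R : realType} {N : nat}.
Local Notation leb := (@lebesgue_rV R N).
Implicit Types x y : 'rV[R]_N.

Lemma measurable_box (A : 'I_N -> set R) : (forall i, measurable (A i)) ->
  measurable [set x : 'rV[R]_N | forall i, A i (x ord0 i)].
Proof.
move=> mA; rewrite (_ : [set _ | _] = \bigcap_(i in [set: 'I_N])
    ((fun x : 'rV[R]_N => x ord0 i) @^-1` A i)).
  apply: fin_bigcap_measurable => // i _.
  by rewrite -[X in measurable X]setTI; exact: measurable_coord.
by apply/seteqP; split => [x Ax i _|x Ax i]; exact: Ax.
Qed.

(** The Borel structure and the measure are defined by coordinates, so cubes are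
    the sets whose measure is directly known. *)
Definition cube x (r : R) : set 'rV[R]_N :=
  [set y | forall i, `[x ord0 i - r, x ord0 i + r]%classic (y ord0 i)].

Lemma measurable_cube x r : measurable (cube x r).
Proof. exact: (measurable_box (A := fun i => `[x ord0 i - r, x ord0 i + r]%classic)). Qed.

Lemma lebesgue_cube x r : 0 <= r -> leb (cube x r) = ((2 * r) ^+ N)%:E.
Proof.
move=> r0.
rewrite (@lebesgue_rV_box _ _ (fun i => `[x ord0 i - r, x ord0 i + r]%classic))//.
rewrite (eq_bigr (fun=> (2 * r)%:E)).
  by rewrite prodEFin prodr_const card_ord.
move=> i _; rewrite lebesgue_measure_itv/= lte_fin.
case: ltP => [_|]; first by rewrite -EFinB; congr EFin; ring.
by move=> h; congr EFin; lra.
Qed.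

Lemma measurable_ball_rV x e : 0 < e -> measurable (ball x e).
Proof.
move=> e0.
rewrite (_ : ball x e = [set y : 'rV[R]_N | forall i, ball (x ord0 i) e (y ord0 i)]).
  by apply: (measurable_box (A := fun i => ball (x ord0 i) e)) => i; exact: measurable_ball.
apply/seteqP; split => y; first by move=> [_ yx] i; exact: yx.
by move=> yx; split => // i j; rewrite (ord1 i); exact: yx.
Qed.

(** A compact set is the intersection over [n] of finite unions of balls of radius
    [1 / (n + 1)], and the balls of the sup norm are boxes. *)
Lemma measurable_compact_rV (K : set 'rV[R]_N) : compact K -> measurable K.
Proof.
move=> cK.
have clK : closed K by apply: compact_closed => //; exact: norm_hausdorff.
have ec n : 0 < n.+1%:R^-1 :> R by rewrite invr_gt0.
have H n : finite_subset_cover K (fun x => ball x n.+1%:R^-1) K.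
  move: cK; rewrite compact_cover; apply; first by move=> x _; exact: ball_open.
  by move=> x Kx; exists x => //; exact: ballxx.
pose F n := s2val (cid2 (H n)).
have FP n : [set` F n] `<=` K /\ K `<=` \bigcup_(x in [set` F n]) ball x n.+1%:R^-1.
  by rewrite /F; case: cid2 => D DK KD; split => // x /DK; exact: set_mem.
rewrite (_ : K = \bigcap_n \bigcup_(x in [set` F n]) ball x n.+1%:R^-1).
  apply: bigcap_measurable => // n _.
  by apply: fin_bigcup_measurable => // x _; exact: measurable_ball_rV (ec n).
apply/seteqP; split => [x Kx n _|x Fx]; first exact: (FP n).2.
apply: clK => B /nbhs_ballP[e /= e0 eB].
have [n ne] : exists n, n.+1%:R^-1 < e.
  by have [n] := ltr_add_invr e0; rewrite add0r => ?; exists n.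
have [y Fy yx] := Fx n I; exists y; split; first exact: (FP n).1.
by apply: eB; apply: ball_sym; apply: le_ball yx; exact: ltW.
Qed.

End euclidean_geometry.

(** * Morrey norms and averages against a probability density *)

Section affine_sets.
Context {R : realType} {N : nat}.
Local Notation leb := (@lebesgue_rV R N).

Lemma measurable_rV_add (b : 'rV[R]_N) :
  measurable_fun setT (fun x : 'rV[R]_N => x + b).
Proof.
have := measurable_rV_affine 1 b; apply: eq_measurable_fun => x _.
by rewrite scale1r.
Qed.

Lemma ge0_integral_affine_set (a : R) (b : 'rV[R]_N) (B : set 'rV[R]_N)
    (g : 'rV[R]_N -> \bar R) :
  0 < a -> measurable B -> measurable_fun setT g -> (forall x, 0 <= g x)%E ->
  (\int[leb]_(x in [set x | B (a *: x + b)%R]) g (a *: x + b)%R =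
   (a ^- N)%:E * \int[leb]_(x in B) g x)%E.
Proof.
move=> a0 mB mg g0; rewrite integral_mkcond [in RHS]integral_mkcond.
rewrite -(ge0_integral_rV_affine b a0).
- apply: eq_integral => x _; rewrite !patchE.
  by rewrite (_ : (x \in _) = (a *: x + b \in B))//; apply/idP/idP; rewrite !inE.
- exact/(measurable_restrictT _ mB)/measurable_funTS.
- by move=> x; rewrite patchE; case: ifP.
Qed.

Lemma measurable_eball (x0 : 'rV[R]_N) r : measurable (eball x0 r).
Proof.
rewrite (_ : eball x0 r = (fun y => enorm (y - x0)) @^-1` `]-oo, r[%classic).
  rewrite -[X in measurable X]setTI.
  by apply: (measurableT_comp measurable_enorm (measurable_rV_add (- x0))).
by apply/seteqP; split => y; rewrite /eball/= in_itv.
Qed.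

Lemma enormZ (a : R) (x : 'rV[R]_N) : 0 <= a -> enorm (a *: x) = a * enorm x.
Proof.
move=> a0; rewrite /enorm.
have -> : dotp (a *: x) (a *: x) = a ^+ 2 * dotp x x.
  by rewrite /dotp mulr_sumr; apply: eq_bigr => i _; rewrite !mxE; ring.
by rewrite sqrtrM ?sqr_ge0// sqrtr_sqr ger0_norm.
Qed.

Lemma coord_le_enorm (x : 'rV[R]_N) i : `|x ord0 i| <= enorm x.
Proof.
rewrite -sqrtr_sqr; apply: ler_wsqrtr.
rewrite /dotp (bigD1 i)//= -expr2 lerDl; apply: sumr_ge0 => j _.
by rewrite -expr2 sqr_ge0.
Qed.

Lemma eball_scale (a r : R) (x0 : 'rV[R]_N) : 0 < a ->
  [set x | eball (a *: x0) (a * r) (a *: x + 0)] = eball x0 r.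
Proof.
move=> a0; apply/seteqP; split => x; rewrite /eball/= addr0 -scalerBr.
  by rewrite enormZ ?(ltW a0)// ltr_pM2l.
by rewrite enormZ ?(ltW a0)// ltr_pM2l.
Qed.

Lemma eball_shift (r : R) (x0 y : 'rV[R]_N) :
  [set x | eball (x0 - y) r (1 *: x - y)] = eball x0 r.
Proof.
by apply/seteqP; split => x; rewrite /eball/= scale1r opprB addrA subrK.
Qed.

Lemma eball_sub_cube (x0 : 'rV[R]_N) r : eball x0 r `<=` cube x0 r.
Proof.
move=> y; rewrite /eball/= => yr i; rewrite /= in_itv/=.
have := le_lt_trans (coord_le_enorm (y - x0) i) yr; rewrite !mxE ltr_norml.
by move=> /andP[]; lra.
Qed.

End affine_sets.

Section morrey_norm.
Context {R : realType} {N : nat}.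
Local Notation leb := (@lebesgue_rV R N).
Variables (q l : R).
Hypothesis (q0 : 0 < q).
Implicit Types f : 'rV[R]_N -> R.

(** The [q]-th power of the quantity whose supremum is the Morrey norm; it is
    linear in [`|f| ^ q], hence suited to Tonelli. *)
Definition morrey_mean f (x0 : 'rV[R]_N) (r : R) : \bar R :=
  ((r `^ (l - N%:R))%:E * \int[leb]_(x in eball x0 r) (`|f x| `^ q)%:E)%E.

Lemma Lnorm_restrict f (B : set 'rV[R]_N) :
  ('N[leb]_(q%:E)[(EFin \o f) \_ B] =
   (\int[leb]_(x in B) (`|f x| `^ q)%:E) `^ q^-1)%E.
Proof.
rewrite unlock /Lnorm [in RHS]integral_mkcond; congr (_ `^ _)%E.
apply: eq_integral => x _; rewrite !patchE; case: ifP => _ //=.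
by rewrite normr0 powR0// gt_eqF.
Qed.

Lemma poweRK (X : \bar R) : (0 <= X)%E -> ((X `^ q^-1) `^ q = X)%E.
Proof. by move=> X0; rewrite -poweRrM mulVf ?gt_eqF// poweRe1. Qed.

Lemma le_poweR_root (X : \bar R) (A : R) : (0 <= X)%E -> 0 <= A ->
  (X `^ q^-1 <= A%:E)%E = (X <= (A `^ q)%:E)%E.
Proof.
move=> X0 A0; apply/idP/idP => h.
  rewrite -(poweRK X0) -poweR_EFin; apply: gt0_ler_poweR => //.
  - exact: ltW.
  - by rewrite in_itv/= poweR_ge0 leey.
  - by rewrite in_itv/= lee_fin A0 leey.
have -> : A%:E = (((A `^ q)%:E) `^ q^-1)%E.
  by rewrite poweR_EFin -powRrM divff ?gt_eqF// powRr1.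
apply: gt0_ler_poweR => //.
- by rewrite invr_ge0 ltW.
- by rewrite in_itv/= X0 leey.
- by rewrite in_itv/= lee_fin powR_ge0 leey.
Qed.

Lemma morrey_mean_ge0 f x0 r : (0 <= morrey_mean f x0 r)%E.
Proof.
rewrite mule_ge0 ?lee_fin ?powR_ge0//; apply: integral_ge0 => x _.
by rewrite lee_fin powR_ge0.
Qed.

Lemma morrey_mean_root f x0 r : 0 < r ->
  ((r `^ ((l - N%:R) / q))%:E * 'N[leb]_(q%:E)[(EFin \o f) \_ (eball x0 r)] =
   morrey_mean f x0 r `^ q^-1)%E.
Proof.
move=> r0; rewrite Lnorm_restrict /morrey_mean poweRM.
- by rewrite poweR_EFin -powRrM.
- by rewrite lee_fin powR_ge0.
- by apply: integral_ge0 => x _; rewrite lee_fin powR_ge0.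
Qed.

(** This equivalence replaces the supremum of roots by bounds on the means. *)
Lemma morrey_norm_leP f (A : R) : 0 <= A ->
  (morrey_norm (q%:E) l (EFin \o f) <= A%:E)%E <->
  (forall x0 r, 0 < r -> (morrey_mean f x0 r <= (A `^ q)%:E)%E).
Proof.
move=> A0; split => [h x0 r r0|h].
  rewrite -le_poweR_root ?morrey_mean_ge0//; apply: le_trans h.
  rewrite -morrey_mean_root//; apply: ereal_sup_ubound.
  by exists x0; exists r.
apply: ge_ereal_sup => _ [x0 [r r0 ->]].
by rewrite morrey_mean_root// le_poweR_root ?morrey_mean_ge0// h.
Qed.

Lemma morrey_norm_ge0 f : (0 <= morrey_norm (q%:E) l (EFin \o f))%E.
Proof.
apply: (@le_trans _ _ (((1 `^ ((l - N%:R) / q))%:E *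
  'N[leb]_(q%:E)[(EFin \o f) \_ (eball 0 1)])%E)).
  by rewrite mule_ge0 ?lee_fin ?powR_ge0// Lnorm_ge0.
by apply: ereal_sup_ubound; exists 0; exists 1.
Qed.

End morrey_norm.

Section averaging.
Context {R : realType} {N : nat}.
Local Notation leb := (@lebesgue_rV R N).
Variable k : 'rV[R]_N -> R.
Hypotheses (mk : measurable_fun setT k) (k0 : forall x, 0 <= k x)
  (k1 : (\int[leb]_x (k x)%:E = 1)%E).

(** Convolution with the density [k], in the form of the semigroup. *)
Definition average (u : 'rV[R]_N -> R) (x : 'rV[R]_N) : \bar R :=
  (\int[leb]_y (k (x - y) * u y)%:E)%E.

Lemma measurable_rV_subr (x : 'rV[R]_N) : measurable_fun setT (fun y : 'rV[R]_N => x - y).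
Proof.
have := measurableT_comp (measurable_rV_add x) (@measurable_rV_opp R N).
by apply: eq_measurable_fun => y _ /=; rewrite addrC.
Qed.

Lemma averageE (u : 'rV[R]_N -> R) x : measurable_fun setT u -> (forall y, 0 <= u y) ->
  average u x = (\int[leb]_y (k y * u (x - y))%:E)%E.
Proof.
move=> mu u0; rewrite -(ge0_integral_rV_subr x).
- by apply: eq_integral => y _; rewrite subKr.
- apply/measurable_EFinP; apply: measurable_funM => //.
  exact: (measurableT_comp mu (measurable_rV_subr x)).
- by move=> y; rewrite lee_fin mulr_ge0.
Qed.

Lemma average_cst c x : average (fun=> c) x = c%:E.
Proof.
rewrite /average; under eq_integral do rewrite mulrC EFinM.
have kx1 : (\int[leb]_y (k (x - y))%:E = 1)%E.
  have mkE : measurable_fun setT (fun y => (k y)%:E) by exact/measurable_EFinP.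
  have kE0 y : (0 <= (k y)%:E)%E by rewrite lee_fin.
  by rewrite (ge0_integral_rV_subr x mkE kE0).
rewrite integralZl//; first by rewrite kx1 mule1.
apply/integrableP; split.
  by apply/measurable_EFinP; exact: (measurableT_comp mk (measurable_rV_subr x)).
under eq_integral do rewrite /= ger0_norm//.
by rewrite kx1 ltry.
Qed.

Section bounded.
Variable u : 'rV[R]_N -> R.
Hypotheses (mu : measurable_fun setT u) (u01 : forall x, 0 <= u x <= 1).

Let u0 x : 0 <= u x. Proof. by have /andP[] := u01 x. Qed.
Let mux (x : 'rV[R]_N) : measurable_fun setT (fun y : 'rV[R]_N => u (x - y)).
Proof. exact: (measurableT_comp mu (measurable_rV_subr x)). Qed.

(** The average of a function with values in [[0, 1]] is finite, so it can be
    handled as a real function. *)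
Definition raverage x := fine (average u x).

Lemma average01 x : (0 <= average u x <= 1)%E.
Proof.
apply/andP; split; first by apply: integral_ge0 => y _; rewrite lee_fin mulr_ge0.
rewrite averageE// -k1; apply: ge0_le_integral => //.
- by move=> y _; rewrite lee_fin mulr_ge0.
- by apply/measurable_EFinP; apply: measurable_funM.
- by apply/measurable_EFinP.
- by move=> y _; rewrite lee_fin ler_piMr//; have /andP[] := u01 (x - y).
Qed.

Lemma raverageE x : average u x = (raverage x)%:E.
Proof.
rewrite /raverage fineK// fin_numElt; have /andP[a b] := average01 x.
by rewrite (lt_le_trans _ a)//= (le_lt_trans b)// ltry.
Qed.

Lemma raverage01 x : 0 <= raverage x <= 1.
Proof. by rewrite -!lee_fin -raverageE; exact: average01. Qed.

Let mdiff : measurable_fun setT (fun z : 'rV[R]_N * 'rV[R]_N => z.1 - z.2).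
Proof.
apply: measurable_fun_rV => i; under eq_fun do rewrite !mxE.
apply: (@measurable_funB _ _ R).
- exact: (measurableT_comp (measurable_coord i) measurable_fst).
- exact: (measurableT_comp (measurable_coord i) measurable_snd).
Qed.

Lemma measurable_raverage : measurable_fun setT raverage.
Proof.
apply/measurable_EFinP.
pose F (z : 'rV[R]_N * 'rV[R]_N) := (k (z.1 - z.2) * u z.2)%:E.
have mF : measurable_fun setT F.
  apply/measurable_EFinP; apply: measurable_funM.
    exact: (measurableT_comp mk mdiff).
  exact: (measurableT_comp mu measurable_snd).
have F0 z : (0 <= F z)%E by rewrite lee_fin mulr_ge0.
have := @measurable_fun_fubini_tonelli_F _ _ _ _ _ leb F mF F0.
by apply: eq_measurable_fun => x _; rewrite -[RHS]raverageE.
Qed.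

(** The graph of the convex function [b |-> b ^ q] lies above its tangent at [a];
    this is Young's inequality for [a ^ (q - 1)] and [b]. *)
Lemma powR_tangent (q a b : R) : 1 <= q -> 0 <= a -> 0 <= b ->
  q * a `^ (q - 1) * b <= (q - 1) * a `^ q + b `^ q.
Proof.
rewrite le_eqVlt => /predU1P[<-|q1] a0 b0.
  by rewrite subrr mul0r add0r powRr0 mulr1 mul1r powRr1.
have qp : 0 < q by lra.
have q1p : 0 < q - 1 by lra.
have pq : (q / (q - 1))^-1 + q^-1 = 1 by field; rewrite !gt_eqF.
have := conjugate_powR (powR_ge0 a (q - 1)) b0 (divr_gt0 qp q1p) qp pq.
have -> : (a `^ (q - 1)) `^ (q / (q - 1)) = a `^ q.
  by rewrite -powRrM mulrC divfK// gt_eqF.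
rewrite -(ler_pM2l qp) mulrA => /le_trans; apply.
rewrite le_eqVlt; apply/orP; left; apply/eqP; field.
by rewrite !gt_eqF.
Qed.

(** Integrate the tangent inequality at the mean value against the density. *)
Lemma jensen_powR q x : 1 <= q ->
  ((raverage x `^ q)%:E <= \int[leb]_y (k y * u (x - y) `^ q)%:E)%E.
Proof.
move=> q1; have /andP[a0 a1] := raverage01 x; set a := raverage x in a0 a1 *.
have q0 : 0 <= q by lra.
have mup : measurable_fun setT (fun y : 'rV[R]_N => u (x - y) `^ q).
  exact: (measurableT_comp (measurable_powR q) (mux x)).
have mkE : measurable_fun setT (fun y => (k y)%:E) by exact/measurable_EFinP.
have mkuE : measurable_fun setT (fun y => (k y * u (x - y))%:E).
  by apply/measurable_EFinP; apply: measurable_funM.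
have mkupE : measurable_fun setT (fun y => (k y * u (x - y) `^ q)%:E).
  by apply/measurable_EFinP; apply: measurable_funM.
have c1 : (0 <= ((q - 1) * a `^ q)%:E)%E by rewrite lee_fin mulr_ge0 ?powR_ge0//; lra.
have c2 : (0 <= (q * a `^ (q - 1))%:E)%E by rewrite lee_fin mulr_ge0 ?powR_ge0//; lra.
have kE0 (y : 'rV[R]_N) : setT y -> (0 <= (k y)%:E)%E by move=> _; rewrite lee_fin.
have kuE0 (y : 'rV[R]_N) : setT y -> (0 <= (k y * u (x - y))%:E)%E by move=> _; rewrite lee_fin mulr_ge0.
have I1 : (\int[leb]_y ((q * a `^ (q - 1))%:E * (k y * u (x - y))%:E) = (q * a `^ q)%:E)%E.
  rewrite (ge0_integralZl leb measurableT mkuE kuE0 c2) -averageE// raverageE -/a -EFinM.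
  congr EFin; rewrite -mulrA mulrC [_ * a]mulrC mulr_powRB1//; first by rewrite mulrC.
  by lra.
have I2 : (\int[leb]_y (((q - 1) * a `^ q)%:E * (k y)%:E + (k y * u (x - y) `^ q)%:E) =
    ((q - 1) * a `^ q)%:E + \int[leb]_y (k y * u (x - y) `^ q)%:E)%E.
  rewrite ge0_integralD//.
  - by rewrite (ge0_integralZl leb measurableT mkE kE0 c1) k1 mule1.
  - by move=> y _; rewrite mule_ge0// lee_fin.
  - exact: measurable_funeM.
  - by move=> y _; rewrite lee_fin mulr_ge0 ?powR_ge0.
have le12 : ((q * a `^ q)%:E <=
    ((q - 1) * a `^ q)%:E + \int[leb]_y (k y * u (x - y) `^ q)%:E)%E.
  rewrite -I1 -I2; apply: ge0_le_integral => //.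
  - by move=> y _; rewrite mule_ge0// lee_fin mulr_ge0.
  - exact: measurable_funeM.
  - by apply: emeasurable_funD => //; exact: measurable_funeM.
  - move=> y _; rewrite -!EFinM -EFinD lee_fin mulrCA [_ * k y]mulrC -mulrDr.
    by apply: ler_wpM2l => //; exact: powR_tangent.
have -> : (a `^ q)%:E = ((q * a `^ q)%:E - ((q - 1) * a `^ q)%:E)%E.
  by rewrite -EFinB; congr EFin; ring.
by rewrite leeBlDl.
Qed.

(** By Jensen and Tonelli the mean of the average over a ball is at most an average
    of means of [u] over translates of the ball. *)
Lemma morrey_mean_average (q l : R) (A : \bar R) : 1 <= q ->
  (forall x0 r, 0 < r -> (morrey_mean q l u x0 r <= A)%E) ->
  forall x0 r, 0 < r -> (morrey_mean q l raverage x0 r <= A)%E.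
Proof.
move=> q1 hA x0 r r0.
pose g (z : 'rV[R]_N * 'rV[R]_N) := ((k z.2)%:E * (u (z.1 - z.2) `^ q)%:E)%E.
pose B := eball x0 r; have mB : measurable B by exact: measurable_eball.
have mug : measurable_fun setT (fun z : 'rV[R]_N * 'rV[R]_N => (u (z.1 - z.2) `^ q)%:E).
  apply/measurable_EFinP; apply: (measurableT_comp (measurable_powR q)).
  exact: (measurableT_comp mu mdiff).
have mkg : measurable_fun setT (fun z : 'rV[R]_N * 'rV[R]_N => (k z.2)%:E).
  by apply/measurable_EFinP; exact: (measurableT_comp mk measurable_snd).
have mg : measurable_fun setT g by exact: emeasurable_funM.
have g0 z : (0 <= g z)%E by rewrite mule_ge0// lee_fin ?powR_ge0.
pose h z := (g z * (\1_B z.1)%:E)%E.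
have mh : measurable_fun setT h.
  apply: emeasurable_funM => //; apply/measurable_EFinP.
  have mi : measurable_fun setT (\1_B : 'rV[R]_N -> R) by exact: measurable_indic.
  exact: (measurableT_comp mi measurable_fst).
have h0 z : (0 <= h z)%E by rewrite mule_ge0// lee_fin.
pose c := r `^ (l - N%:R); have c0 : 0 <= c by exact: powR_ge0.
have le1 : (\int[leb]_(x in B) (`|raverage x| `^ q)%:E <= \int[leb]_x \int[leb]_y h (x, y))%E.
  rewrite integral_mkcond; apply: ge0_le_integral => //.
  - by move=> x _; rewrite patchE; case: ifP => // _; rewrite lee_fin powR_ge0.
  - apply/(measurable_restrictT _ mB)/measurable_funTS; apply/measurable_EFinP.
    apply: (measurableT_comp (measurable_powR q)).
    exact: (measurableT_comp _ measurable_raverage).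
  - exact: (@measurable_fun_fubini_tonelli_F _ _ _ _ _ leb h mh h0).
  - move=> x _; rewrite patchE /h/=; case: ifPn => xB; last first.
      by apply: integral_ge0 => y _; exact: (h0 (x, y)).
    rewrite ger0_norm; last by have /andP[] := raverage01 x.
    apply: (le_trans (jensen_powR x q1)).
    by under [leRHS]eq_integral do rewrite indicE xB mule1 /g/= -EFinM.
rewrite /morrey_mean -/B -/c.
apply: (@le_trans _ _ (c%:E * \int[leb]_x \int[leb]_y h (x, y))%E).
  by apply: lee_wpmul2l; rewrite ?lee_fin.
rewrite (@fubini_tonelli _ _ _ _ _ leb leb h mh h0).
have mup : measurable_fun setT (fun x => (u x `^ q)%:E).
  by apply/measurable_EFinP; exact: (measurableT_comp (measurable_powR q) mu).
have inner y : (\int[leb]_x h (x, y) =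
    (k y)%:E * \int[leb]_(x in eball (x0 - y) r) (u x `^ q)%:E)%E.
  have up0 x : (0 <= (u x `^ q)%:E)%E by rewrite lee_fin powR_ge0.
  have := ge0_integral_affine_set (- y) ltr01 (measurable_eball (x0 - y) r) mup up0.
  rewrite eball_shift expr1n invr1 mul1e => <-.
  rewrite [in RHS]integral_mkcond.
  have mr : measurable_fun setT ((fun x => (u (1 *: x - y) `^ q)%:E) \_ (eball x0 r)).
    apply/(measurable_restrictT _ mB)/measurable_funTS.
    exact: (measurableT_comp mup (measurable_rV_affine 1 (- y))).
  rewrite -(ge0_integralZl leb measurableT mr).
  - apply: eq_integral => x _; rewrite /h /g/= patchE indicE scale1r -/B.
    by case: (x \in B); rewrite ?mule1// !mule0.
  - by move=> x _; rewrite patchE; case: ifP.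
  - by rewrite lee_fin.
under eq_integral do rewrite inner.
have mI : measurable_fun setT (fun y =>
    (k y)%:E * \int[leb]_(x in eball (x0 - y) r) (u x `^ q)%:E)%E.
  have := @measurable_fun_fubini_tonelli_G _ _ _ _ _ leb h mh h0.
  by apply: eq_measurable_fun => y _; exact: inner.
rewrite -(ge0_integralZl leb measurableT mI); last 2 first.
- move=> y _; rewrite mule_ge0 ?lee_fin//; apply: integral_ge0 => x _.
  by rewrite lee_fin powR_ge0.
- by rewrite lee_fin.
have A0 : (0 <= A)%E := le_trans (morrey_mean_ge0 q l u x0 r) (hA x0 r r0).
have mkE : measurable_fun setT (fun y => (k y)%:E) by exact/measurable_EFinP.
have kE0 (y : 'rV[R]_N) : setT y -> (0 <= (k y)%:E)%E by move=> _; rewrite lee_fin.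
have <- : (\int[leb]_y ((k y)%:E * A) = A)%E.
  by rewrite (ge0_integralZr leb measurableT mkE kE0 A0) k1 mul1e.
apply: ge0_le_integral => //.
- move=> y _; rewrite mule_ge0 ?lee_fin// mule_ge0 ?lee_fin//.
  by apply: integral_ge0 => x _; rewrite lee_fin powR_ge0.
- exact: measurable_funeM.
- by apply: emeasurable_funM.
- move=> y _; rewrite muleCA; apply: lee_wpmul2l; first by rewrite lee_fin.
  have := hA (x0 - y) r r0; rewrite /morrey_mean; apply: le_trans.
  apply: lee_wpmul2l; first by rewrite lee_fin.
  by under [leRHS]eq_integral do rewrite ger0_norm//.
Qed.

End bounded.

End averaging.

(** * Slowly varying functions belong to the dotted Morrey space *)

Section l1norm.
Context {R : realType} {N : nat}.
Local Notation leb := (@lebesgue_rV R N).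
Implicit Types x y : 'rV[R]_N.

(** Any norm would do for the profile; this one is a sum of coordinates, so it is
    plainly measurable, homogeneous and subadditive, and it is the one appearing
    in [expw]. *)
Definition l1norm x : R := \sum_(j < N) `|x ord0 j|.

Lemma l1norm_ge0 x : 0 <= l1norm x.
Proof. exact: sumr_ge0. Qed.

Lemma l1normN x : l1norm (- x) = l1norm x.
Proof. by apply: eq_bigr => i _; rewrite mxE normrN. Qed.

Lemma l1normD x y : l1norm (x + y) <= l1norm x + l1norm y.
Proof. by rewrite -big_split; apply: ler_sum => i _; rewrite mxE ler_normD. Qed.

Lemma l1normZ a x : 0 <= a -> l1norm (a *: x) = a * l1norm x.
Proof.
by move=> a0; rewrite /l1norm mulr_sumr; apply: eq_bigr => i _; rewrite mxE normrM ger0_norm.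
Qed.

Lemma coord_le_l1norm x i : `|x ord0 i| <= l1norm x.
Proof. by rewrite /l1norm (bigD1 i)//= lerDl; exact: sumr_ge0. Qed.

Lemma measurable_l1norm : measurable_fun setT l1norm.
Proof.
apply: measurable_sum => i; apply: measurableT_comp => //.
exact: measurable_coord.
Qed.

Lemma coord_le_norm x i : `|x ord0 i| <= `|x|.
Proof.
rewrite [leRHS]/Num.norm /= mx_normrE.
by apply/bigmax_geP; right => /=; exists (ord0, i).
Qed.

Lemma l1norm_cvg0 : l1norm y @[y --> (0 : 'rV[R]_N)] --> (0 : R).
Proof.
apply: (@squeeze_cvgr _ (nbhs (0 : 'rV[R]_N)) _ R (cst 0) (fun y : 'rV[R]_N => N%:R * `|y|)).
- apply: nearW => y; rewrite l1norm_ge0/=.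
  rewrite -[N in N%:R]card_ord mulr_natl -sumr_const.
  by apply: ler_sum => i _; exact: coord_le_norm.
- exact: cvg_cst.
- rewrite -[X in _ --> X](mulr0 N%:R); apply: cvgM; first exact: cvg_cst.
  have : `|y| @[y --> (0 : 'rV[R]_N)] --> `|0 : 'rV[R]_N| by exact: norm_continuous.
  by rewrite normr0.
Qed.

Lemma ge0_integral_le_cst (D : set 'rV[R]_N) (g : 'rV[R]_N -> R) (c : R) :
  measurable D -> measurable_fun setT g -> (forall x, 0 <= g x) ->
  (forall x, D x -> g x <= c) ->
  (\int[leb]_(x in D) (g x)%:E <= c%:E * leb D)%E.
Proof.
move=> mD mg g0 gc; rewrite -(integral_cst leb mD c%:E); have mgE : measurable_fun D (fun x => (g x)%:E).
  by apply/measurable_EFinP; exact: measurable_funTS.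
by apply: (ge0_le_integral leb mD) => // x _; rewrite lee_fin.
Qed.

Lemma cube0_sub_eball : cube 0 N.+1%:R^-1 `<=` eball (0 : 'rV[R]_N) 1.
Proof.
move=> x cx; rewrite /eball /= subr0 /enorm.
have N1 : 0 < N.+1%:R :> R by rewrite ltr0n.
have xi i : x ord0 i * x ord0 i <= N.+1%:R^-1.
  have := cx i; rewrite /= in_itv/= mxE !add0r => xi.
  have {}xi : `|x ord0 i| <= N.+1%:R^-1 by rewrite ler_norml.
  rewrite -expr2 -real_normK ?num_real// expr2.
  rewrite -[leRHS]mulr1; apply: ler_pM => //.
  by apply: (le_trans xi); rewrite invf_le1// ler1n.
rewrite -[ltRHS]sqrtr1 ltr_sqrt//; apply: (@le_lt_trans _ _ (N%:R / N.+1%:R)).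
  rewrite -[N in N%:R]card_ord mulr_natl -sumr_const.
  by apply: ler_sum => i _; exact: xi.
by rewrite ltr_pdivrMr// mul1r ltr_nat.
Qed.

End l1norm.

Section slowly_varying.
Context {R : realType} {N : nat}.
Local Notation leb := (@lebesgue_rV R N).
Variables (q l : R) (u : 'rV[R]_N -> R) (m : R -> R).
Hypotheses (q1 : 1 <= q) (mu : measurable_fun setT u) (u01 : forall x, 0 <= u x <= 1).
Hypothesis (um : forall x y, u (x - y) <= m (l1norm y) * u x).
Hypothesis (m1 : m s @[s --> (0 : R)] --> (1 : R)).
Hypothesis (ufin : (morrey_norm q%:E l (EFin \o u) < +oo)%E).

Let q0 : 0 < q. Proof. exact: lt_le_trans ltr01 q1. Qed.

Lemma Lp_loc_bounded : Lp_loc q%:E u.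
Proof.
move=> K cK; have mK := measurable_compact_rV cK.
have muK : measurable_fun setT (u \_ K).
  exact/(measurable_restrictT _ mK)/measurable_funTS.
rewrite inE/=; apply/andP; split; first exact: mem_set.
rewrite /finLfun; apply: mem_set => /=; rewrite /finite_norm.
have -> : EFin \o u \_ K = (EFin \o u) \_ K.
  by apply/funext => x; rewrite /= !patchE; case: ifP.
rewrite Lnorm_restrict//; apply: poweR_lty.
have [M [_ MK]] := compact_bounded cK.
have {}MK x : K x -> cube 0 (`|M| + 1) x.
  move=> Kx i; rewrite /= in_itv/= mxE !add0r -ler_norml.
  have := MK (`|M| + 1) _ x Kx; rewrite ltr_pwDr ?ler_norm// => /(_ isT).
  by apply: le_trans; exact: coord_le_norm.
have mup : measurable_fun setT (fun x => `|u x| `^ q).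
  apply: (measurableT_comp (measurable_powR q)).
  exact: measurableT_comp.
have M0 : 0 <= `|M| + 1 by rewrite addr_ge0.
apply: (@le_lt_trans _ _ (1%:E * leb K)%E).
  apply: ge0_integral_le_cst => //.
  - move=> x _; have /andP[ux0 ux1] := u01 x; rewrite ger0_norm//.
    apply: (@le_trans _ _ (1 `^ q)); last by rewrite powR1.
    by apply: ge0_ler_powR; rewrite ?nnegrE// ltW.
rewrite mul1e; apply: (@le_lt_trans _ _ (leb (cube 0 (`|M| + 1)))).
  apply: le_measure; [exact: mem_set|apply: mem_set; exact: measurable_cube|exact: MK].
by rewrite lebesgue_cube// ltry.
Qed.

(** The hypothesis on [u] used for [y] and for [- y] bounds the difference from
    both sides. *)
Lemma slowly_varying_diff x y : `|u (x - y) - u x| <= `|m (l1norm y) - 1| * u x.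
Proof.
have u0 z : 0 <= u z by have /andP[] := u01 z.
have mm : m (l1norm y) - 1 <= `|m (l1norm y) - 1| := ler_norm _.
have h1 := um x y.
have h2 : u x <= m (l1norm y) * u (x - y).
  by have := um (x - y) (- y); rewrite opprK subrK l1normN.
have [xy|xy] := leP (u x) (u (x - y)).
  rewrite ger0_norm ?subr_ge0//.
  by apply: (@le_trans _ _ ((m (l1norm y) - 1) * u x)); [lra|exact: ler_wpM2r].
rewrite ltr0_norm ?subr_lt0// opprB.
apply: (@le_trans _ _ ((m (l1norm y) - 1) * u (x - y))); first by lra.
apply: (@le_trans _ _ (`|m (l1norm y) - 1| * u (x - y))); first exact: ler_wpM2r.
by apply: ler_wpM2l => //; exact: ltW.
Qed.

(** The translates differ from [u] by at most a factor tending to [0], uniformly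
    in [x], so their Morrey norms are controlled by that of [u]. *)
Lemma dotted_morrey_slowly_varying : dotted_morrey q%:E l u.
Proof.
split; first by split; [exact: Lp_loc_bounded|].
have u0 z : 0 <= u z by have /andP[] := u01 z.
pose c := fine (morrey_norm q%:E l (EFin \o u)).
have cE : morrey_norm q%:E l (EFin \o u) = c%:E.
  by rewrite /c fineK// ge0_fin_numE// morrey_norm_ge0.
have c0 : 0 <= c by rewrite -lee_fin -cE morrey_norm_ge0.
have cP := (morrey_norm_leP l q0 u c0).1.
rewrite cE lexx in cP; move/(_ isT) : cP => cP.
have bound y : (0 <= morrey_norm q%:E l (fun x => (u (x - y) - u x)%:E) <=
    (`|m (l1norm y) - 1| * c)%:E)%E.
  rewrite (morrey_norm_ge0 q l (fun x => u (x - y) - u x))/=.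
  apply/(morrey_norm_leP l q0 (fun x => u (x - y) - u x)); first by rewrite mulr_ge0.
  move=> x0 r r0; rewrite powRM// EFinM.
  apply: (@le_trans _ _ ((`|m (l1norm y) - 1| `^ q)%:E * morrey_mean q l u x0 r)%E); last first.
    by apply: lee_wpmul2l; [rewrite lee_fin powR_ge0|exact: cP].
  rewrite /morrey_mean muleCA; apply: lee_wpmul2l; first by rewrite lee_fin powR_ge0.
  have mup : measurable_fun setT (fun x => (`|u x| `^ q)%:E).
    apply/measurable_EFinP; apply: (measurableT_comp (measurable_powR q)).
    exact: measurableT_comp.
  have mB := measurable_eball x0 r.
  rewrite -(ge0_integralZl leb mB (measurable_funTS mup)); last 2 first.
  - by move=> x _; rewrite lee_fin powR_ge0.
  - by rewrite lee_fin powR_ge0.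
  have md : measurable_fun (eball x0 r) (fun x => (`|u (x - y) - u x| `^ q)%:E).
    apply: measurable_funTS; apply/measurable_EFinP.
    apply: (measurableT_comp (measurable_powR q)); apply: measurableT_comp => //.
    apply: measurable_funB => //.
    exact: (measurableT_comp mu (measurable_rV_add (- y))).
  have mc := measurable_funTS (measurable_funeM (`|m (l1norm y) - 1| `^ q)%:E mup).
  apply: (ge0_le_integral leb mB _ md (mc _)).
  - by move=> x _; rewrite lee_fin powR_ge0.
  - move=> x _; rewrite -EFinM lee_fin -powRM// (ger0_norm (u0 x)).
    apply: ge0_ler_powR; rewrite ?nnegrE ?mulr_ge0//; first exact: ltW.
    exact: slowly_varying_diff.
apply: (@squeeze_cvge _ (nbhs (0 : 'rV[R]_N)) _ R (fun=> 0%E) _ (fun y => (`|m (l1norm y) - 1| * c)%:E)).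
- by apply: nearW => y; exact: bound.
- exact: cvg_cst.
apply/cvg_EFin; first by apply: nearW.
rewrite -[X in _ --> X](mul0r c); apply: cvgM; last exact: cvg_cst.
have mc : m (l1norm y) @[y --> (0 : 'rV[R]_N)] --> (1 : R).
  exact: (cvg_comp _ _ l1norm_cvg0 m1).
have : `|m (l1norm y) - 1| @[y --> (0 : 'rV[R]_N)] --> `|1 - 1 : R|.
  have nc : `|s - 1| @[s --> (1 : R)] --> `|1 - 1 : R|.
    by apply: cvg_norm; apply: cvgB; [exact: cvg_id|exact: cvg_cst].
  exact: (cvg_comp _ _ mc nc).
by rewrite subrr normr0.
Qed.

(** A lower bound on a single unit ball is enough. *)
Lemma morrey_norm_gt0 (d : R) : 0 < d -> (forall x, cube 0 1 x -> d <= u x) ->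
  (0 < morrey_norm q%:E l (EFin \o u))%E.
Proof.
move=> d0 du; rewrite lt_neqAle morrey_norm_ge0// andbT eq_sym; apply/negP => /eqP e0.
have := (morrey_norm_leP l q0 u (lexx 0)).1; rewrite e0 lexx => /(_ isT 0 1 ltr01).
rewrite powR0 ?gt_eqF// /morrey_mean powR1 mul1e; apply/negP; rewrite -ltNge.
have N1 : 0 < N.+1%:R^-1 :> R by rewrite invr_gt0.
have mup : measurable_fun setT (fun x => (`|u x| `^ q)%:E).
  apply/measurable_EFinP; apply: (measurableT_comp (measurable_powR q)).
  exact: measurableT_comp.
apply: (@lt_le_trans _ _ (\int[leb]_(x in cube 0 N.+1%:R^-1) (`|u x| `^ q)%:E)%E); last first.
  apply: ge0_subset_integral.
  - exact: measurable_cube.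
  - exact: measurable_eball.
  - exact: measurable_funTS.
  - by move=> x _; rewrite lee_fin powR_ge0.
  - exact: cube0_sub_eball.
apply: (@lt_le_trans _ _ ((d `^ q)%:E * leb (cube 0 N.+1%:R^-1))%E).
  rewrite lebesgue_cube ?(ltW N1)// -EFinM lte_fin.
  apply: mulr_gt0; first exact: powR_gt0.
  by apply: exprn_gt0; exact: mulr_gt0.
rewrite -(integral_cst leb (measurable_cube _ _)).
apply: (ge0_le_integral leb (measurable_cube _ _)).
- by move=> x _; rewrite lee_fin powR_ge0.
- exact: measurable_cst.
- exact: measurable_funTS.
- move=> x cx; rewrite lee_fin.
  have ux : d <= u x.
    apply: du => i; have := cx i; rewrite /= !in_itv/= mxE !add0r.
    have : N.+1%:R^-1 <= 1 :> R by rewrite invf_le1// ler1n.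
    move=> h; rewrite -!ler_norml => xi; exact: le_trans xi h.
  rewrite ger0_norm ?(le_trans (ltW d0))//.
  apply: ge0_ler_powR; rewrite ?nnegrE ?(ltW q0) ?(ltW d0)//.
  by rewrite (le_trans (ltW d0)).
Qed.

End slowly_varying.

(** * The power profile and its Morrey norm *)

Section kernel_mass.
Context {R : realType} {N : nat}.
Local Notation leb := (@lebesgue_rV R N).
Variable k : 'rV[R]_N -> R.
Hypotheses (mk : measurable_fun setT k) (k0 : forall x, 0 <= k x)
  (k1 : (\int[leb]_x (k x)%:E = 1)%E).

Definition l1ball (M : R) : set 'rV[R]_N := [set y | l1norm y <= M].

Lemma measurable_l1ball M : measurable (l1ball M).
Proof.
rewrite (_ : l1ball M = l1norm @^-1` `]-oo, M]%classic).
  rewrite -[X in measurable X]setTI; exact: (measurable_l1norm measurableT).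
by apply/seteqP; split => y; rewrite /l1ball/= in_itv.
Qed.

Lemma kernel_mass_l1ball (e : R) : 0 < e ->
  exists n : nat, ((1 - e)%:E <= \int[leb]_(y in l1ball n%:R) (k y)%:E)%E.
Proof.
move=> e0.
have mkE : measurable_fun setT (fun y => (k y)%:E) by exact/measurable_EFinP.
have c : (\int[leb]_(y in l1ball n%:R) (k y)%:E)%E @[n --> \oo] --> (1 : \bar R)%E.
  have U : \bigcup_n l1ball n%:R = setT.
    apply/seteqP; split => // y _; exists (Num.truncn (l1norm y)).+1 => //.
    by rewrite /l1ball/= ltW// truncnS_gt.
  rewrite -k1 -U; apply: ge0_nondecreasing_set_cvg_integral.
  - move=> n p np; apply/subsetPset => y; rewrite /l1ball/= => /le_trans; apply.
    by rewrite ler_nat.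
  - by move=> n; exact: measurable_l1ball.
  - by move=> n; exact: measurable_funTS.
  - by move=> n y _; rewrite lee_fin.
apply: contrapT => H.
have : (1 <= (1 - e)%:E)%E.
  apply: (cvge_to_le c); apply: nearW => n; apply: ltW; rewrite ltNge.
  by apply/negP => h; apply: H; exists n.
by rewrite lee_fin; lra.
Qed.

End kernel_mass.

Section split_integral.
Context {R : realType} {N : nat}.
Local Notation leb := (@lebesgue_rV R N).

Lemma ge0_integral_setID (A B : set 'rV[R]_N) (g : 'rV[R]_N -> R) :
  measurable A -> measurable B -> measurable_fun setT g -> (forall x, 0 <= g x) ->
  (\int[leb]_(x in A) (g x)%:E =
   \int[leb]_(x in A `&` B) (g x)%:E + \int[leb]_(x in A `\` B) (g x)%:E)%E.
Proof.
move=> mA mB mg g0; rewrite -{1}(setUIDK A B).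
apply: (ge0_integral_setU leb (measurableI _ _ mA mB) (measurableD mA mB)).
- by apply: measurable_funTS; exact/measurable_EFinP.
- by move=> x _; rewrite lee_fin.
- by apply/disj_set2P; apply/seteqP; split => // x [[_ Bx] [_ nBx]].
Qed.

End split_integral.

Section power_profile.
Context {R : realType} {N : nat}.
Local Notation leb := (@lebesgue_rV R N).
Variables (q l : R).
Hypotheses (q1 : 1 <= q) (l0 : 0 < l).

Let q0 : 0 < q. Proof. exact: lt_le_trans ltr01 q1. Qed.
Let a := l / q.
Let a0 : 0 < a. Proof. exact: divr_gt0. Qed.

(** Comparable to the homogeneous function [|x| ^ (- l / q)] at infinity, but
    smooth enough at the origin for its translates to be close to it. *)
Definition profile (x : 'rV[R]_N) : R := (1 + l1norm x) `^ (- (l / q)).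

Let n1 (x : 'rV[R]_N) : 0 < 1 + l1norm x.
Proof. by rewrite ltr_pwDl// l1norm_ge0. Qed.

Lemma profile_gt0 x : 0 < profile x. Proof. exact: powR_gt0. Qed.

Lemma le_profile (s t : R) : 0 < s -> s <= t -> t `^ (- a) <= s `^ (- a).
Proof.
move=> s0 st; have t0 := lt_le_trans s0 st.
rewrite !powRN lef_pV2 ?posrE ?powR_gt0//.
by apply: ge0_ler_powR; rewrite ?nnegrE ?(ltW s0) ?(ltW t0) ?(ltW a0).
Qed.

Lemma profile01 x : 0 <= profile x <= 1.
Proof.
rewrite (ltW (profile_gt0 x))/=.
apply: (@le_trans _ _ (1 `^ (- a))); last by rewrite powR1.
by apply: le_profile => //; rewrite lerDl l1norm_ge0.
Qed.

Lemma measurable_profile : measurable_fun setT profile.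
Proof.
apply: (measurableT_comp (measurable_powR _)).
by apply: measurable_funD => //; exact: measurable_l1norm.
Qed.

Lemma profile_powR x : profile x `^ q = (1 + l1norm x) `^ (- l).
Proof. by rewrite /profile -powRrM mulNr divfK// gt_eqF. Qed.

(** From [1 + |x| <= (1 + |x - y|) (1 + |y|)]. *)
Lemma profile_shift x y : profile (x - y) <= (1 + l1norm y) `^ a * profile x.
Proof.
have le : 1 + l1norm x <= (1 + l1norm (x - y)) * (1 + l1norm y).
  have := l1normD (x - y) y; rewrite subrK.
  have := mulr_ge0 (l1norm_ge0 (x - y)) (l1norm_ge0 y); lra.
rewrite /profile -/a !powRN ler_pdivlMr ?powR_gt0// mulrC ler_pdivrMr ?powR_gt0//.
rewrite mulrC -powRM ?(ltW (n1 _))//.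
by apply: ge0_ler_powR; rewrite ?nnegrE ?(ltW a0) ?(ltW (n1 _)) ?mulr_ge0 ?(ltW (n1 _)).
Qed.

Lemma profile_modulus_cvg : (1 + s) `^ a @[s --> (0 : R)] --> (1 : R).
Proof.
have c1 : {for 1, continuous (fun s : R => s `^ a)}.
  apply: differentiable_continuous; apply/derivable1_diffP.
  by apply: derivable_powR; rewrite in_itv/= andbT.
have s1 : 1 + s @[s --> (0 : R)] --> (1 : R).
  by rewrite -[X in _ --> X]addr0; apply: cvgD; [exact: cvg_cst|exact: cvg_id].
have := cvg_comp _ _ s1 c1.
by rewrite powR1.
Qed.

Hypothesis lN : l < N%:R.

Let Nl : 0 < N%:R - l. Proof. by rewrite subr_gt0. Qed.

Let g (x : 'rV[R]_N) := (1 + l1norm x) `^ (- l).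
Let g0 x : 0 <= g x. Proof. exact: powR_ge0. Qed.
Let mg : measurable_fun setT g.
Proof.
apply: (measurableT_comp (measurable_powR _)).
by apply: measurable_funD => //; exact: measurable_l1norm.
Qed.

Let g_far r x : 0 < r -> ~ cube 0 r x -> g x <= r `^ (- l).
Proof.
move=> r0 xr.
have rx : r <= 1 + l1norm x.
  rewrite leNgt; apply/negP => h; apply: xr => i.
  rewrite /= in_itv/= mxE !add0r -ler_norml.
  by apply: (le_trans (coord_le_l1norm x i)); rewrite (le_trans _ (ltW h))// lerDr.
rewrite /g !powRN lef_pV2 ?posrE ?powR_gt0//.
by apply: ge0_ler_powR; rewrite ?nnegrE ?(ltW r0) ?(ltW l0) ?(ltW (n1 _)).
Qed.

Let g_le1 x : g x <= 1.
Proof.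
rewrite /g powRN invf_le1 ?powR_gt0//.
apply: (@le_trans _ _ (1 `^ l)); first by rewrite powR1.
by apply: ge0_ler_powR; rewrite ?nnegrE ?(ltW l0) ?(ltW (n1 _))// lerDl l1norm_ge0.
Qed.

Let K : R := 2 ^+ N + 4 ^+ N / (2 `^ (N%:R - l) - 1).

Let K2 : 1 < 2 `^ (N%:R - l).
Proof.
have := gt0_ltr_powR Nl; move=> /(_ 1 2); rewrite powR1 !nnegrE; apply => //.
by rewrite ltr1n.
Qed.

Let powRNl (r : R) : 0 < r -> r `^ (- l) * r ^+ N = r `^ (N%:R - l).
Proof.
move=> r0; rewrite -powR_mulrn ?(ltW r0)// -powRD; first by rewrite addrC.
by rewrite (gt_eqF r0) implybT.
Qed.

(** Halving the cube: the part of the cube of radius [r] outside that of radius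
    [r / 2] contributes at most a constant times [r ^ (N - l)], and since
    [N - l > 0] these contributions form a geometric sum.  The constant [K] is the
    one for which the induction closes. *)
Lemma integral_cube0_le n r : 0 < r -> r <= 2 ^+ n ->
  (\int[leb]_(x in cube 0 r) (g x)%:E <= (K * r `^ (N%:R - l))%:E)%E.
Proof.
elim: n r => [|n IH] r r0 rn.
  have r1 : r <= 1 by rewrite expr0 in rn.
  apply: (le_trans (ge0_integral_le_cst (measurable_cube 0 r) mg g0 (fun x _ => g_le1 x))).
  rewrite mul1e lebesgue_cube ?(ltW r0)// lee_fin exprMn.
  apply: ler_pM; rewrite ?exprn_ge0 ?(ltW r0)//.
    by rewrite /K lerDl divr_ge0 ?exprn_ge0// subr_ge0 ltW.
  rewrite -powR_mulrn ?(ltW r0)//; apply: ger_powR; first by rewrite r0.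
  by rewrite gerBl ltW.
have h0 : 0 < r / 2 by rewrite divr_gt0.
have hn : r / 2 <= 2 ^+ n by rewrite ler_pdivrMr// mulrC -exprS.
have sub : cube 0 (r / 2) `<=` cube (0 : 'rV[R]_N) r.
  move=> x cx i; have := cx i; rewrite /= !in_itv/= mxE !add0r -!ler_norml.
  by move=> /le_trans; apply; rewrite ler_pdivrMr// ler_peMr ?(ltW r0)// ler1n.
have m1 := measurable_cube (0 : 'rV[R]_N) (r / 2).
have m2 := measurable_cube (0 : 'rV[R]_N) r.
rewrite (ge0_integral_setID m2 m1 mg g0) setIidr//.
have far : (\int[leb]_(x in cube 0 r `\` cube 0 (r / 2)) (g x)%:E <=
    ((r / 2) `^ (- l) * (2 * r) ^+ N)%:E)%E.
  apply: (le_trans (ge0_integral_le_cst (c := (r / 2) `^ (- l)) (measurableD m2 m1) mg g0 _)).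
    by move=> x [_ nx]; exact: g_far.
  rewrite [leRHS]EFinM; apply: lee_wpmul2l; first by rewrite lee_fin powR_ge0.
  rewrite -(lebesgue_cube (0 : 'rV[R]_N) (ltW r0)); apply: le_measure.
  - by apply: mem_set; exact: measurableD.
  - exact: mem_set.
  - by move=> x [].
apply: (le_trans (leeD (IH _ h0 hn) far)); rewrite -EFinD lee_fin.
have -> : (r / 2) `^ (- l) * (2 * r) ^+ N = 4 ^+ N * (r / 2) `^ (N%:R - l).
  have -> : 2 * r = 4 * (r / 2) by field.
  by rewrite exprMn mulrCA powRNl.
rewrite -mulrDl.
have -> : r `^ (N%:R - l) = 2 `^ (N%:R - l) * (r / 2) `^ (N%:R - l).
  by rewrite -powRM ?(ltW h0)//; congr (_ `^ _); field.
rewrite mulrA ler_wpM2r ?powR_ge0//.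
have K2' : 0 < 2 `^ (N%:R - l) - 1 by rewrite subr_gt0.
rewrite -lerBrDl -{2}[K]mulr1 -mulrBr /K mulrDl divfK ?gt_eqF//.
by rewrite lerDr mulr_ge0 ?exprn_ge0// ltW.
Qed.

(** Inside the cube of radius [r] at the origin, [integral_cube0_le] applies; away
    from it the integrand is at most [r ^ (- l)] and the volume of the ball is of
    order [r ^ N]. *)
Lemma profile_mean_bound x0 r : 0 < r ->
  (morrey_mean q l profile x0 r <= (K + 2 ^+ N)%:E)%E.
Proof.
move=> r0; rewrite /morrey_mean.
have -> : (\int[leb]_(x in eball x0 r) (`|profile x| `^ q)%:E =
    \int[leb]_(x in eball x0 r) (g x)%:E)%E.
  by apply: eq_integral => x _; rewrite ger0_norm ?(ltW (profile_gt0 _))// profile_powR.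
have mE := measurable_eball x0 r; have mC := measurable_cube (0 : 'rV[R]_N) r.
have mgE D : measurable_fun D (fun x => (g x)%:E).
  by apply: measurable_funTS; exact/measurable_EFinP.
have near0 : (\int[leb]_(x in eball x0 r `&` cube 0 r) (g x)%:E <=
    (K * r `^ (N%:R - l))%:E)%E.
  have [n rn] : exists n : nat, r <= 2 ^+ n.
    exists (Num.truncn r).+1; apply: (le_trans (ltW (truncnS_gt r))).
    by rewrite -natrX ler_nat ltnW// ltn_expl.
  apply: (le_trans _ (integral_cube0_le r0 rn)).
  apply: ge0_subset_integral => //; first exact: measurableI.
  by move=> x _; rewrite lee_fin.
have far : (\int[leb]_(x in eball x0 r `\` cube 0 r) (g x)%:E <=
    (r `^ (- l) * (2 * r) ^+ N)%:E)%E.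
  apply: (le_trans (ge0_integral_le_cst (c := r `^ (- l)) (measurableD mE mC) mg g0 _)).
    by move=> x [_ nx]; exact: g_far.
  rewrite [leRHS]EFinM; apply: lee_wpmul2l; first by rewrite lee_fin powR_ge0.
  rewrite -(lebesgue_cube x0 (ltW r0)); apply: le_measure.
  - by apply: mem_set; exact: measurableD.
  - by apply: mem_set; exact: measurable_cube.
  - by move=> x [+ _]; exact: eball_sub_cube.
rewrite (ge0_integral_setID mE mC mg g0).
apply: (@le_trans _ _ ((r `^ (l - N%:R))%:E * (K * r `^ (N%:R - l) + r `^ (- l) * (2 * r) ^+ N)%:E)%E).
  apply: lee_wpmul2l; first by rewrite lee_fin powR_ge0.
  by rewrite EFinD; exact: leeD.
rewrite -EFinM lee_fin exprMn mulrCA powRNl// -mulrDl mulrCA.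
have -> : r `^ (l - N%:R) = (r `^ (N%:R - l))^-1 by rewrite -powRN opprB.
by rewrite mulVf ?mulr1// gt_eqF// powR_gt0.
Qed.

Lemma morrey_norm_profile_lty : (morrey_norm q%:E l (EFin \o profile) < +oo)%E.
Proof.
have A0 : 0 <= K + 2 ^+ N.
  have K20 : 0 <= 2 `^ (N%:R - l) - 1 by rewrite subr_ge0 ltW.
  by rewrite /K !addr_ge0 ?exprn_ge0// divr_ge0 ?exprn_ge0.
apply: (@le_lt_trans _ _ ((K + 2 ^+ N) `^ q^-1)%:E); last exact: ltry.
apply/(morrey_norm_leP l q0 profile); first exact: powR_ge0.
move=> x0 r r0; rewrite -powRrM mulVf ?gt_eqF// powRr1//.
exact: profile_mean_bound.
Qed.

End power_profile.

(** * Averaging preserves the Morrey norm of the profile *)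

Section profile_average.
Context {R : realType} {N : nat}.
Local Notation leb := (@lebesgue_rV R N).
Variable k : 'rV[R]_N -> R.
Hypotheses (mk : measurable_fun setT k) (k0 : forall x, 0 <= k x)
  (k1 : (\int[leb]_x (k x)%:E = 1)%E).

Lemma average_raverage (u : 'rV[R]_N -> R) : measurable_fun setT u ->
  (forall x, 0 <= u x <= 1) -> average k u = EFin \o raverage k u.
Proof. by move=> mu u01; apply/funext => x; rewrite /= -raverageE. Qed.

Lemma morrey_norm_average_le (q l : R) (u : 'rV[R]_N -> R) : 1 <= q ->
  measurable_fun setT u -> (forall x, 0 <= u x <= 1) ->
  (morrey_norm q%:E l (EFin \o u) < +oo)%E ->
  (morrey_norm q%:E l (average k u) <= morrey_norm q%:E l (EFin \o u))%E.
Proof.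
move=> q1 mu u01 ufin; have q0 := lt_le_trans ltr01 q1.
have u0 := morrey_norm_ge0 q l u.
have fin : morrey_norm q%:E l (EFin \o u) \is a fin_num by rewrite ge0_fin_numE.
have c0 : 0 <= fine (morrey_norm q%:E l (EFin \o u)) by exact: fine_ge0.
rewrite -[leRHS](fineK fin) average_raverage//.
apply/(morrey_norm_leP l q0 _ c0); apply: morrey_mean_average => //.
by apply/(morrey_norm_leP l q0 u c0); rewrite fineK.
Qed.

Section power.
Variables (q l : R).
Hypotheses (q1 : 1 <= q) (l0 : 0 < l).
Local Notation u := (@profile R N q l).

Let q0 : 0 < q. Proof. exact: lt_le_trans ltr01 q1. Qed.

(** Keep only the part of the average over the l1 ball of radius [n], where the
    translates of the profile are at least [(1 + n + |x|) ^ (- l / q)]. *)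
Lemma raverage_profile_ge (e : R) : 0 < e -> e < 1 -> exists n : nat, forall x,
  (1 - e) * (1 + n%:R + l1norm x) `^ (- (l / q)) <= raverage k u x.
Proof.
move=> e0 e1; have [n hn] := kernel_mass_l1ball mk k0 k1 e0; exists n => x.
have mu := @measurable_profile R N q l.
have u01 := @profile01 R N q l q1 l0.
have u0 y : 0 <= u y by have /andP[] := u01 y.
set c := _ `^ _.
have c0 : 0 <= c by exact: powR_ge0.
rewrite -lee_fin -raverageE// averageE//.
have mB := @measurable_l1ball R N n%:R.
have mkE : measurable_fun setT (fun y => (k y)%:E) by exact/measurable_EFinP.
have mku : measurable_fun setT (fun y : 'rV[R]_N => (k y * u (x - y))%:E).
  apply/measurable_EFinP; apply: measurable_funM => //.
  exact: (measurableT_comp mu (measurable_rV_subr x)).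
apply: (@le_trans _ _ (\int[leb]_(y in l1ball n%:R) (c%:E * (k y)%:E))%E).
  rewrite (ge0_integralZl leb mB (measurable_funTS mkE)) ?lee_fin//.
    by rewrite mulrC EFinM; apply: lee_wpmul2l; rewrite ?lee_fin.
  by move=> y _; rewrite lee_fin.
apply: (@le_trans _ _ (\int[leb]_(y in l1ball n%:R) (k y * u (x - y))%:E)%E).
  apply: (ge0_le_integral leb mB).
  - by move=> y _; rewrite -EFinM lee_fin mulr_ge0.
  - by apply: measurable_funTS; exact: measurable_funeM.
  - exact: measurable_funTS.
  - move=> y yn; rewrite -EFinM lee_fin mulrC; apply: ler_wpM2l => //.
    apply: le_profile => //; first by rewrite ltr_pwDl// l1norm_ge0.
    rewrite -addrA lerD2l; apply: (le_trans (l1normD _ _)).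
    by rewrite l1normN [leLHS]addrC lerD2r.
apply: ge0_subset_integral => //.
by move=> y _; rewrite lee_fin mulr_ge0.
Qed.

(** With [lam = 1 + n] one has [1 + n + |lam x| = lam (1 + |x|)], so the bound of
    [raverage_profile_ge] at [lam x] is a multiple of the profile at [x].  The
    powers of [lam] cancel because the Morrey mean is scale invariant. *)
Lemma morrey_mean_raverage_profile_ge (e : R) : 0 < e -> e < 1 ->
  exists2 lam : R, 0 < lam & forall x0 r, 0 < r ->
    (((1 - e) `^ q)%:E * morrey_mean q l u x0 r <=
     morrey_mean q l (raverage k u) (lam *: x0) (lam * r))%E.
Proof.
move=> e0 e1; have [n hn] := raverage_profile_ge e0 e1.
pose lam : R := 1 + n%:R; have lam0 : 0 < lam by rewrite ltr_pwDl.
exists lam => // x0 r r0.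
have e1' : 0 <= 1 - e by rewrite subr_ge0 ltW.
have mu := @measurable_profile R N q l.
have u01 := @profile01 R N q l q1 l0.
have u0 y : 0 <= u y by have /andP[] := u01 y.
have s01 := raverage01 mk k0 k1 mu u01.
have s0 y : 0 <= raverage k u y by have /andP[] := s01 y.
have ms := measurable_raverage mk k0 k1 mu u01.
have msq : measurable_fun setT (fun x => (`|raverage k u x| `^ q)%:E).
  apply/measurable_EFinP; apply: (measurableT_comp (measurable_powR q)).
  exact: measurableT_comp.
have muq : measurable_fun setT (fun x => (`|u x| `^ q)%:E).
  apply/measurable_EFinP; apply: (measurableT_comp (measurable_powR q)).
  exact: measurableT_comp.
have mB := measurable_eball x0 r.
have sq0 x : (0 <= (`|raverage k u x| `^ q)%:E)%E by rewrite lee_fin powR_ge0.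
have uq0 x : (0 <= (`|u x| `^ q)%:E)%E by rewrite lee_fin powR_ge0.
have := ge0_integral_affine_set 0 lam0 (measurable_eball (lam *: x0) (lam * r)) msq sq0.
rewrite eball_scale// => /(congr1 (fun z => (lam ^+ N)%:E * z)%E).
rewrite muleA -EFinM divff ?gt_eqF ?exprn_gt0// mul1e => cov.
rewrite /morrey_mean -cov.
have pt x : (1 - e) `^ q * lam `^ (- l) * `|u x| `^ q <=
    `|raverage k u (lam *: x + 0)| `^ q.
  rewrite addr0 (ger0_norm (u0 x)) (ger0_norm (s0 _)).
  have -> : (1 - e) `^ q * lam `^ (- l) * u x `^ q =
      ((1 - e) * (1 + n%:R + l1norm (lam *: x)) `^ (- (l / q))) `^ q.
    rewrite l1normZ ?(ltW lam0)// -/lam.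
    rewrite (_ : lam + lam * l1norm x = lam * (1 + l1norm x)); last by ring.
    have x1 : 0 <= 1 + l1norm x by rewrite addr_ge0// l1norm_ge0.
    rewrite powRM ?(ltW lam0)// powRM ?mulr_ge0 ?powR_ge0//.
    rewrite powRM ?powR_ge0// -powRrM mulNr divfK ?gt_eqF// mulrA.
    by rewrite /profile.
  apply: ge0_ler_powR; rewrite ?nnegrE ?(ltW q0)//.
  by rewrite mulr_ge0 ?powR_ge0.
have md : measurable_fun setT (fun x : 'rV[R]_N => (`|raverage k u (lam *: x + 0)| `^ q)%:E).
  exact: (measurableT_comp msq (measurable_rV_affine lam 0)).
pose C := (1 - e) `^ q * lam `^ (- l).
have C0 : (0 <= C%:E)%E by rewrite lee_fin mulr_ge0 ?powR_ge0.
have leI : (C%:E * \int[leb]_(x in eball x0 r) (`|u x| `^ q)%:E <=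
    \int[leb]_(x in eball x0 r) (`|raverage k u (lam *: x + 0)| `^ q)%:E)%E.
  rewrite -(ge0_integralZl leb mB (measurable_funTS muq) (fun x _ => uq0 x) C0).
  apply: (ge0_le_integral leb mB).
  - by move=> x _; rewrite mule_ge0.
  - by apply: measurable_funTS; exact: measurable_funeM.
  - exact: measurable_funTS.
  - by move=> x _; rewrite -EFinM lee_fin; exact: pt.
apply: (@le_trans _ _ (((lam * r) `^ (l - N%:R))%:E * ((lam ^+ N)%:E *
   (C%:E * \int[leb]_(x in eball x0 r) (`|u x| `^ q)%:E)))%E); last first.
  apply: lee_wpmul2l; first by rewrite lee_fin powR_ge0.
  by apply: lee_wpmul2l; first by rewrite lee_fin exprn_ge0// ltW.
rewrite !muleA -!EFinM le_eqVlt; apply/orP; left; apply/eqP; congr (_%:E * _)%E.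
rewrite powRM ?(ltW lam0) ?(ltW r0)// /C.
have lamE : lam `^ (l - N%:R) * lam ^+ N * lam `^ (- l) = 1.
  rewrite -powR_mulrn ?(ltW lam0)// -!powRD ?(gt_eqF lam0) ?implybT//.
  by rewrite subrK subrr powRr0.
transitivity ((1 - e) `^ q * r `^ (l - N%:R) *
  (lam `^ (l - N%:R) * lam ^+ N * lam `^ (- l))); last by ring.
by rewrite lamE mulr1.
Qed.

(** The upper bound is the contraction property; the lower bound holds up to the
    factor [1 - e] for every [e]. *)
Lemma morrey_norm_average_profile : l < N%:R ->
  morrey_norm q%:E l (average k u) = morrey_norm q%:E l (EFin \o u).
Proof.
move=> lN.
have mu := @measurable_profile R N q l.
have u01 := @profile01 R N q l q1 l0.
have ufin := morrey_norm_profile_lty q1 l0 lN.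
have su := morrey_norm_average_le q1 mu u01 ufin.
apply/eqP; rewrite eq_le su andTb; have sfin := le_lt_trans su ufin.
rewrite (average_raverage mu u01) in sfin *.
have sfn : morrey_norm q%:E l (EFin \o raverage k u) \is a fin_num.
  by rewrite ge0_fin_numE// morrey_norm_ge0.
pose c := fine (morrey_norm q%:E l (EFin \o raverage k u)).
have c0 : 0 <= c by rewrite fine_ge0// morrey_norm_ge0.
have cP := (morrey_norm_leP l q0 (raverage k u) c0).1.
rewrite /c fineK// lexx in cP; move/(_ isT) : cP; rewrite -/c => cP.
have le e : 0 < e -> e < 1 -> (morrey_norm q%:E l (EFin \o u) <= (c / (1 - e))%:E)%E.
  move=> e0 e1; have e1' : 0 < 1 - e by rewrite subr_gt0.
  have [lam lam0 lamP] := morrey_mean_raverage_profile_ge e0 e1.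
  apply/(morrey_norm_leP l q0 u); first by rewrite divr_ge0// ltW.
  move=> x0 r r0.
  have := le_trans (lamP x0 r r0) (cP (lam *: x0) (lam * r) (mulr_gt0 lam0 r0)).
  rewrite -lee_pdivlMl ?powR_gt0// -EFinM => /le_trans; apply.
  rewrite lee_fin powRM ?invr_ge0 ?(ltW e1')//.
  have -> : ((1 - e)^-1) `^ q = ((1 - e) `^ q)^-1.
    by rewrite -(powR_inv1 (ltW e1')) -powRrM mulN1r powRN.
  by rewrite mulrC.
have ufn : morrey_norm q%:E l (EFin \o u) \is a fin_num.
  by rewrite ge0_fin_numE// morrey_norm_ge0.
rewrite -(fineK sfn) -/c -(fineK ufn) lee_fin leNgt; apply/negP => cd.
set d := fine _ in cd; have {}le e : 0 < e -> e < 1 -> d <= c / (1 - e).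
  by move=> e0 e1; rewrite -lee_fin fineK//; exact: le.
have d0 : 0 < d by exact: le_lt_trans cd.
have e0 : 0 < (d - c) / (2 * d) by rewrite divr_gt0 ?subr_gt0// mulr_gt0.
have e1 : (d - c) / (2 * d) < 1.
  by rewrite ltr_pdivrMr ?mulr_gt0// mul1r; lra.
have := le _ e0 e1; rewrite ler_pdivlMr ?subr_gt0//.
have -> : d * (1 - (d - c) / (2 * d)) = (d + c) / 2 by field; rewrite gt_eqF.
lra.
Qed.

End power.

End profile_average.

(** * The integrable case and the theorem *)

Section integrable_case.
Context {R : realType} {N : nat}.
Local Notation leb := (@lebesgue_rV R N).
Local Notation u := (@expw R N 1).

Lemma expw1E x : u x = expR (- l1norm x).
Proof. by rewrite expwE mul1r. Qed.

Lemma expw01 x : 0 <= u x <= 1.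
Proof. by rewrite expw_ge0 expw_le1. Qed.

Lemma expw_shift x y : u (x - y) <= expR (l1norm y) * u x.
Proof.
rewrite !expw1E -expRD ler_expR; have := l1normD (x - y) y.
by rewrite subrK; lra.
Qed.

Lemma morrey_mean1 (f : 'rV[R]_N -> R) x0 r : (forall x, 0 <= f x) ->
  (morrey_mean 1 N%:R f x0 r = \int[leb]_(x in eball x0 r) (f x)%:E)%E.
Proof.
move=> f0; rewrite /morrey_mean subrr powRr0 mul1e; apply: eq_integral => x _.
by rewrite powRr1// ger0_norm.
Qed.

Lemma integral_expw1 : (\int[leb]_x (u x)%:E = (2 ^+ N)%:E)%E.
Proof. by rewrite integral_expw// divr1. Qed.

Lemma expw_mean_bound x0 r : (morrey_mean 1 N%:R u x0 r <= (2 ^+ N)%:E)%E.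
Proof.
rewrite morrey_mean1; last by move=> x; exact: expw_ge0.
rewrite -integral_expw1; apply: ge0_subset_integral => //.
- exact: measurable_eball.
- by apply/measurable_EFinP; exact: measurable_expw.
- by move=> x _; rewrite lee_fin expw_ge0.
Qed.

Lemma morrey_norm_expw_lty : (morrey_norm 1%:E N%:R (EFin \o u) < +oo)%E.
Proof.
have A0 : 0 <= 2 ^+ N :> R by rewrite exprn_ge0.
apply: (@le_lt_trans _ _ (2 ^+ N)%:E); last exact: ltry.
apply/(morrey_norm_leP N%:R ltr01 u A0) => x0 r r0.
by rewrite powRr1//; exact: expw_mean_bound.
Qed.

Variable k : 'rV[R]_N -> R.
Hypotheses (mk : measurable_fun setT k) (k0 : forall x, 0 <= k x)
  (k1 : (\int[leb]_x (k x)%:E = 1)%E).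

(** Tonelli and translation invariance: averaging preserves total mass. *)
Lemma integral_average (f : 'rV[R]_N -> R) : measurable_fun setT f ->
  (forall x, 0 <= f x) ->
  (\int[leb]_x average k f x = \int[leb]_x (f x)%:E)%E.
Proof.
move=> mf f0.
pose F (z : 'rV[R]_N * 'rV[R]_N) := ((k (z.1 - z.2))%:E * (f z.2)%:E)%E.
have mF : measurable_fun setT F.
  apply: emeasurable_funM; apply/measurable_EFinP.
    apply: (measurableT_comp mk).
    apply: measurable_fun_rV => i; under eq_fun do rewrite !mxE.
    apply: (@measurable_funB _ _ R).
    - exact: (measurableT_comp (measurable_coord i) measurable_fst).
    - exact: (measurableT_comp (measurable_coord i) measurable_snd).
  exact: (measurableT_comp mf measurable_snd).
have F0 z : (0 <= F z)%E by rewrite mule_ge0// lee_fin.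
transitivity (\int[leb]_x \int[leb]_y F (x, y))%E.
  by apply: eq_integral => x _; apply: eq_integral => y _; rewrite EFinM.
rewrite (@fubini_tonelli _ _ _ _ _ leb leb F mF F0).
apply: eq_integral => y _; rewrite /F/=.
have mkE : measurable_fun setT (fun x => (k x)%:E) by exact/measurable_EFinP.
have kE0 x : (0 <= (k x)%:E)%E by rewrite lee_fin.
have mky : measurable_fun setT (fun x : 'rV[R]_N => (k (x - y))%:E).
  exact: (measurableT_comp mkE (measurable_rV_add (- y))).
have fy0 : (0 <= (f y)%:E)%E by rewrite lee_fin.
rewrite (ge0_integralZr leb measurableT mky (fun x _ => kE0 _) fy0).
by rewrite (ge0_integral_rV_shift (- y) mkE kE0) k1 mul1e.
Qed.

(** When [q = 1] and [l = N] the Morrey norm of a nonnegative function is its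
    integral: the means over balls centred at the origin increase to it. *)
Lemma morrey_norm_average_expw :
  morrey_norm 1%:E N%:R (average k u) = morrey_norm 1%:E N%:R (EFin \o u).
Proof.
have mu : measurable_fun setT u by exact: measurable_expw.
have u0 x : 0 <= u x by exact: expw_ge0.
have su := morrey_norm_average_le mk k0 k1 (lexx 1) mu expw01 morrey_norm_expw_lty.
apply/eqP; rewrite eq_le su andTb.
have sfin := le_lt_trans su morrey_norm_expw_lty.
rewrite (average_raverage mk k0 k1 mu expw01) in sfin *.
have sfn : morrey_norm 1%:E N%:R (EFin \o raverage k u) \is a fin_num.
  by rewrite ge0_fin_numE// morrey_norm_ge0.
pose c := fine (morrey_norm 1%:E N%:R (EFin \o raverage k u)).
have c0 : 0 <= c by rewrite fine_ge0// morrey_norm_ge0.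
have cP := (morrey_norm_leP N%:R ltr01 (raverage k u) c0).1.
rewrite /c fineK// lexx in cP; move/(_ isT) : cP; rewrite -/c powRr1// => cP.
have s0 x : 0 <= raverage k u x by have /andP[] := raverage01 mk k0 k1 mu expw01 x.
have msE : measurable_fun setT (fun x => (raverage k u x)%:E).
  by apply/measurable_EFinP; exact: (measurable_raverage mk k0 k1 mu expw01).
have tot : (\int[leb]_x (u x)%:E <= c%:E)%E.
  rewrite -integral_average// (average_raverage mk k0 k1 mu expw01).
  have U : \bigcup_n eball (0 : 'rV[R]_N) n%:R = setT.
    apply/seteqP; split => // y _; exists (Num.truncn (enorm y)).+1 => //.
    by rewrite /eball/= subr0 truncnS_gt.
  have : (\int[leb]_(y in eball 0 n%:R) (raverage k u y)%:E)%E @[n --> \oo] -->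
      (\int[leb]_y (raverage k u y)%:E)%E.
    rewrite -U; apply: ge0_nondecreasing_set_cvg_integral.
    - move=> n p np; apply/subsetPset => y; rewrite /eball/= => /lt_le_trans; apply.
      by rewrite ler_nat.
    - by move=> n; exact: measurable_eball.
    - by move=> n; exact: measurable_funTS.
    - by move=> n y _; rewrite lee_fin.
  move=> /cvge_to_le; apply; apply: nearW => n.
  have [->|n0] := posnP n.
    rewrite (_ : eball _ _ = set0) ?integral_set0 ?lee_fin//.
    apply/seteqP; split => // y; rewrite /eball/= => y0.
    by have := sqrtr_ge0 (dotp (y - 0) (y - 0)); rewrite leNgt y0.
  by rewrite -morrey_mean1//; apply: cP; rewrite ltr0n.
rewrite -(fineK sfn) -/c; apply/(morrey_norm_leP N%:R ltr01 u c0) => x0 r r0.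
rewrite powRr1// morrey_mean1//; apply: le_trans tot.
apply: ge0_subset_integral => //.
- exact: measurable_eball.
- exact/measurable_EFinP.
- by move=> x _; rewrite lee_fin.
Qed.

End integrable_case.

Theorem proposition6p2 (R : realType) (N : nat) (mu l : R) (p : \bar R)
  (hN : (0 < N)%N) (hmu0 : 0 < mu) (hmu1 : mu <= 1)
  (hpl : (1 <= p)%E /\ 0 < l < N%:R \/ p = 1%E /\ l = N%:R) :
  exists2 u0 : 'rV[R]_N -> R, dotted_morrey p l u0 &
    exists2 c : R, 0 < c &
      forall t : R, 0 < t ->
        morrey_norm p l (frac_heat_semigroup mu t u0) = c%:E.
Proof.
have mk t := @measurable_frac_heat_kernel R N mu t hmu0.
have k0 t (t0 : 0 < t) := frac_heat_kernel_ge0 hN hmu0 hmu1 t0.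
have k1 t (t0 : 0 < t) := integral_frac_heat_kernel hN hmu0 hmu1 t0.
have SE t u : frac_heat_semigroup mu t u = average (@frac_heat_kernel R N mu t) u by [].
have l1cube x : cube (0 : 'rV[R]_N) 1 x -> l1norm x <= N%:R.
  move=> cx; rewrite -[N in N%:R]card_ord -sumr_const; apply: ler_sum => i _.
  by have := cx i; rewrite /= in_itv/= mxE !add0r -ler_norml.
have finish q (u : 'rV[R]_N -> R) : 1 <= q -> (morrey_norm q%:E l (EFin \o u) < +oo)%E ->
    (0 < morrey_norm q%:E l (EFin \o u))%E -> dotted_morrey q%:E l u ->
    (forall t, 0 < t -> morrey_norm q%:E l (frac_heat_semigroup mu t u) =
      morrey_norm q%:E l (EFin \o u)) ->
    exists2 u0 : 'rV[R]_N -> R, dotted_morrey q%:E l u0 &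
    exists2 c : R, 0 < c & forall t : R, 0 < t ->
        morrey_norm q%:E l (frac_heat_semigroup mu t u0) = c%:E.
  move=> q1 ufin upos du us; exists u => //.
  exists (fine (morrey_norm q%:E l (EFin \o u))).
    by apply: fine_gt0; rewrite upos ufin.
  by move=> t t0; rewrite us// fineK// ge0_fin_numE// morrey_norm_ge0.
case: hpl => [[p1 /andP[l0 lN]]|[-> lN]]; last first.
  have mu_ : measurable_fun setT (@expw R N 1) by exact: measurable_expw.
  have ufin : (morrey_norm 1%:E l (EFin \o @expw R N 1) < +oo)%E.
    by rewrite lN; exact: morrey_norm_expw_lty.
  apply: (finish 1 (@expw R N 1)) => //.
  - apply: (@morrey_norm_gt0 _ _ _ _ _ (lexx 1) mu_ (expR (- N%:R))).
      exact: expR_gt0.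
    by move=> x cx; rewrite expw1E ler_expR lerN2 l1cube.
  - apply: (@dotted_morrey_slowly_varying _ _ _ _ _ expR (lexx 1) mu_ expw01) => //.
      exact: expw_shift.
    by have := @continuous_expR R 0; rewrite /continuous_at expR0.
  - move=> t t0; rewrite SE lN.
    exact: (morrey_norm_average_expw (mk t t0) (k0 t t0) (k1 t t0)).
case: p p1 => [q| |] // q1; last first.
  have leb0 : (0 < lebesgue_rV N [set: 'rV[R]_N])%E.
    apply: (@lt_le_trans _ _ (lebesgue_rV N (cube (0 : 'rV[R]_N) 1))).
      by rewrite lebesgue_cube// lte_fin exprn_gt0// mulr1.
    by apply: le_measure; [apply: mem_set; exact: measurable_cube|exact: mem_set|].
  have n1 : ('N[lebesgue_rV N]_+oo[(fun=> 1%:E) : 'rV[R]_N -> \bar R] = 1%:E)%E.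
    rewrite unlock /Lnorm leb0 (ess_sup_ae_cst 1%:E)//.
    by apply: nearW => x /=; rewrite normr1.
  exists (fun=> 1).
    split.
      rewrite /morrey/= inE/=; apply/andP; split; first by apply: mem_set; exact: measurable_cst.
      by rewrite /finLfun; apply: mem_set => /=; rewrite /finite_norm n1 ltry.
    rewrite /morrey_norm subrr (@Lnorm0 _ _ _ (lebesgue_rV N) +oo%E)//.
    by apply: (@cvg_near_cst _ _ _ _ (nbhs (0 : 'rV[R]_N))); apply: nearW.
  exists 1 => // t t0.
  rewrite SE (_ : average _ _ = fun=> 1%:E)//.
  by apply/funext => x; exact: (average_cst (mk t t0) (k0 t t0) (k1 t t0)).
have {}q1 : 1 <= q by rewrite -lee_fin.
have a0 : 0 < l / q by rewrite divr_gt0// (lt_le_trans ltr01).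
have mu_ := @measurable_profile R N q l.
have u01 := @profile01 R N q l q1 l0.
have ufin := morrey_norm_profile_lty q1 l0 lN.
apply: (finish q (@profile R N q l)) => //.
- apply: (@morrey_norm_gt0 _ _ _ _ _ q1 mu_ ((1 + N%:R) `^ (- (l / q)))).
    by rewrite powR_gt0// ltr_pwDl.
  move=> x cx; apply: le_profile => //; first by rewrite ltr_pwDl// l1norm_ge0.
  by rewrite lerD2l l1cube.
- apply: (@dotted_morrey_slowly_varying _ _ _ _ _ (fun s => (1 + s) `^ (l / q)) q1 mu_ u01) => //.
    exact: profile_shift.
  exact: profile_modulus_cvg.
- move=> t t0; rewrite SE.
  exact: (morrey_norm_average_profile (mk t t0) (k0 t t0) (k1 t t0)).
Qed.
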